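(* Let $m,N$ be positive integers of arbitrary parities. For every $k\ge1$, the homology of the Hodge degree $k$ part of the two-loop hairy graph-complex $0\to\mathcal C_2\to\mathcal C_1\to\mathcal C_0\to0$ (with rational coefficients) is concentrated in a single degree, i.e. at most one of its homology groups $H_0,H_1,H_2$ is non-zero in Hodge degree $k$.
   Context: Let $m,N$ be positive integers; all coefficients are in $\mathbb Q$. Graph-complex $\mathcal E^{m,N}_\pi$. It is spanned by connected graphs (self-loops and multiple edges allowed) with a non-empty finite set of unlabeled external vertices of valence $1$ and a possibly empty finite set of unlabeled internal vertices of valence $\ge3$. The orientation set of a graph is the union of its external vertices (each of degree $-m$), internal vertices (each of degree $-N$) and edges (each of degree $N-1$). An orientation of a graph is a total order of its orientation set together with an orientation of every edge. Isomorphic oriented graphs (isomorphism respecting adjacency, edge orientations and the order) are identified. One takes the quotient of the $\mathbb Q$-vector space spanned by isomorphism classes of oriented graphs by the relations: reversing the orientation of one edge multiplies by $(-1)^N$; permuting the orientation set multiplies by the Koszul sign of the permutation, computed from the degrees of the elements. The differential $\partial\Upsilon$ is the sum, over all internal vertices $v$ and all unordered partitions of the half-edges at $v$ into two sets of size $\ge2$, of the graph obtained by replacing $v$ by a new edge joining two vertices, the half-edges of one set being attached to one endpoint and those of the other set to the other endpoint; one endpoint is regarded as the old vertex $v$, the other one as the new vertex; the new vertex and the new edge are added as the first and second elements of the ordered orientation set, and the new edge is oriented from the old vertex to the new one (the choice of which endpoint is new does not matter). Hairy graphs. An edge of a connected graph is tree-type if removing it disconnects the graph into two parts, exactly one of which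 is a tree. The frame is the subgraph generated by the edges that are not tree-type. A hair is a tree-type edge one of whose endpoints is univalent and whose other endpoint lies in the frame and has no other tree-type edges adjacent to it. A vertex is a cut vertex if removing it (as a point of the topological space) disconnects the graph. A two-loop hairy graph is a connected graph (self-loops and multiple edges allowed) with a non-empty finite set of unlabeled external vertices of valence $1$ and a finite set of unlabeled internal vertices of valence $\ge3$, of first Betti number $2$, whose frame has no cut vertices and all of whose tree-type edges are hairs; its frame is a (subdivided) $\Theta$-graph. The Hodge degree is the number of external vertices (i.e. of hairs). The defect is $\sum_v(|v|-3)$ over the internal vertices $v$, where $|v|$ is the valence; for two-loop hairy graphs it is $0$, $1$ or $2$. Let $\mathcal C_i\subset\mathcal E^{m,N}_\pi$ be the span of the two-loop hairy graphs of defect $i$. The differential $\partial$ preserves Hodge degree and lowers the defect by $1$, giving the two-loop hairy graph-complex $0\to\mathcal C_2\xrightarrow{\partial_2}\mathcal C_1\xrightarrow{\partial_1}\mathcal C_0\to0$, with $H_i=\ker\partial_i/\operatorname{im}\partial_{i+1}$. *)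

(* Defs.v *)
From HB Require Import structures.
From mathcomp Require Import freeg.
From mathcomp Require Import all_boot ssralg ssrnum ssrint rat.
From mathcomp Require Import fingroup perm.
From mathcomp Require Import generic_quotient ring_quotient.
From mathcomp Require Import boolp.

Set Implicit Arguments.
Unset Strict Implicit.
Unset Printing Implicit Defensive.

Import GRing.Theory.
Local Open Scope ring_scope.
Local Open Scope quotient_scope.

Definition sum_map (A B A' B' : Type) (f : A -> A') (g : B -> B')
    (x : A + B) : A' + B' :=
  match x with inl a => inl (f a) | inr b => inr (g b) end.

Lemma sum_map_inj (A B A' B' : Type) (f : A -> A') (g : B -> B') :
  injective f -> injective g -> injective (sum_map f g).
Proof.
move=> fI gI [x|x] [y|y] //= eq_xy; congr (_ _).
  by apply: fI; case: eq_xy.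
by apply: gI; case: eq_xy.
Qed.

(** ** Oriented graphs *)

Definition total_order_of (T : finType) := {s : seq T | perm_eq s (enum T)}.

(* A graph with [nx] external vertices, [ni] internal vertices and [ne] edges;
   every finite graph is isomorphic to one of these.  The half-edges are the
   pairs (e, b); the edge e is oriented from its half-edge (e, false) to its
   half-edge (e, true), and [ends] gives the vertex to which a half-edge is
   attached.  Admissibility (connectedness, valences) is imposed separately. *)
Record ograph := OGraph {
  nx : nat;
  ni : nat;
  ne : nat;
  ends : {ffun 'I_ne * bool -> 'I_nx + 'I_ni};
  order : total_order_of ('I_nx + 'I_ni + 'I_ne)%type
}.

HB.instance Definition _ := gen_eqMixin ograph.
HB.instance Definition _ := gen_choiceMixin ograph.

Notation vertex g := ('I_(nx g) + 'I_(ni g))%type.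
Notation edge g := 'I_(ne g).
Notation half g := ('I_(ne g) * bool)%type.
Notation element g := ('I_(nx g) + 'I_(ni g) + 'I_(ne g))%type.

Definition halves (g : ograph) (v : vertex g) : {set half g} :=
  [set h | ends g h == v].

Definition valence (g : ograph) (v : vertex g) : nat := #|halves v|.

(* In terms of the endpoints only, an isomorphism respecting the edge
   orientations; the action on half-edges is determined by that on edges. *)
Definition oiso (g h : ograph) : Prop :=
  exists (fx : 'I_(nx g) -> 'I_(nx h)) (fi : 'I_(ni g) -> 'I_(ni h))
         (fe : edge g -> edge h),
    [/\ bijective fx, bijective fi & bijective fe] /\
    (forall e b, ends h (fe e, b) = sum_map fx fi (ends g (e, b))) /\
    val (order h) = map (sum_map (sum_map fx fi) fe) (val (order g)).

Definition flip_half (g : ograph) (e : edge g) (h : half g) : half g :=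
  (h.1, if h.1 == e then ~~ h.2 else h.2).

Definition flip (g : ograph) (e : edge g) : ograph :=
  @OGraph (nx g) (ni g) (ne g) [ffun h => ends g (flip_half e h)] (order g).

Definition reorder (g : ograph) (o : total_order_of (element g)) : ograph :=
  @OGraph (nx g) (ni g) (ne g) (ends g) o.

(** ** The space of oriented graphs modulo the orientation relations *)

Definition degree (m N : nat) (A B C : Type) (x : A + B + C) : int :=
  match x with
  | inl (inl _) => - m%:Z
  | inl (inr _) => - N%:Z
  | inr _ => N%:Z - 1
  end.

(* The Koszul sign of the permutation taking the total order s to t: one factor
   for each pair of elements whose relative order changes. *)
Definition koszul (T : finType) (deg : T -> int) (s t : seq T) : rat :=
  \prod_(x : T)
    \prod_(y : T | (index x s < index y s)%N && (index y t < index x t)%N)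
      (-1) ^ (deg x * deg y).

Definition chains := {freeg ograph / rat}.

Inductive span (V : lmodType rat) (S : V -> Prop) : V -> Prop :=
| span0 : span S 0
| spanD a x y of S x & span S y : span S (a *: x + y).

Inductive orientation_relation (m N : nat) : chains -> Prop :=
| rel_iso g h of oiso g h :
    orientation_relation m N (<< g >> - << h >>)
| rel_flip g e :
    orientation_relation m N (<< @flip g e >> - (-1) ^+ N *: << g >>)
| rel_reorder g o :
    orientation_relation m N
      (<< @reorder g o >>
       - koszul (@degree m N _ _ _) (val (order g)) (val o) *: << g >>).

Definition relations (m N : nat) : {pred chains} :=
  fun x => `[< span (orientation_relation m N) x >].

Section Span.
Variables (V : lmodType rat) (S : V -> Prop).

Lemma span_gen x : S x -> span S x.
Proof. by move=> Sx; rewrite -[x]addr0 -[x]scale1r; apply: spanD (span0 _). Qed.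

Lemma span_submod a x y : span S x -> span S y -> span S (a *: x + y).
Proof.
elim=> [|b u v Su _ IH] Sy; first by rewrite scaler0 add0r.
by rewrite scalerDr scalerA -addrA; apply: spanD (IH Sy).
Qed.

Lemma span_min (P : V -> Prop) :
    P 0 -> (forall a x y, S x -> P y -> P (a *: x + y)) ->
  forall x, span S x -> P x.
Proof. by move=> P0 PD x; elim=> // a u v Su _; apply: PD. Qed.

End Span.

Lemma relations_submod m N : submod_closed (relations m N).
Proof.
split=> [|a x y /asboolP Rx /asboolP Ry]; apply/asboolP; first exact: span0.
exact: span_submod.
Qed.

HB.instance Definition _ m N :=
  GRing.isSubmodClosed.Build rat chains (relations m N) (relations_submod m N).

Definition graph_space (m N : nat) := Quotient.quot (relations m N).

HB.instance Definition _ m N := GRing.Zmodule.on (graph_space m N).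
HB.instance Definition _ m N := EqQuotient.on (graph_space m N).

Section GraphSpace.
Variables m N : nat.
Local Notation E := (graph_space m N).

Definition proj (x : chains) : E := \pi_E x.

Lemma projP x y : (proj x = proj y) <-> x - y \in relations m N.
Proof.
rewrite /proj; split=> [/eqP|xy]; [|apply/eqP].
  by rewrite -Quotient.idealrBE.
by rewrite -Quotient.idealrBE.
Qed.

Lemma proj_repr (c : E) : proj (repr c) = c.
Proof. exact: reprK. Qed.

Fact proj_zmod : zmod_morphism proj.
Proof. by move=> x y; rewrite /proj !piE. Qed.
HB.instance Definition _ := GRing.isZmodMorphism.Build chains E proj proj_zmod.

Definition qscale (a : rat) (c : E) : E := proj (a *: repr c).

Lemma qscaleE a x : qscale a (proj x) = proj (a *: x).
Proof.
by apply/projP; rewrite -scalerBr rpredZ //; apply/projP; rewrite proj_repr.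
Qed.

Fact qscaleA a b c : qscale a (qscale b c) = qscale (a * b) c.
Proof. by rewrite -[c]proj_repr !qscaleE scalerA. Qed.
Fact qscale1 : left_id 1 qscale.
Proof. by move=> c; rewrite -[c]proj_repr !qscaleE scale1r. Qed.
Fact qscaleDr : right_distributive qscale +%R.
Proof.
by move=> a c d; rewrite -[c]proj_repr -[d]proj_repr -raddfD !qscaleE scalerDr raddfD.
Qed.
Fact qscaleDl c : {morph qscale^~ c : a b / a + b}.
Proof. by move=> a b; rewrite -[c]proj_repr !qscaleE scalerDl raddfD. Qed.

HB.instance Definition _ :=
  GRing.Zmodule_isLmodule.Build rat E qscaleA qscale1 qscaleDr qscaleDl.

Fact proj_scalable : scalable proj.
Proof. by move=> a x; rewrite -qscaleE. Qed.
HB.instance Definition _ := GRing.isScalable.Build rat chains E *:%R proj proj_scalable.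

End GraphSpace.

(** ** The differential *)

Section Expansion.
Variables (g : ograph) (v : 'I_(ni g)) (S : {set half g}).

(* The old vertex v and the old elements are embedded by [lift ord0]; the new
   internal vertex and the new edge have index [ord0].  The half-edges in S are
   moved to the new vertex. *)
Definition expand_vertex : vertex g -> 'I_(nx g) + 'I_(ni g).+1 :=
  sum_map id (lift ord0).

Definition expand_element : element g -> 'I_(nx g) + 'I_(ni g).+1 + 'I_(ne g).+1 :=
  sum_map expand_vertex (lift ord0).

Definition expand_ends (h : 'I_(ne g).+1 * bool) : 'I_(nx g) + 'I_(ni g).+1 :=
  match unlift ord0 h.1 with
  | Some e => if (e, h.2) \in S then inr ord0 else expand_vertex (ends g (e, h.2))
  | None => if h.2 then inr ord0 else inr (lift ord0 v)
  end.

Definition expand_seq (s : seq (element g)) :=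
  inl (inr ord0) :: inr ord0 :: map expand_element s.

Fact expand_element_inj : injective expand_element.
Proof.
have vi : injective expand_vertex.
  by apply: sum_map_inj => //; apply: lift_inj.
by apply: sum_map_inj => //; apply: lift_inj.
Qed.

Fact expand_seq_subproof (o : total_order_of (element g)) :
  perm_eq (expand_seq (val o)) (enum {: 'I_(nx g) + 'I_(ni g).+1 + 'I_(ne g).+1}).
Proof.
case: o => s /= ps.
have us : uniq s by rewrite (perm_uniq ps) enum_uniq.
have ms x : x \in s by rewrite (perm_mem ps) mem_enum.
apply: uniq_perm; rewrite ?enum_uniq //=.
  rewrite (map_inj_uniq expand_element_inj) us inE /= andbT.
  by apply/andP; split; apply/mapP => -[[[x|x]|x] _].
move=> [[x|x]|x]; rewrite mem_enum !inE /=.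
- by apply/mapP; exists (inl (inl x)).
- by case: (unliftP ord0 x) => [y ->|-> //]; apply/orP; right; apply/mapP; exists (inl (inr y)).
- case: (unliftP ord0 x) => [y ->|->]; last by rewrite eqxx.
  by apply/orP; right; apply/mapP; exists (inr y).
Qed.

Definition expand : ograph :=
  @OGraph (nx g) (ni g).+1 (ne g).+1 (finfun expand_ends)
    (Sub (expand_seq (val (order g))) (expand_seq_subproof (order g))).

End Expansion.

(* Unordered partitions of the half-edges at v into two sets of size >= 2. *)
Definition splittings (g : ograph) (v : 'I_(ni g)) : {set {set {set half g}}} :=
  [set P | [&& partition P (halves (inr v : vertex g)), #|P| == 2%N &
               [forall S in P, (2 <= #|S|)%N]]].

(* The block attached to the new vertex; either choice gives the same class, see
   [cls_new_block]. *)
Definition new_block (T : finType) (P : {set {set T}}) : {set T} :=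
  odflt set0 [pick S in P].

Definition graph_boundary (g : ograph) : chains :=
  \sum_(v : 'I_(ni g)) \sum_(P in splittings v) << expand v (new_block P) >>.

Definition chain_boundary : chains -> chains := fglift graph_boundary.

Definition boundary (m N : nat) (c : graph_space m N) : graph_space m N :=
  proj m N (chain_boundary (repr c)).

(** *** The differential is well defined *)

Lemma prod_inj (A B : finType) (f : A -> B) (G : B -> rat) :
    injective f -> (forall y, y \notin codom f -> G y = 1) ->
  \prod_y G y = \prod_x G (f x).
Proof.
move=> fI G1; rewrite -(big_imset (h := f) (A := predT) G); last by move=> ? ? _ _; apply: fI.
rewrite (bigID (mem (codom f))) /= [X in _ * X]big1 ?mulr1 //.
apply: eq_bigl => y; apply/codomP/imsetP => [[x ->]|[x _ ->]]; first by exists x.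
by exists x.
Qed.

Lemma koszulE (T : finType) (deg : T -> int) (s t : seq T) :
  koszul deg s t = \prod_x \prod_y
    (if (index x s < index y s)%N && (index y t < index x t)%N
     then (-1) ^ (deg x * deg y) else 1).
Proof. by apply: eq_bigr => x _; rewrite big_mkcond. Qed.

Lemma koszul_expand (m N : nat) (g : ograph) (s t : seq (element g)) :
  koszul (@degree m N _ _ _) (expand_seq s) (expand_seq t)
  = koszul (@degree m N _ _ _) s t.
Proof.
have eI := @expand_element_inj g.
have dE (x : element g) : degree m N (expand_element x) = degree m N x by case: x => [[x|x]|x].
have noV (x : element g) : (inl (inr ord0) == expand_element x) = false.
  by apply/eqP; case: x => [[x|x]|x].
have noE (x : element g) : (inr ord0 == expand_element x) = false by apply/eqP; case: x => [[x|x]|x].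
have iE u (x : element g) : index (expand_element x) (expand_seq u) = (index x u).+2.
  by rewrite [LHS]/= noV noE (index_map eI).
have iV u : index (inl (inr ord0)) (@expand_seq g u) = 0%N by [].
have iN u : index (inr ord0) (@expand_seq g u) = 1%N by rewrite /= ?eqxx.
have offE y : y \notin codom (@expand_element g) -> y = inl (inr ord0) \/ y = inr ord0.
  case: y => [[y|y]|y] ny; [exfalso|left|right].
  - by move/negP: ny; apply; apply/codomP; exists (inl (inl y)).
  - case: (unliftP ord0 y) ny => [z ->|-> //] /negP[].
    by apply/codomP; exists (inl (inr z)).
  - case: (unliftP ord0 y) ny => [z ->|-> //] /negP[].
    by apply/codomP; exists (inr z).
rewrite !koszulE (prod_inj eI) => [|y /offE yE]; last first.
  apply: big1 => z _; case: (boolP (z \in codom (@expand_element g))) => [/codomP[x ->]|/offE zE].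
    by case: yE => ->; rewrite ?iV ?iN ?iE.
  by case: yE => ->; case: zE => ->; rewrite ?iV ?iN.
apply: eq_bigr => x _; rewrite (prod_inj eI) => [|y /offE yE]; last first.
  by case: yE => ->; rewrite ?iV ?iN ?iE.
by apply: eq_bigr => y _; rewrite !iE !ltnS !dE.
Qed.

Lemma koszul_swap (T : finType) (deg : T -> int) (s : seq T) (a b : T) :
    uniq s -> (forall x, x \in s) -> (index a s < index b s)%N -> deg a = deg b ->
  koszul deg s (map (tperm a b) s) = (-1) ^ (deg a * deg a).
Proof.
move=> us ms ltab dab; rewrite koszulE.
pose p x := index x s.
have pt x : index x (map (tperm a b) s) = p (tperm a b x).
  by rewrite -{1}[x](tpermK a b) index_map //; apply: perm_inj.
have ab : a != b by apply: contraTneq ltab => ->; rewrite ltnn.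
pose F x y : rat := if (p x < p y)%N && (p (tperm a b y) < p (tperm a b x))%N
           then (-1) ^ (deg x * deg y) else 1.
transitivity (\prod_x \prod_y F x y).
  by apply: eq_bigr => x _; apply: eq_bigr => y _; rewrite !pt.
have ltF x y : (p x < p y)%N -> (p y < p x)%N = false by move=> l; apply/negbTE; rewrite -leqNgt ltnW.
have Fbb : F b b = 1 by rewrite /F ltnn.
have Faa : F a a = 1 by rewrite /F ltnn.
have F1 x y : x != a -> y != b -> F x y = 1.
  move=> xa yb; rewrite /F; have [->|xb] := eqVneq x b.
    have [->|ya] := eqVneq y a; first by rewrite ltF.
    rewrite tpermR tpermD 1?eq_sym //; case: ifP => // /andP[l1 l2].
    by have := ltn_trans (ltn_trans l1 l2) ltab; rewrite ltnn.
  have [->|ya] := eqVneq y a.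
    rewrite tpermL tpermD 1?eq_sym //; case: ifP => // /andP[l1 l2].
    by have := ltn_trans (ltn_trans l1 ltab) l2; rewrite ltnn.
  rewrite !tpermD 1?eq_sym //; case: ifP => // /andP[l1 l2].
  by rewrite ltF in l2.
rewrite (bigD1 a) //=.
have -> : \prod_(x | x != a) \prod_y F x y = \prod_(x | x != a) F x b.
  apply: eq_bigr => x xa; rewrite (bigD1 b) //= big1 ?mulr1 // => y yb.
  exact: F1.
rewrite (bigD1 b) //= -mulrA.
have -> : \prod_(y | y != b) F a y = \prod_(y | (y != a) && (y != b)) F a y.
  by rewrite (bigD1 a) //= Faa mul1r; apply: eq_bigl => y; rewrite andbC.
have -> : \prod_(x | x != a) F x b = \prod_(x | (x != a) && (x != b)) F x b.
  by rewrite (bigD1 b) 1?eq_sym //= Fbb mul1r.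
rewrite -big_split /= big1 ?mulr1.
  by rewrite /F tpermL tpermR ltab /= dab.
move=> z /andP[za zb].
rewrite /F tpermL tpermR !(tpermD (z := z)) 1?eq_sym //.
rewrite (andbC (p z < p b)%N); case: ifP => _; last by rewrite mulr1.
by rewrite -dab (mulrC (deg z)) -expfzMl mulrNN mul1r exp1rz.
Qed.

HB.instance Definition _ (M : lmodType rat) (K : choiceType) (f : K -> M) :=
  GRing.isZmodMorphism.Build {freeg K / rat} M (fglift f) (lift_is_additive f).

Lemma fglift_is_scalable (M : lmodType rat) (K : choiceType) (f : K -> M) :
  scalable (fglift f).
Proof.
move=> a D; rewrite -[D]freeg_sumE.
have -> : a *: (\sum_(x <- dom D) << coeff x D *g x >>)
          = \sum_(x <- dom D) << a * coeff x D *g x >>.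
  rewrite scaler_sumr; apply: eq_bigr => x _; apply/eqP/freeg_eqP => y.
  by rewrite coeffZ !coeffU mulrA.
rewrite !raddf_sum /=; apply: eq_bigr => x _.
by rewrite !liftU scalerA.
Qed.

HB.instance Definition _ (M : lmodType rat) (K : choiceType) (f : K -> M) :=
  GRing.isScalable.Build rat {freeg K / rat} M *:%R (fglift f) (fglift_is_scalable f).

HB.instance Definition _ := GRing.Linear.copy chain_boundary (fglift graph_boundary).

Section Classes.
Variables m N : nat.

Definition cls (g : ograph) : graph_space m N := proj m N << g >>.

Lemma proj_rel x : orientation_relation m N x -> proj m N x = 0.
Proof.
move=> Rx; rewrite -(raddf0 (proj m N)); apply/projP; rewrite subr0.
by apply/asboolP; apply: span_gen.
Qed.

Lemma cls_iso g h : oiso g h -> cls h = cls g.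
Proof. by move=> /rel_iso-/(_ m N)/proj_rel/eqP; rewrite raddfB subr_eq0 => /eqP. Qed.

Lemma cls_flip g e : cls (@flip g e) = (-1) ^+ N *: cls g.
Proof.
have /eqP := proj_rel (rel_flip m N e).
by rewrite raddfB /= linearZ subr_eq0 => /eqP.
Qed.

Lemma cls_reorder g o :
  cls (@reorder g o)
  = koszul (@degree m N _ _ _) (val (order g)) (val o) *: cls g.
Proof.
have /eqP := proj_rel (rel_reorder m N o).
by rewrite raddfB /= linearZ subr_eq0 => /eqP.
Qed.


Lemma ograph_eq (x i e : nat) (E1 E2 : {ffun 'I_e * bool -> 'I_x + 'I_i})
    (o1 o2 : total_order_of ('I_x + 'I_i + 'I_e)%type) :
  E1 =1 E2 -> val o1 = val o2 -> OGraph E1 o1 = OGraph E2 o2.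
Proof. by move=> /ffunP-> /val_inj->. Qed.

Lemma cls_expand_compl (g : ograph) (v : 'I_(ni g)) (S : {set half g}) :
    S \subset halves (inr v : vertex g) ->
  cls (expand v S) = cls (expand v (halves (inr v : vertex g) :\: S)).
Proof.
set H := halves _ => sSH; set g1 := expand v S; set g2 := expand v (H :\: S).
pose tau : {perm 'I_(ni g).+1} := tperm ord0 (lift ord0 v).
have ordP (o : total_order_of (element g2)) : uniq (val o) /\ forall x, x \in val o.
  case: o => s /= ps; rewrite (perm_uniq ps) enum_uniq; split=> // x.
  by rewrite (perm_mem ps) mem_enum.
have [us ms] := ordP (order g2).
pose a : element g2 := inl (inr ord0); pose b : element g2 := inl (inr (lift ord0 v)).
have tE x : sum_map (sum_map id tau) id x = tperm a b x.
  case: x => [[x|x]|x] /=; [by rewrite tpermD| |by rewrite tpermD].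
  rewrite /tau; have [->|x0] := eqVneq x ord0; first by rewrite !tpermL.
  have [->|xv] := eqVneq x (lift ord0 v); first by rewrite !tpermR.
  rewrite tpermD 1?eq_sym // tpermD //; apply/eqP => /esym; case=> /eqP.
    by rewrite (negbTE x0).
  by rewrite (negbTE xv).
have po : perm_eq (map (tperm a b) (val (order g2))) (enum {: element g2}).
  apply: uniq_perm; rewrite ?enum_uniq // ?map_inj_uniq //; first exact: perm_inj.
  move=> x; rewrite mem_enum; apply/mapP; exists (tperm a b x) => //.
  by rewrite tpermK.
pose o' : total_order_of (element g2) :=
  exist (fun s => is_true (perm_eq s (enum {: element g2}))) _ po.
have -> : cls g1 = cls (@reorder (@flip g2 ord0) o').
  apply/esym/cls_iso; exists id, tau, id; split; first by split; [exists id|exists tau; exact: tpermK|exists id].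
  split=> [e c|].
    rewrite !ffunE /flip_half /expand_ends /=; case: (unliftP ord0 e) => [e' ->|->].
      have -> : (lift ord0 e' == ord0) = false by rewrite eq_sym (negbTE (neq_lift _ _)).
      rewrite in_setD.
      have [eS|eS] := boolP ((e', c) \in S) => /=.
        have := subsetP sSH _ eS; rewrite inE => /eqP ->.
        by rewrite /tau tpermL.
      case: ifP => [eH|].
        by move: eH; rewrite inE => /eqP ->; rewrite /= /tau tpermR.
      rewrite inE; case: (ends g (e', c)) => //= w.
      move=> /negbT nw; rewrite /tau tpermD //.
      by rewrite (inj_eq (@lift_inj _ _)) eq_sym; apply: contra nw => /eqP->.
    by case: c; rewrite /= /tau ?tpermL ?tpermR.
  exact: (eq_map (fun x => esym (tE x)) (val (order g2))).
rewrite cls_reorder /= cls_flip scalerA koszul_swap //=.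
rewrite mulrNN -PoszM -exprnP -exprD -signr_odd oddD oddM andbb addbb.
by rewrite expr0 scale1r.
Qed.

Lemma splittingsP (g : ograph) (v : 'I_(ni g)) (P : {set {set half g}}) S T :
    P \in splittings v -> S \in P -> T \in P ->
  S \subset halves (inr v : vertex g) /\
  (T = S \/ T = halves (inr v : vertex g) :\: S).
Proof.
rewrite inE => /and3P[PH /cards2P[A [B [nAB defP]]] _] PS PT.
split; first by rewrite -(cover_partition PH) (bigcup_sup S).
have [->|nTS] := eqVneq T S; [by left|right].
have defP' : P = [set S; T].
  apply/esym/eqP; rewrite eqEcard subUset !sub1set PS PT /= defP !cards2 nAB.
  by rewrite eq_sym nTS.
have dST : [disjoint S & T].
  by case/and3P: PH => _ /trivIsetP/(_ S T PS PT) + _; apply; rewrite eq_sym.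
rewrite -(cover_partition PH) /cover defP' bigcup_setU !big_set1.
by rewrite setDUl setDv set0U; apply/esym/setDidPl; rewrite disjoint_sym.
Qed.

Lemma cls_new_block (g : ograph) (v : 'I_(ni g)) (P : {set {set half g}}) S :
  P \in splittings v -> S \in P -> cls (expand v (new_block P)) = cls (expand v S).
Proof.
move=> vP PS; rewrite /new_block; case: pickP => [T PT|/(_ S)]; last by rewrite PS.
have [sTH [->//|->]] := splittingsP vP PT PS.
exact: cls_expand_compl.
Qed.

Lemma imset_bijective (A B : finType) (f : A -> B) :
  bijective f -> bijective (fun S : {set A} => f @: S).
Proof.
case=> f' fK f'K; exists (fun S : {set B} => f' @: S) => S.
  by rewrite -imset_comp (eq_imset (g := id)) ?imset_id.
by rewrite -imset_comp (eq_imset (g := id)) ?imset_id.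
Qed.

Lemma imset_splittings (g h : ograph) (phi : half g -> half h)
    (v : 'I_(ni g)) (w : 'I_(ni h)) (P : {set {set half g}}) :
    injective phi -> halves (inr w : vertex h) = phi @: halves (inr v : vertex g) ->
  ([set phi @: S | S : {set half g} in P] \in splittings w) = (P \in splittings v).
Proof.
move=> phiI Hw; rewrite !inE Hw imset_partition // card_imset; last exact: imset_inj.
congr [&& _, _ & _]; apply/forall_inP/forall_inP => [gt1 S PS|gt1 _ /imsetP[S PS ->]].
  by rewrite -(card_imset _ phiI) gt1 ?imset_f.
by rewrite card_imset ?gt1.
Qed.

Lemma proj_graph_boundary (g : ograph) :
  proj m N (graph_boundary g)
  = \sum_(v : 'I_(ni g)) \sum_(P in splittings v) cls (expand v (new_block P)).
Proof. by rewrite raddf_sum; apply: eq_bigr => v _; rewrite raddf_sum. Qed.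

Lemma proj_graph_boundary_eq (g h : ograph) (c : rat)
    (phi : half g -> half h) (fi : 'I_(ni g) -> 'I_(ni h)) :
    bijective phi -> bijective fi ->
    (forall v, halves (inr (fi v) : vertex h) = phi @: halves (inr v : vertex g)) ->
    (forall v (S : {set half g}), cls (expand (fi v) (phi @: S)) = c *: cls (expand v S)) ->
  proj m N (graph_boundary h) = c *: proj m N (graph_boundary g).
Proof.
move=> phiB fiB Hphi clsE; rewrite !proj_graph_boundary scaler_sumr.
rewrite (reindex fi) /=; last exact: onW_bij.
apply: eq_bigr => v _; rewrite scaler_sumr.
have [psi phiK psiK] := phiB; have phiI := can_inj phiK.
pose Phi (P : {set {set half g}}) := [set phi @: S | S : {set half g} in P].
have PhiB : bijective Phi by do 2![apply: imset_bijective].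
rewrite (reindex Phi) /=; last exact: onW_bij.
rewrite (eq_bigl (fun P => P \in splittings v)) => [|P]; last first.
  exact: (imset_splittings P phiI (Hphi v)).
apply: eq_bigr => P vP.
have /set0Pn[S PS] : P != set0.
  by move: vP; rewrite inE -card_gt0 => /and3P[_ /eqP-> _].
rewrite (cls_new_block vP PS) (cls_new_block (S := phi @: S)) ?clsE //.
  by rewrite (imset_splittings P phiI (Hphi v)).
exact: imset_f.
Qed.

Definition lift_fun (p q : nat) (f : 'I_p -> 'I_q) (x : 'I_p.+1) : 'I_q.+1 :=
  if unlift ord0 x is Some y then lift ord0 (f y) else ord0.

Lemma lift_fun_bij (p q : nat) (f : 'I_p -> 'I_q) : bijective f -> bijective (lift_fun f).
Proof.
case=> f' fK f'K; exists (lift_fun f') => x; rewrite /lift_fun.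
  by case: (unliftP ord0 x) => [y ->|->]; rewrite ?liftK ?fK ?unlift_none.
by case: (unliftP ord0 x) => [y ->|->]; rewrite ?liftK ?f'K ?unlift_none.
Qed.

Lemma mem_imset_bij (A B : finType) (f : A -> B) (S : {set A}) x :
  bijective f -> (f x \in f @: S) = (x \in S).
Proof. by move=> /bij_inj fI; rewrite mem_imset. Qed.

Lemma graph_boundary_iso (g h : ograph) :
  oiso g h -> proj m N (graph_boundary h) = proj m N (graph_boundary g).
Proof.
case=> fx [fi [fe [[fxB fiB feB] [eE oE]]]].
pose phi (x : half g) : half h := (fe x.1, x.2).
have phiB : bijective phi.
  by case: feB => fe' K K'; exists (fun x => (fe' x.1, x.2)) => -[e b]; rewrite /phi /= ?K ?K'.
have sI : injective (sum_map fx fi) by apply: sum_map_inj; apply: bij_inj.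
rewrite -[RHS]scale1r; apply: (proj_graph_boundary_eq phiB fiB) => [v|v S].
  apply/setP => x; have [psi phiK psiK] := phiB; rewrite -[x]psiK mem_imset_bij //.
  by case: (psi x) => e b; rewrite !inE eE -(inj_eq sI).
rewrite scale1r; apply: cls_iso.
exists fx, (lift_fun fi), (lift_fun fe); split; first by split=> //; apply: lift_fun_bij.
have evE u : sum_map fx (lift_fun fi) (@expand_vertex g u) = @expand_vertex h (sum_map fx fi u).
  by case: u => [x|x] //=; rewrite /lift_fun liftK.
split=> [e b|].
  rewrite !ffunE /expand_ends /=; case: (unliftP ord0 e) => [e' ->|->].
    rewrite /lift_fun !liftK -[(fe e', b)]/(phi (e', b)) mem_imset_bij //.
    case: ifP => _; first by rewrite /= unlift_none.
    by rewrite evE eE.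
  rewrite /lift_fun !unlift_none; case: b => /=; rewrite ?unlift_none //.
  by rewrite liftK.
rewrite /= oE /expand_seq /= -!map_comp /lift_fun !unlift_none; congr [:: _, _ & _].
apply: eq_map => -[u|e] /=; rewrite ?liftK //.
by rewrite -evE.
Qed.

Lemma graph_boundary_flip (g : ograph) (e : edge g) :
  proj m N (graph_boundary (flip e)) = (-1) ^+ N *: proj m N (graph_boundary g).
Proof.
have phiK : involutive (flip_half e).
  by case=> f b; rewrite /flip_half /=; case: eqP => _; rewrite ?negbK.
have phiB : bijective (flip_half e) by exists (flip_half e).
apply: (@proj_graph_boundary_eq g (flip e) _ (flip_half e) id) => //; first by exists id.
  move=> v; apply/setP => x.
  by rewrite -[x in RHS]phiK mem_imset_bij // !inE ffunE.
move=> v S; rewrite -(@cls_flip (expand v S) (lift ord0 e)); congr cls.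
apply: ograph_eq => // -[f b].
rewrite !ffunE /flip_half /expand_ends /=; case: (unliftP ord0 f) => [f' ->|->].
  rewrite (inj_eq (@lift_inj _ _)) /=.
  have : ((f', b) \in flip_half e @: S) = (flip_half e (f', b) \in S).
    by rewrite -[(f', b) in LHS]phiK mem_imset_bij.
  by rewrite ffunE /flip_half /= => ->.
by rewrite (negbTE (neq_lift _ _)).
Qed.

Lemma graph_boundary_reorder (g : ograph) (o : total_order_of (element g)) :
  proj m N (graph_boundary (reorder o))
  = koszul (@degree m N _ _ _) (val (order g)) (val o) *: proj m N (graph_boundary g).
Proof.
apply: (@proj_graph_boundary_eq g (reorder o) _ id id); try by exists id.
  by move=> v; rewrite imset_id.
move=> v S; rewrite imset_id.
pose o' : total_order_of (element (expand v S)) :=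
  exist (fun s => is_true (perm_eq s _)) _ (expand_seq_subproof o).
rewrite -koszul_expand -[RHS](@cls_reorder (expand v S) o'); congr cls.
exact: ograph_eq.
Qed.

Lemma proj_chain_boundary0 x :
  x \in relations m N -> proj m N (chain_boundary x) = 0.
Proof.
have cbU g : chain_boundary << g >> = graph_boundary g.
  by rewrite /chain_boundary liftU scale1r.
move=> /asboolP; elim=> [|a u y Ru _ IH]; first by rewrite !raddf0.
rewrite 2!linearP /= IH addr0; case: Ru => [g h gh|g e|g o].
- by rewrite !linearB /= !cbU (graph_boundary_iso gh) subrr ?scaler0.
- by rewrite !linearB /= !linearZ /= !cbU graph_boundary_flip !scalerN subrr.
by rewrite !linearB /= !linearZ /= !cbU graph_boundary_reorder !scalerN subrr.
Qed.

(* [boundary] is the map induced by [chain_boundary] on the quotient. *)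
Lemma boundary_proj x : boundary (proj m N x) = proj m N (chain_boundary x).
Proof.
apply/eqP; rewrite -subr_eq0 -raddfB -raddfB; apply/eqP/proj_chain_boundary0.
by apply/projP; rewrite proj_repr.
Qed.

Fact boundary_linear : linear (@boundary m N).
Proof.
move=> a c d; rewrite -[c]proj_repr -[d]proj_repr -linearP !boundary_proj.
by rewrite !linearP.
Qed.

End Classes.

HB.instance Definition _ m N :=
  GRing.isLinear.Build rat (graph_space m N) (graph_space m N) *:%R
    (@boundary m N) (@boundary_linear m N).

(** ** Two-loop hairy graphs *)

Section Subgraphs.
Variable g : ograph.
Implicit Types (W : {set vertex g}) (A : {set edge g}).

Definition adjacent A : rel (vertex g) := fun u w =>
  [exists e in A, exists b, (ends g (e, b) == u) && (ends g (e, ~~ b) == w)].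

Definition connected W A : bool :=
  (W != set0) && [forall u in W, forall w in W, connect (adjacent A) u w].

(* The first Betti number of a connected graph (W, A). *)
Definition betti1 W A : nat := (#|A|.+1 - #|W|)%N.

Definition is_tree W A : bool := connected W A && (betti1 W A == 0%N).

Definition component A (u : vertex g) : {set vertex g} :=
  [set w | connect (adjacent A) u w].

Definition edges_within W A : {set edge g} :=
  [set e in A | [forall b, ends g (e, b) \in W]].

(* The graph minus e has at most the two components of the endpoints of e. *)
Definition tree_type (e : edge g) : bool :=
  let A := [set~ e] in
  let part b := component A (ends g (e, b)) in
  let tree_part b := is_tree (part b) (edges_within (part b) A) in
  ~~ connect (adjacent A) (ends g (e, false)) (ends g (e, true))
  && (tree_part false (+) tree_part true).

Definition frame_edges : {set edge g} := [set e | ~~ tree_type e].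
Definition frame_vertices : {set vertex g} :=
  [set ends g h | h : half g & h.1 \in frame_edges].

(* Removing the point v from the topological space of (W, A) leaves the other
   vertices and all the open edges (loops at v included). *)
Definition punctured W A (v : vertex g) : {set vertex g + edge g} :=
  [set c | match c with inl u => (u \in W) && (u != v) | inr e => e \in A end].

Definition incident : rel (vertex g + edge g) := fun c d =>
  match c, d with
  | inl u, inr e | inr e, inl u => [exists b, ends g (e, b) == u]
  | _, _ => false
  end.

Definition cut_vertex W A (v : vertex g) : bool :=
  let P := punctured W A v in
  let link c d := [&& c \in P, d \in P & incident c d] in
  ~~ [forall c in P, forall d in P, connect link c d].

Definition hair (e : edge g) : bool :=
  tree_type e &&
  [exists b, [&& valence (ends g (e, b)) == 1%N,
                 ends g (e, ~~ b) \in frame_vertices &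
                 [forall e' : edge g,
                    tree_type e' && [exists b', ends g (e', b') == ends g (e, ~~ b)]
                    ==> (e' == e)]]].

End Subgraphs.

Definition admissible (g : ograph) : bool :=
  [&& (0 < nx g)%N, connected [set: vertex g] [set: edge g],
      [forall x : 'I_(nx g), valence (inl x : vertex g) == 1%N] &
      [forall v : 'I_(ni g), (3 <= valence (inr v : vertex g))%N]].

Definition two_loop_hairy (g : ograph) : bool :=
  [&& admissible g, betti1 [set: vertex g] [set: edge g] == 2%N,
      [forall v in frame_vertices g,
         ~~ cut_vertex (frame_vertices g) (frame_edges g) v] &
      [forall e : edge g, tree_type e ==> hair e]].

Definition hodge_degree (g : ograph) : nat := nx g.

Definition defect (g : ograph) : nat :=
  (\sum_(v : 'I_(ni g)) (valence (inr v : vertex g) - 3))%N.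

(** ** The complexes and the homology *)

(* The relations only relate orientations of isomorphic graphs, so the complex
   spanned by the admissible graphs is a subspace of the ambient one. *)
Definition graph_complex (m N : nat) : graph_space m N -> Prop :=
  span (fun c => exists2 g, admissible g & c = cls m N g).

(* The Hodge degree k part of C_i. *)
Definition hairy_complex (m N k i : nat) : graph_space m N -> Prop :=
  span (fun c => exists2 g,
    [/\ two_loop_hairy g, hodge_degree g = k & defect g = i] &
    c = cls m N g).

(* The kernel of C_i -> C_(i-1) and the image of C_(i+1) -> C_i in the complex
   0 -> C_2 -> C_1 -> C_0 -> 0. *)
Definition is_cycle (m N k i : nat) (c : graph_space m N) : Prop :=
  hairy_complex k i c /\ (i = 0%N \/ boundary c = 0).

Definition is_boundary (m N k i : nat) (c : graph_space m N) : Prop :=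
  if (i < 2)%N then exists2 c', hairy_complex k i.+1 c' & boundary c' = c
  else c = 0.

Definition homology_nonzero (m N k i : nat) : Prop :=
  exists2 c : graph_space m N, is_cycle k i c & ~ is_boundary k i c.

(* Main.v *)
(** A two-loop hairy graph is a theta graph: two branch vertices P and Q joined
    by three paths carrying a, b and c hairs, with p and q in {0, 1} hairs at P
    and Q, and defect p + q.  A choice of P and of the order of the paths fixes
    an orientation, so that the complex is presented by generators (a,b,c,p,q);
    permuting the paths and exchanging P with Q act on them by explicit signs.
    In terms of coefficient functions z(a,b,c) that are equivariant under
    permutations of the paths, the differential is, up to scalars, the operator
    R that lengthens one of the three paths.  R is injective, whence H_2 = 0.

    Let m + N be even.  If k is odd the exchange of P and Q kills C_0; if k is
    even it acts trivially on C_0, so that a cycle z of C_1 has R z = 0 and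
    hence z = 0.

    Let m + N be odd.  If k = 0 (resp. 1) mod 4, only the generators of C_0
    with a, b, c all even (resp. all odd) survive, and each of them is the
    boundary of a single generator.  If k = 2 (resp. 3) mod 4, a cycle z of C_1
    satisfies (R z)(a,b,c) = 0 when exactly two (resp. one) of a, b, c are odd,
    which forces z = R w with w supported on the all even (resp. all odd)
    triples, so that z is a boundary. *)

From mathcomp Require Import freeg.
From mathcomp Require Import all_boot.
From mathcomp Require Import ssralg ssrnum ssrint rat.
From mathcomp Require Import fingroup perm.
From mathcomp Require Import boolp.
From mathcomp Require generic_quotient.
From mathcomp Require Import zify ring lra.
Require Import Defs.

Set Implicit Arguments.
Unset Strict Implicit.
Unset Printing Implicit Defensive.

Import GRing.Theory.
Local Open Scope ring_scope.

(** * Koszul signs *)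

(** The delicate point is that generators and symmetries really present the complex: in the quotient
    by the orientation relations each generator must be well defined, and no relation may hold
    except those coming from the symmetries. A marking is a way of reading a graph as a theta graph,
    and it singles out an orientation. Matching two graphs position by position along markings of
    equal type shows that the oriented class depends on the type alone. Conversely, any two markings
    of one graph differ by permutations of the paths and the exchange of P and Q, so a function of
    the type with the right signs descends to a linear functional on the quotient. Applied to a
    coefficient function itself, this functional returns the sum of its squares, which is why
    equivariant coefficients over the rationals are determined by their chain. The order attached to
    a marking is grouped so that every interior step of a path has total degree of the parity of m +
    N; hence the role of m + N in the signs. The residue of k modulo 4 comes from the binomial sign
    of reversing a path. *)

Definition complete (T : finType) (s : seq T) := perm_eq s (enum T).

Section Koszul.
Variables (T : finType) (deg : T -> int).
Implicit Types s t u : seq T.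
Let c x y : rat := (-1) ^ (deg x * deg y).

Lemma complete_uniq s : complete s -> uniq s.
Proof. by move=> /perm_uniq->; apply: enum_uniq. Qed.

Lemma mem_complete s x : complete s -> x \in s.
Proof. by move=> /perm_mem->; rewrite mem_enum. Qed.

Lemma completeP s : uniq s -> (forall x, x \in s) -> complete s.
Proof. by move=> us ms; apply: uniq_perm; rewrite ?enum_uniq // => x; rewrite mem_enum ms. Qed.

(** Ordered pairs are grouped into unordered ones; [enum_rank] merely serves as a strict total order
    that selects one representative of each pair. *)
Lemma prod_pairs (F : T -> T -> rat) : (forall x, F x x = 1) ->
  \prod_x \prod_y F x y
  = \prod_x \prod_(y | (enum_rank x < enum_rank y)%N) (F x y * F y x).
Proof.
move=> F1.
transitivity (\prod_x ((\prod_(y | (enum_rank x < enum_rank y)%N) F x y)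
  * \prod_(y | (enum_rank y < enum_rank x)%N) F x y)).
  apply: eq_bigr => x _; rewrite (bigD1 x) //= F1 mul1r.
  rewrite (bigID (fun y => (enum_rank x < enum_rank y)%N)) /=; congr (_ * _).
    by apply: eq_bigl => y; case: eqVneq => //= ->; rewrite ltnn.
  apply: eq_bigl => y; rewrite -leqNgt ltn_neqAle; congr (_ && _).
  by rewrite (inj_eq val_inj) (inj_eq enum_rank_inj).
rewrite big_split /= [X in _ * X](exchange_big_dep xpredT) //= -big_split /=.
by apply: eq_bigr => x _; rewrite big_split.
Qed.

Let cC x y : c x y = c y x. Proof. by rewrite /c mulrC. Qed.
Let c2 x y : c x y * c x y = 1.
Proof. by rewrite /c -expfzMl mulrNN mul1r exp1rz. Qed.

Let before s x y := (index x s < index y s)%N.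

Let beforeN s x y : complete s -> x != y -> before s y x = ~~ before s x y.
Proof.
move=> cs xy; rewrite /before ltnNge leq_eqVlt negb_or.
suff -> : index x s != index y s by [].
by apply: contra xy => /eqP /index_inj -> //; apply: mem_complete.
Qed.

(** Of the two orderings of a pair of distinct elements at most one is counted, namely when s and t
    disagree about the pair. With one factor per unordered pair and an exclusive or,
    multiplicativity of the sign becomes visible. *)
Lemma koszul_xor s t : complete s -> complete t -> koszul deg s t =
  \prod_x \prod_(y | (enum_rank x < enum_rank y)%N)
    (if (index x s < index y s)%N (+) (index x t < index y t)%N
     then (-1) ^ (deg x * deg y) else 1).
Proof.
move=> cs ct; rewrite koszulE prod_pairs => [|x]; last by rewrite ltnn.
apply: eq_bigr => x _; apply: eq_bigr => y lt_xy.
have xy : x != y by apply: contraTneq lt_xy => ->; rewrite ltnn.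
rewrite -/(before s x y) -/(before t x y) -/(before t y x) -/(before s y x).
rewrite (beforeN cs xy) (beforeN ct xy) -/(c x y) -/(c y x) -cC.
by case: (before s x y); case: (before t x y); rewrite /= ?mulr1 ?mul1r.
Qed.

Lemma koszul_cocycle s t u : complete s -> complete t -> complete u ->
  koszul deg s t * koszul deg t u = koszul deg s u.
Proof.
move=> cs ct cu; rewrite !koszul_xor // -big_split; apply: eq_bigr => x _ /=.
rewrite -big_split; apply: eq_bigr => y _ /=; rewrite -/(c x y).
by do 3![case: (index _ _ < _)%N] => /=; rewrite ?mulr1 ?mul1r ?c2.
Qed.

Lemma koszul_sq s t : koszul deg s t * koszul deg s t = 1.
Proof.
rewrite koszulE -big_split; apply: big1 => x _ /=.
rewrite -big_split; apply: big1 => y _ /=; rewrite -/(c x y).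
by case: ifP; rewrite ?mulr1 ?c2.
Qed.

Lemma koszulxx s : koszul deg s s = 1.
Proof.
rewrite koszulE; apply: big1 => x _; apply: big1 => y _.
by case: ifP => // /andP[l1 l2]; move: (ltn_trans l1 l2); rewrite ltnn.
Qed.

(** Only the pairs in B x C change their relative order. The integer degrees are traded for natural
    weights [w] that give the same signs, so the exponent is a product of two natural sums. *)
Lemma koszul_blocks (w : T -> nat) s1 B C s2 :
    (forall x y, (-1) ^ (deg x * deg y) = (-1) ^+ (w x * w y) :> rat) ->
    complete (s1 ++ B ++ C ++ s2) ->
  koszul deg (s1 ++ B ++ C ++ s2) (s1 ++ C ++ B ++ s2)
  = (-1) ^+ (sumn (map w B) * sumn (map w C)).
Proof.
move=> wP cs; have us := complete_uniq cs.
have ms x := mem_complete x cs.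
have [uB uC] : uniq B /\ uniq C by move: us; rewrite !cat_uniq => /and5P[_ _ ? _ /and3P[? _ _]].
have dj x : [&& (x \in s1) ==> [&& x \notin B, x \notin C & x \notin s2],
     (x \in B) ==> (x \notin C) && (x \notin s2) & (x \in C) ==> (x \notin s2)].
  move: us; rewrite !cat_uniq !has_cat !negb_or.
  move=> /and3P[_ /and3P[/hasPn h1 /hasPn h2 /hasPn h3]].
  move=> /and3P[_ /andP[/hasPn h4 /hasPn h5] /and3P[_ /hasPn h6 _]].
  apply/and3P; split; apply/implyP => xs.
  - by apply/and3P; split; apply/negP => xB; [have := h1 _ xB|have := h2 _ xB|have := h3 _ xB]; rewrite /= xs.
  - by apply/andP; split; apply/negP => xB; [have := h4 _ xB|have := h5 _ xB]; rewrite /= xs.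
  - by apply/negP => xB; have := h6 _ xB; rewrite /= xs.
transitivity (\prod_(x in B) \prod_(y in C) c x y).
  rewrite /koszul [RHS]big_mkcond; apply: eq_bigr => x _.
  case: ifP => xB; last first.
    apply: big1 => y /andP[]; rewrite !index_cat xB => l1 l2; exfalso; move: l1 l2 (dj x) (dj y).
    have := index_size x s1; have := index_size x C; have := index_size y s1.
    have := index_size y B; have := index_size y C.
    have := ms x; have := ms y; rewrite !mem_cat xB.
    have := index_mem x s1; have := index_mem y s1; have := index_mem y B.
    have := index_mem x C; have := index_mem y C.
    case: (x \in s1); case: (x \in C) => //=; case: (y \in s1); case: (y \in B); case: (y \in C) => //=; lia.
  apply: eq_bigl => y; rewrite !index_cat xB.
  move: (dj x) (dj y); rewrite xB /=.
  have := index_size y s1.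
  have := index_size y B; have := index_size y C.
  have := ms y; rewrite !mem_cat.
  have := index_mem x s1; have := index_mem y s1; have := index_mem y B.
  have := index_mem x B; rewrite xB.
  have := index_mem x C; have := index_mem y C.
  case: (x \in s1) => //=; case: (x \in C) => //=; case: (y \in s1); case: (y \in B); case: (y \in C) => //=; lia.
transitivity (\prod_(x <- B) \prod_(y <- C) c x y).
  by rewrite big_uniq //; apply: eq_bigr => x _; rewrite big_uniq.
rewrite (eq_bigr (fun x => (-1) ^+ (w x * sumn (map w C)))) => [|x _].
  elim: (B) => [|x B' IH]; first by rewrite big_nil mul0n expr0.
  by rewrite big_cons IH /= mulnDl exprD.
elim: (C) => [|y C' IH]; first by rewrite big_nil muln0 expr0.
by rewrite big_cons IH /= mulnDr exprD /c wP.
Qed.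

End Koszul.

(** Natural numbers of the same parity as [degree]: N + 1 stands for N - 1, and the minus signs of m
    and N are dropped. *)
Definition weight (m N : nat) (A B C : Type) (x : A + B + C) : nat :=
  match x with
  | inl (inl _) => m
  | inl (inr _) => N
  | inr _ => N.+1
  end.

Lemma exprz_sign (z : int) : (-1) ^ z = (-1) ^+ `|z|%N :> rat.
Proof.
case: z => n; rewrite /= ?NegzE -?exprnP //= -exprz_inv.
by rewrite invrN1 -exprnP.
Qed.

Lemma sign_eq (a b : nat) : odd a = odd b -> (-1) ^+ a = (-1) ^+ b :> rat.
Proof. by move=> e; rewrite -signr_odd e signr_odd. Qed.

Lemma degree_sign (m N : nat) (A B C : Type) (x y : A + B + C) :
  (-1) ^ (degree m N x * degree m N y)
  = (-1) ^+ (weight m N x * weight m N y) :> rat.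
Proof.
rewrite exprz_sign; apply: sign_eq; rewrite abszM !oddM.
have oddE (z : A + B + C) : odd `|degree m N z| = odd (weight m N z).
  by case: z => [[z|z]|z] /=; lia.
by rewrite !oddE.
Qed.

Section KoszulMap.
Variables (T U : finType) (dT : T -> int) (dU : U -> int) (f : T -> U).
Hypotheses (fB : bijective f) (df : forall x, dU (f x) = dT x).

Lemma koszul_map s t : koszul dU (map f s) (map f t) = koszul dT s t.
Proof.
rewrite !koszulE (reindex f) /=; last exact: onW_bij.
apply: eq_bigr => x _; rewrite (reindex f) /=; last exact: onW_bij.
by apply: eq_bigr => y _; rewrite !index_map ?df //; apply: bij_inj.
Qed.

Lemma complete_map s : complete s -> complete (map f s).
Proof.
move=> cs; apply: completeP; first by rewrite (map_inj_uniq (bij_inj fB)) (complete_uniq cs).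
case: fB => f' fK f'K y; apply/mapP; exists (f' y) => //; exact: mem_complete.
Qed.
End KoszulMap.

Lemma complete_order (T : finType) (o : total_order_of T) : complete (val o).
Proof. exact: valP o. Qed.

(** * Markings of theta graphs *)

(* A theta graph is read from P to Q.  A path [(d, [:: (h1, d1); (h2, d2); ...])]
   leaves P along the half-edge d; at the i-th vertex met on the way, hi is the
   half-edge of the hair and di the next half-edge of the path.  [hP] and [hQ]
   list the half-edges at P and Q of the hairs attached there. *)
Record marking (D : Type) :=
  Marking { hP : seq D; hQ : seq D; pa : D * seq (D * D); pb : D * seq (D * D);
            pc : D * seq (D * D) }.

Definition pmap2 (D E : Type) (f : D -> E) (p : D * seq (D * D)) :=
  (f p.1, map (fun s => (f s.1, f s.2)) p.2).
Definition mmap (D E : Type) (f : D -> E) (M : marking D) :=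
  Marking (map f (hP M)) (map f (hQ M)) (pmap2 f (pa M)) (pmap2 f (pb M)) (pmap2 f (pc M)).

(** The last half-edge of a path in reading direction; for a valid marking its opposite is attached
    to Q. *)
Definition pend (D : Type) (p : D * seq (D * D)) := last p.1 (unzip2 p.2).
Definition steps (D : Type) (M : marking D) := (pa M).2 ++ (pb M).2 ++ (pc M).2.
(** In a valid marking [hairs] names every hair by its half-edge at the frame, and [fdarts] names
    every frame edge by the half-edge met first on the way from P to Q. *)
Definition hairs (D : Type) (M : marking D) := hP M ++ hQ M ++ unzip1 (steps M).
Definition fdarts (D : Type) (M : marking D) :=
  [:: (pa M).1; (pb M).1; (pc M).1] ++ unzip2 (steps M).
Definition mtype (D : Type) (M : marking D) :=
  (size (pa M).2, size (pb M).2, size (pc M).2, size (hP M), size (hQ M)).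

Definition is_ext (A B : Type) (v : A + B) := if v is inl _ then true else false.

Section Marking.
Variable g : ograph.
Implicit Types (d h : half g) (M : marking (half g)).

Definition opp d : half g := (d.1, ~~ d.2).
Lemma oppK : involutive opp. Proof. by case=> e b; rewrite /opp /= negbK. Qed.

Definition vx d : element g := inl (ends g d).
Definition ed d : element g := inr d.1.

Definition hair_block h := [:: vx (opp h); ed h].
(** External vertex, interior vertex, hair edge, next path edge: the weights m + N + (N + 1) + (N +
    1) have the parity of m + N, whereas a hair block has that of m + N + 1. Moving steps past each
    other thus costs a sign that depends on m + N only. *)
Definition step_block (s : half g * half g) :=
  [:: vx (opp s.1); vx s.1; ed s.1; ed s.2].
Definition hair_blocks (s : seq (half g)) := flatten (map hair_block s).
Definition step_blocks s := flatten (map step_block s).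

Definition mP M := ends g (pa M).1.
Definition mQ M := ends g (opp (pend (pa M))).

(* [mlist M] is the order of the orientation set singled out by the marking. *)
Definition base M := [:: inl (mP M) : element g; inl (mQ M); ed (pa M).1; ed (pb M).1; ed (pc M).1].
Definition mlist M :=
  base M ++ hair_blocks (hP M) ++ hair_blocks (hQ M) ++
  step_blocks (pa M).2 ++ step_blocks (pb M).2 ++ step_blocks (pc M).2.

Fixpoint chain d (s : seq (half g * half g)) :=
  if s is (h, d') :: s' then
    [&& ends g h == ends g (opp d), ends g d' == ends g h & chain d' s']
  else true.

Definition hair_ok h := ~~ is_ext (ends g h) && is_ext (ends g (opp h)).

(** [validC] carries much of the content: every vertex and every edge occurs exactly once in
    [mlist M], so the graph consists of the marked paths and hairs and nothing else. *)
Record valid M : Prop := Valid {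
  validC : complete (mlist M);
  validH : all hair_ok (hairs M);
  validP : ~~ is_ext (mP M);
  validQ : ~~ is_ext (mQ M);
  validPb : ends g (pb M).1 = mP M;
  validPc : ends g (pc M).1 = mP M;
  validQb : ends g (opp (pend (pb M))) = mQ M;
  validQc : ends g (opp (pend (pc M))) = mQ M;
  validhP : all (fun h => ends g h == mP M) (hP M);
  validhQ : all (fun h => ends g h == mQ M) (hQ M);
  validsP : (size (hP M) <= 1)%N;
  validsQ : (size (hQ M) <= 1)%N;
  validca : chain (pa M).1 (pa M).2;
  validcb : chain (pb M).1 (pb M).2;
  validcc : chain (pc M).1 (pc M).2
}.

(** A half-edge with second component [true] sits at the head of its edge, so this counts the edges
    oriented against the marking, whose preferred directions are from P to Q and outwards along the
    hairs. *)
Definition nflip M := count snd (fdarts M ++ hairs M).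

(** [sgn m N M *: cls m N g] is the class of the graph with the orientation preferred by the
    marking: order [mlist M], all edges in reading direction. *)
Definition sgn m N M : rat :=
  koszul (@degree m N _ _ _) (val (order g)) (mlist M) * (-1) ^+ (N * nflip M).

End Marking.

Lemma pend_map (D E : Type) (f : D -> E) p : pend (pmap2 f p) = f (pend p).
Proof.
rewrite /pend /pmap2 /=.
rewrite /unzip2 -map_comp -[RHS]last_map -map_comp.
by congr (last _ _); apply: eq_map.
Qed.

Lemma mtype_map (D E : Type) (f : D -> E) M : mtype (mmap f M) = mtype M.
Proof. by rewrite /mtype /= !size_map. Qed.

Lemma steps_map (D E : Type) (f : D -> E) M :
  steps (mmap f M) = map (fun s => (f s.1, f s.2)) (steps M).
Proof. by rewrite /steps /= !map_cat. Qed.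

Lemma hairs_map (D E : Type) (f : D -> E) M : hairs (mmap f M) = map f (hairs M).
Proof.
rewrite /hairs steps_map 2!map_cat /unzip1 -!map_comp.
by congr (_ ++ (_ ++ _)); apply: eq_map.
Qed.

Lemma fdarts_map (D E : Type) (f : D -> E) M : fdarts (mmap f M) = map f (fdarts M).
Proof.
rewrite /fdarts steps_map map_cat /unzip2 -!map_comp.
by congr (_ ++ _); apply: eq_map.
Qed.

(** * Markings and the three orientation relations *)

Section Transport.
Variables (g h : ograph) (F : half g -> half h) (fv : vertex g -> vertex h)
  (fe : edge g -> edge h).
Hypotheses (feB : bijective (sum_map fv fe))
  (fvext : forall v, is_ext (fv v) = is_ext v)
  (FE : forall d, (F d).1 = fe d.1) (Fopp : forall d, F (opp d) = opp (F d))
  (Fends : forall d, ends h (F d) = fv (ends g d)).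

Lemma mlist_map M : mlist (mmap F M) = map (sum_map fv fe) (mlist M).
Proof.
have vxE d : vx (F d) = sum_map fv fe (vx d) by rewrite /vx Fends.
have edE d : ed (F d) = sum_map fv fe (ed d) by rewrite /ed FE.
have hbE s : hair_blocks (map F s) = map (sum_map fv fe) (hair_blocks s).
  rewrite /hair_blocks map_flatten -!map_comp; congr flatten; apply: eq_map => d /=.
  by rewrite /hair_block -Fopp vxE edE.
have sbE s : step_blocks (map (fun s => (F s.1, F s.2)) s) = map (sum_map fv fe) (step_blocks s).
  rewrite /step_blocks map_flatten -!map_comp; congr flatten; apply: eq_map => d /=.
  by rewrite /step_block /= -Fopp !vxE !edE.
rewrite /mlist !map_cat !hbE !sbE; congr (_ ++ _).
by rewrite /base /mP /mQ /= pend_map -Fopp !Fends !edE.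
Qed.

Lemma valid_map M : valid M -> valid (mmap F M).
Proof.
have chE d s : chain d s -> chain (F d) (map (fun s => (F s.1, F s.2)) s).
  elim: s d => //= -[k d'] s IH d /= /and3P[/eqP e1 /eqP e2 /IH->].
  by rewrite -Fopp !Fends e1 e2 e1 !eqxx.
have PE M' : mP (mmap F M') = fv (mP M') by rewrite /mP Fends.
have QE M' : mQ (mmap F M') = fv (mQ M') by rewrite /mQ pend_map -Fopp Fends.
case=> vC vH vP vQ vPb vPc vQb vQc vhP vhQ vsP vsQ vca vcb vcc; split;
  rewrite ?PE ?QE ?fvext //= ?size_map ?pend_map -?Fopp ?Fends ?vPb ?vPc ?vQb ?vQc //; try exact: chE.
- by rewrite mlist_map; apply: complete_map.
- rewrite hairs_map all_map; apply: sub_all vH => d /=.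
  by rewrite /hair_ok -Fopp !Fends !fvext.
- by rewrite all_map; apply: sub_all vhP => d /= /eqP; rewrite Fends => ->.
- by rewrite all_map; apply: sub_all vhQ => d /= /eqP; rewrite Fends => ->.
Qed.

End Transport.

Section TransportSign.
Variables (m N : nat).

Lemma marking_iso (g h : ograph) (M : marking (half g)) : oiso g h -> valid M ->
  exists M' : marking (half h), [/\ valid M', mtype M' = mtype M & sgn m N M' = sgn m N M].
Proof.
case=> fx [fi [fe [[fxB fiB feB] [eE oE]]]] vM.
pose F (d : half g) : half h := (fe d.1, d.2).
have vB : bijective (sum_map fx fi).
  case: fxB fiB => [fx' K1 K2] [fi' K3 K4]; exists (sum_map fx' fi').
    by case=> x /=; congr (_ _).
  by case=> x /=; congr (_ _).
have B : bijective (sum_map (sum_map fx fi) fe).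
  case: vB feB => [fv' K1 K2] [fe' K3 K4]; exists (sum_map fv' fe').
    by case=> x; rewrite [LHS]/= ?K1 ?K3.
  by case=> x; rewrite [LHS]/= ?K2 ?K4.
have Fe d : ends h (F d) = sum_map fx fi (ends g d) by case: d => e b; rewrite eE.
have ve v : is_ext (sum_map fx fi v) = is_ext v by case: v.
exists (mmap F M); split; last 1 first.
- rewrite /sgn (@mlist_map g h F (sum_map fx fi) fe) // oE (koszul_map (dT := @degree m N _ _ _)) //; last by case=> [[]|].
  by rewrite /nflip fdarts_map hairs_map -map_cat count_map.
- exact: (@valid_map g h F (sum_map fx fi) fe B ve).
- exact: mtype_map.
Qed.

Lemma marking_reorder (g : ograph) (o : total_order_of (element g)) (M : marking (half g)) :
  valid M -> exists M' : marking (half (reorder o)), [/\ valid M', mtype M' = mtype M &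
    sgn m N M' = koszul (@degree m N _ _ _) (val (order g)) (val o) * sgn m N M].
Proof.
move=> vM; exists M; split=> //.
  by case: vM => *; split.
rewrite /sgn mulrA; congr (_ * _).
rewrite -(@koszul_cocycle _ _ (val (order g)) (val o) (mlist M)) ?mulrA ?koszul_sq ?mul1r //.
- exact: complete_order.
- exact: complete_order.
- by case: vM.
Qed.


Lemma count_flip (g : ograph) (e : edge g) (s : seq (half g)) :
  uniq (map fst s) ->
  odd (count snd (map (flip_half e) s)) = odd (count snd s) (+) (e \in map fst s).
Proof.
elim: s => //= -[f b] s IH /andP[/= fs us]; rewrite !oddD IH // inE /flip_half /= [e == f]eq_sym.
case: (eqVneq f e) fs => [-> fs|_ _] /=; last by rewrite addbA.
by rewrite (negbTE fs) addbF addbT; case: (b) => /=; case: (odd _).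
Qed.

Definition edge_of (A B : Type) (x : A + B) : option B := if x is inr e then Some e else None.

Lemma perm_edges (g : ograph) (M : marking (half g)) :
  perm_eq (pmap (@edge_of _ _) (mlist M)) (map fst (fdarts M ++ hairs M)).
Proof.
have hE (s : seq (half g)) : pmap (@edge_of _ _) (hair_blocks s) = map fst s.
  by elim: s => //= h s IH; rewrite -[in RHS]IH.
have sE (s : seq (half g * half g)) a : count a (pmap (@edge_of _ _) (step_blocks s))
    = (count a (map fst (unzip2 s)) + count a (map fst (unzip1 s)))%N.
  by elim: s => //= -[h d] s /= IH; rewrite IH; lia.
apply/seq.permP => a; rewrite /mlist /fdarts /hairs /steps.
rewrite !pmap_cat !hE /unzip1 /unzip2 !map_cat !count_cat !sE /unzip1 /unzip2 /=; lia.
Qed.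

(** The marking chooses exactly one of the two half-edges of every edge; flipping an edge therefore
    alters a single entry and changes the parity of [nflip]. *)
Lemma edge_dart (g : ograph) (M : marking (half g)) : complete (mlist M) ->
  uniq (map fst (fdarts M ++ hairs M)) /\ forall e, e \in map fst (fdarts M ++ hairs M).
Proof.
move=> cM; rewrite -(perm_uniq (perm_edges M)); split.
  apply: (@pmap_uniq _ _ _ inr) (complete_uniq cM); by case.
move=> e; rewrite -(perm_mem (perm_edges M)) mem_pmap.
by apply/mapP; exists (inr e) => //; apply: mem_complete cM.
Qed.

(** The last clause records the shape of the new marking, so that the normalisation below can follow
    the exact value of [nflip] and not just its parity. *)
Lemma marking_flip (g : ograph) (e : edge g) (M : marking (half g)) :
  valid M -> exists M' : marking (half (flip e)), [/\ valid M', mtype M' = mtype M,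
    sgn m N M' = (-1) ^+ N * sgn m N M & M' = mmap (flip_half e) M].
Proof.
move=> vM; pose F (d : half g) : half (flip e) := flip_half e d.
have idB : bijective (sum_map id id : element g -> element (flip e)).
  by exists (sum_map id id); case.
have FF d : flip_half e (flip_half e d) = d.
  by case: d => f b; rewrite /flip_half /=; case: eqP; rewrite ?negbK.
have Fe d : ends (flip e) (F d) = id (ends g d) by rewrite ffunE FF.
have Fo d : F (opp d) = opp (F d).
  by case: d => f b; rewrite /F /opp /flip_half /=; case: eqP.
exists (mmap F M); split => //.
- exact: (@valid_map g (flip e) F id id).
- exact: mtype_map.
- rewrite /sgn (@mlist_map g (flip e) F id id) // mulrCA.
  have -> : map (sum_map id id) (mlist M) = mlist M.
    by rewrite -[RHS]map_id; apply: eq_map; case.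
  congr (_ * _); rewrite -exprD; apply: sign_eq.
  rewrite oddD !oddM /nflip fdarts_map hairs_map -map_cat count_flip; last by case: (edge_dart (validC vM)).
  rewrite (proj2 (edge_dart (validC vM))).
  by case: (odd N); case: (odd _).
Qed.

End TransportSign.

(** * The oriented class depends on the type only *)

Section SameType.
Variables (m N : nat).
Local Notation cls := (cls m N).

Lemma count_unflip (g : ograph) (e : edge g) (s : seq (half g)) :
  uniq (map fst s) -> (e, true) \in s ->
  (count snd (map (flip_half e) s)).+1 = count snd s.
Proof.
elim: s => //= -[f b] s IH /andP[/= fs us]; rewrite inE /flip_half /=.
case: eqP => [[-> <-] _|nfb /= es].
  rewrite eqxx /= add0n add1n; congr _.+1; rewrite count_map; apply: eq_in_count => -[e' b'] /= ins.
  rewrite /flip_half /=; case: eqP => // e'f; case/negP: fs; rewrite -e'f.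
  by apply/mapP; exists (e', b').
rewrite -(IH us es) -addnS; congr (_ + _)%N.
case: (eqVneq f e) fs => [->|//] /negP[].
by apply/mapP; exists (e, true).
Qed.

(** Edges oriented against the marking are flipped one at a time, by induction on their number; a
    final reordering turns the order into [mlist]. The signs that arise are exactly those collected
    in [sgn]. *)
Lemma marking_normal (g : ograph) (M : marking (half g)) : valid M ->
  exists (h : ograph) (M' : marking (half h)),
  [/\ valid M', mtype M' = mtype M, sgn m N M *: cls g = cls h,
     nflip M' = 0%N & val (order h) = mlist M'].
Proof.
have [n] := ubnP (nflip M); elim: n => // n IH in g M *; rewrite ltnS => le vM.
have [nf0|] := posnP (nflip M).
  pose o : total_order_of (element g) := Sub (mlist M) (validC vM).
  exists (reorder o), M; split=> //; first by case: (vM) => *; split.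
  by rewrite /sgn nf0 muln0 expr0 mulr1 cls_reorder.
rewrite -has_count => /hasP[[e []] eL // _].
have [us _] := edge_dart (validC vM).
have [M' [vM' tM' sM' defM']] := marking_flip m N e vM.
have nM' : (nflip M').+1 = nflip M.
  by rewrite /nflip defM' fdarts_map hairs_map -map_cat count_unflip.
have [|h [M2 [v2 t2 s2 n2 o2]]] := IH _ M' _ vM'; first by rewrite nM'.
exists h, M2; split=> //; first by rewrite t2.
by rewrite -s2 sM' cls_flip scalerA mulrAC -exprD addnn -signr_odd odd_double mul1r.
Qed.

Definition kind (A B C : Type) (x : A + B + C) : nat :=
  match x with inl (inl _) => 0 | inl (inr _) => 1 | inr _ => 2 end.

Lemma kind_hairs (g : ograph) (s : seq (half g)) : all (@hair_ok g) s ->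
  map (@kind _ _ _) (hair_blocks s) = flatten (nseq (size s) [:: 0; 2]%N).
Proof.
elim: s => [//|h s IH] /= /andP[/andP[h1 h2] /IH]; rewrite /hair_blocks /= => ->.
by case: (ends g (opp h)) h2.
Qed.

Lemma kind_steps (g : ograph) (s : seq (half g * half g)) : all (@hair_ok g) (unzip1 s) ->
  map (@kind _ _ _) (step_blocks s) = flatten (nseq (size s) [:: 0; 1; 2; 2]%N).
Proof.
elim: s => [//|[h d] s IH] /= /andP[/andP[h1 h2] /IH]; rewrite /step_blocks /= => ->.
by case: (ends g (opp h)) h2; case: (ends g h) h1.
Qed.

(** The kinds along [mlist M] can be read off from the type, so a matching of two such lists by
    position respects external vertices, internal vertices and edges. *)
Lemma kind_mlist (g h : ograph) (M : marking (half g)) (M' : marking (half h)) :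
  valid M -> valid M' -> mtype M = mtype M' ->
  map (@kind _ _ _) (mlist M) = map (@kind _ _ _) (mlist M').
Proof.
have kE (g' : ograph) (M1 : marking (half g')) : valid M1 -> map (@kind _ _ _) (mlist M1) =
    [:: 1; 1; 2; 2; 2]%N ++ flatten (nseq (size (hP M1)) [:: 0; 2]%N) ++
    flatten (nseq (size (hQ M1)) [:: 0; 2]%N) ++ flatten (nseq (size (pa M1).2) [:: 0; 1; 2; 2]%N)
    ++ flatten (nseq (size (pb M1).2) [:: 0; 1; 2; 2]%N) ++ flatten (nseq (size (pc M1).2) [:: 0; 1; 2; 2]%N).
  move=> vM; have := validH vM; rewrite /hairs /steps /unzip1 !map_cat !all_cat.
  case/and5P => a1 a2 a3 a4 a5; rewrite ?map_cat !kind_hairs // !kind_steps //.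
  by congr (_ ++ _); move: (validP vM) (validQ vM); rewrite /=; case: (mP M1); case: (mQ M1).
by move=> v v' [e1 e2 e3 e4 e5]; rewrite !kE // e1 e2 e3 e4 e5.
Qed.

Section Psi.
Variables (T U : eqType) (s : seq T) (t : seq U) (u0 : U).
Hypothesis szE : size s = size t.
(** Sends an entry of s to the entry of t at the same position; [u0] is the junk value outside s. *)
Definition psi x := nth u0 t (index x s).
Lemma map_psi : uniq s -> map psi s = t.
Proof.
move=> us; apply: (@eq_from_nth _ u0); rewrite size_map // => i lt_i.
have x0 : T by case: (s) lt_i.
by rewrite (nth_map x0) // /psi index_uniq.
Qed.
End Psi.

Lemma psiK (T U : eqType) (s : seq T) (t : seq U) (u0 : U) (t0 : T) x :
  size s = size t -> uniq t -> x \in s -> psi t s t0 (psi s t u0 x) = x.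
Proof.
move=> szE ut xs; rewrite /psi index_uniq //; last by rewrite -szE index_mem.
by rewrite nth_index.
Qed.

Lemma size_hair_blocks (g : ograph) (s : seq (half g)) : size (hair_blocks s) = (size s).*2.
Proof. by elim: s => //= h s /= IH; rewrite IH. Qed.
Lemma size_step_blocks (g : ograph) (s : seq (half g * half g)) : size (step_blocks s) = (4 * size s)%N.
Proof. by elim: s => //= h s /= IH; rewrite IH /=; lia. Qed.

Section Iso.
Variables (g h : ograph) (M : marking (half g)) (M' : marking (half h)).
Hypotheses (vM : valid M) (vM' : valid M') (tE : mtype M = mtype M').
Variable f : element g -> element h.
Hypothesis fE : map f (mlist M) = mlist M'.

Definition corr d d' := [/\ f (vx d) = vx d', f (vx (opp d)) = vx (opp d') & f (ed d) = ed d'].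

Lemma corr_parts : [/\ f (inl (mP M)) = inl (mP M'), f (inl (mQ M)) = inl (mQ M') &
  [/\ f (ed (pa M).1) = ed (pa M').1, f (ed (pb M).1) = ed (pb M').1 & f (ed (pc M).1) = ed (pc M').1]] /\
  [/\ map f (hair_blocks (hP M)) = hair_blocks (hP M'), map f (hair_blocks (hQ M)) = hair_blocks (hQ M'),
     map f (step_blocks (pa M).2) = step_blocks (pa M').2,
     map f (step_blocks (pb M).2) = step_blocks (pb M').2 &
     map f (step_blocks (pc M).2) = step_blocks (pc M').2].
Proof.
case: tE => e1 e2 e3 e4 e5.
move: fE; rewrite /mlist !map_cat => /eqP.
rewrite !eqseq_cat ?size_map ?size_hair_blocks ?size_step_blocks ?e1 ?e2 ?e3 ?e4 ?e5 //.
case/and5P => /eqP[-> -> -> -> ->] /eqP-> /eqP-> /eqP-> /andP[/eqP-> /eqP->].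
by [].
Qed.

Lemma corr_hairs (s s' : seq (half g)) (t : seq (half h)) (p : vertex g) (p' : vertex h) :
  map f (hair_blocks s) = hair_blocks t -> f (inl p) = inl p' ->
  all (fun h => ends g h == p) s -> all (fun k => ends h k == p') t ->
  forall x, x \in s -> exists2 x', x' \in t & corr x x'.
Proof.
elim: s t => //= k s IH [|k' t] //= [e1 e2 e3] ep /andP[/eqP kp ap] /andP[/eqP kp' ap'] x.
rewrite inE => /predU1P[->|xs].
  by exists k'; rewrite ?inE ?eqxx //; split=> //; rewrite /vx kp kp'.
by have [x' xt cx] := IH t e3 ep ap ap' x xs; exists x'; rewrite // inE xt orbT.
Qed.

(** Induction along the path. The far end of the last edge does not occur in the step blocks, so the
    hypothesis about it is passed through the recursion separately. *)
Lemma corr_path d (s : seq (half g * half g)) d' (s' : seq (half h * half h)) :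
  chain d s -> chain d' s' -> map f (step_blocks s) = step_blocks s' ->
  f (vx d) = vx d' -> f (ed d) = ed d' ->
  f (vx (opp (last d (unzip2 s)))) = vx (opp (last d' (unzip2 s'))) ->
  forall x, x \in d :: unzip2 s ++ unzip1 s ->
  exists2 x', x' \in d' :: unzip2 s' ++ unzip1 s' & corr x x'.
Proof.
elim: s s' d d' => [|[k d1] s IH] [|[k' d1'] s'] d d' //=.
  by move=> _ _ _ ev ee et x; rewrite !inE => /eqP->; exists d'; rewrite ?inE //; split.
case/and3P => /eqP e1 /eqP e2 c /and3P[/eqP e1' /eqP e2' c'] [b1 b2 b3 b4 b5] ev ee et x.
have {}IH : forall x, x \in d1 :: unzip2 s ++ unzip1 s ->
    exists2 x', x' \in [:: d', d1' & unzip2 s' ++ k' :: unzip1 s'] & corr x x'.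
  move=> y ys; have [||x' x't cx] := IH s' d1 d1' c c' b5 _ b4 et y; rewrite ?ys //.
    by rewrite /vx e2 e2'.
  exists x' => //; move: x't; rewrite !inE !mem_cat !inE.
  by case/or3P => ->; rewrite ?orbT.
rewrite !inE mem_cat inE => /or3P[/eqP->|/eqP->|/or3P[xs|/eqP->|xs]].
- by exists d'; rewrite ?inE ?eqxx //; split=> //; rewrite /vx -e1 -e1'.
- by apply: IH; rewrite inE eqxx.
- by apply: IH; rewrite inE mem_cat xs orbT.
- by exists k'; first by rewrite !inE !mem_cat !inE eqxx !orbT.
- by apply: IH; rewrite inE mem_cat xs !orbT.
Qed.

Lemma corr_all x : x \in fdarts M ++ hairs M ->
  exists2 x', x' \in fdarts M' ++ hairs M' & corr x x'.
Proof.
have [[fP fQ [fa fb fc]] [fhP fhQ fsa fsb fsc]] := corr_parts.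
have A := corr_path (validca vM) (validca vM') fsa fP fa fQ.
have B := @corr_path (pb M).1 _ (pb M').1 _ (validcb vM) (validcb vM') fsb.
have C := @corr_path (pc M).1 _ (pc M').1 _ (validcc vM) (validcc vM') fsc.
have HP := corr_hairs [::] fhP fP (validhP vM) (validhP vM').
have HQ := corr_hairs [::] fhQ fQ (validhQ vM) (validhQ vM').
have {}B := B _ fb; rewrite {1 2}/vx (validPb vM) (validPb vM') in B.
have {}C := C _ fc; rewrite {1 2}/vx (validPc vM) (validPc vM') in C.
have {}B := B fP; rewrite /vx [ends g _](validQb vM) [ends h _](validQb vM') in B.
have {}C := C fP; rewrite /vx [ends g _](validQc vM) [ends h _](validQc vM') in C.
have {}B := B fQ; have {}C := C fQ.
have memE (g' : ograph) (M1 : marking (half g')) y : (y \in fdarts M1 ++ hairs M1) =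
   [|| y \in (pa M1).1 :: unzip2 (pa M1).2 ++ unzip1 (pa M1).2,
       y \in (pb M1).1 :: unzip2 (pb M1).2 ++ unzip1 (pb M1).2,
       y \in (pc M1).1 :: unzip2 (pc M1).2 ++ unzip1 (pc M1).2, y \in hP M1 | y \in hQ M1].
  rewrite -[(y \in hP _) || _]mem_cat -!mem_cat; apply/perm_mem/seq.permP => a.
  rewrite /fdarts /hairs /steps /unzip1 /unzip2 !map_cat /= !count_cat /= !count_cat /= ?count_cat; lia.
rewrite memE => /or4P[/A|/B|/C|/orP[/HP|/HQ]] [x' xM' cx]; exists x' => //; rewrite memE xM' ?orbT //.
Qed.
End Iso.

(** After normalising both sides, the map that matches the two orders by position is an isomorphism
    of oriented graphs: the type fixes all incidences, and neither graph has an edge against its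
    marking. *)
Lemma same_type_cls (g h : ograph) (M : marking (half g)) (M' : marking (half h)) :
  valid M -> valid M' -> mtype M = mtype M' -> sgn m N M *: cls g = sgn m N M' *: cls h.
Proof.
move=> v0 v0' t0.
have [g1 [M1 [v1 t1 -> n1 o1]]] := marking_normal v0.
have [g2 [M2 [v2 t2 -> n2 o2]]] := marking_normal v0'.
have tE : mtype M1 = mtype M2 by rewrite t1 t0 -t2.
have kE := kind_mlist v1 v2 tE.
have szE : size (mlist M1) = size (mlist M2).
  by rewrite -(size_map (@kind _ _ _)) kE size_map.
have u1 := complete_uniq (validC v1); have u2 := complete_uniq (validC v2).
have m1 x := mem_complete x (validC v1); have m2 x := mem_complete x (validC v2).
pose f := psi (mlist M1) (mlist M2) (inl (mP M2)).
pose f' := psi (mlist M2) (mlist M1) (inl (mP M1)).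
have fE : map f (mlist M1) = mlist M2 by apply: map_psi.
have fK : cancel f f' by move=> x; apply: psiK.
have f'K : cancel f' f by move=> x; apply: psiK.
have fk x : kind (f x) = kind x.
  have : map ((@kind _ _ _) \o f) (mlist M1) = map (@kind _ _ _) (mlist M1).
    by rewrite map_comp fE kE.
  by move/eq_in_map => /(_ x (m1 x)).
have f'k x : kind (f' x) = kind x by rewrite -{2}[x]f'K fk.
have /boolp.choice[fx fxE] : forall x, exists y, f (inl (inl x)) = inl (inl y).
  by move=> x; have := fk (inl (inl x)); case: (f _) => [[y|y]|y] // _; exists y.
have /boolp.choice[fi fiE] : forall x, exists y, f (inl (inr x)) = inl (inr y).
  by move=> x; have := fk (inl (inr x)); case: (f _) => [[y|y]|y] // _; exists y.
have /boolp.choice[fe feE] : forall x, exists y, f (inr x) = inr y.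
  by move=> x; have := fk (inr x); case: (f _) => [[y|y]|y] // _; exists y.
have /boolp.choice[fx' fxE'] : forall x, exists y, f' (inl (inl x)) = inl (inl y).
  by move=> x; have := f'k (inl (inl x)); case: (f' _) => [[y|y]|y] // _; exists y.
have /boolp.choice[fi' fiE'] : forall x, exists y, f' (inl (inr x)) = inl (inr y).
  by move=> x; have := f'k (inl (inr x)); case: (f' _) => [[y|y]|y] // _; exists y.
have /boolp.choice[fe' feE'] : forall x, exists y, f' (inr x) = inr y.
  by move=> x; have := f'k (inr x); case: (f' _) => [[y|y]|y] // _; exists y.
have fS x : f x = sum_map (sum_map fx fi) fe x by case: x => [[x|x]|x] /=.
apply/esym/cls_iso; exists fx, fi, fe; split; first split.
- by exists fx' => x; [have := fK (inl (inl x))|have := f'K (inl (inl x))]; rewrite ?fxE ?fxE' ?fxE => -[].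
- by exists fi' => x; [have := fK (inl (inr x))|have := f'K (inl (inr x))]; rewrite ?fiE ?fiE' ?fiE => -[].
- by exists fe' => x; [have := fK (inr x)|have := f'K (inr x)]; rewrite ?feE ?feE' ?feE => -[].
split; last by rewrite o1 o2 -fE; apply: eq_map.
have [_ eM1] := edge_dart (validC v1).
move=> e b; have /mapP[[e0 b0] dL /= e0E] := eM1 e; rewrite -{e0}e0E in dL.
have nof (g' : ograph) (M3 : marking (half g')) x : nflip M3 = 0%N -> x \in fdarts M3 ++ hairs M3 -> x.2 = false.
  move=> n0 xL; apply/negbTE/negP => x2.
  have : has snd (fdarts M3 ++ hairs M3) by apply/hasP; exists x.
  by rewrite has_count -/(nflip M3) n0.
(* Without reversed edges all chosen half-edges are tails, so the matching of edges takes tails to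
   tails. *)
have /= b0F := nof _ _ _ n1 dL.
have [[e' b'] dL' [c1 c2 c3]] := corr_all v1 v2 tE fE dL.
have /= b'F := nof _ _ _ n2 dL'; subst b0 b'.
move: c3; rewrite /ed /= feE => -[->].
move: c1 c2; rewrite /vx /opp !fS /= => -[c1] [c2].
by case: b.
Qed.

End SameType.

(** * Symmetries of markings *)

Section Moves.
Variables (m N : nat) (g : ograph).
Implicit Types (s t u w z : seq (element g)) (M : marking (half g)).
Local Notation deg := (@degree m N _ _ _ : element g -> int).
Local Notation wt := (@weight m N _ _ _ : element g -> nat).

Definition wts s := sumn (map wt s).
(** Completeness of the new order travels with the sign because the validity of the transformed
    marking needs it. Exponents matter only modulo 2. *)
Definition kequiv s t (e : nat) :=
  complete s -> complete t /\ koszul deg s t = (-1) ^+ e.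

Lemma kequiv_trans s t u e f : kequiv s t e -> kequiv t u f -> kequiv s u (e + f).
Proof.
move=> st tu cs; have [ct kst] := st cs; have [cu ktu] := tu ct.
by split=> //; rewrite -(koszul_cocycle _ cs ct cu) kst ktu exprD.
Qed.

Lemma kequiv_parity s t e f : odd e = odd f -> kequiv s t e -> kequiv s t f.
Proof. by move=> ef st cs; have [ct ->] := st cs; split=> //; apply: sign_eq. Qed.

Lemma kequiv_blocks u s t z : kequiv (u ++ s ++ t ++ z) (u ++ t ++ s ++ z) (wts s * wts t).
Proof.
move=> cs; split; last by apply: koszul_blocks => // x y; apply: degree_sign.
apply: perm_trans cs; rewrite perm_cat2l !catA perm_cat2r; exact/permPl/perm_catC.
Qed.

Lemma wts_cat s t : wts (s ++ t) = (wts s + wts t)%N.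
Proof. by rewrite /wts map_cat sumn_cat. Qed.

(** The elements of w are crossed once by x and once by y, which have equal weight, so they
    contribute nothing; the transposition itself contributes the square of the weight. *)
Lemma kequiv_swap u x w y z : wt x = wt y ->
  kequiv (u ++ x :: w ++ y :: z) (u ++ y :: w ++ x :: z) (wt x).
Proof.
move=> xy; have h1 := @kequiv_blocks u [:: x] (w ++ [:: y]) z.
have h2 := @kequiv_blocks u w [:: y] ([:: x] ++ z).
rewrite -catA in h1; rewrite -catA in h1.
apply: kequiv_parity (kequiv_trans h1 h2).
rewrite wts_cat /wts /= !addn0 -xy !(oddM, oddD).
by case: (odd _); case: (odd _).
Qed.

Lemma wts_steps (s : seq (half g * half g)) : all (@hair_ok g) (unzip1 s) ->
  odd (wts (step_blocks s)) = odd (size s * (m + N)).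
Proof.
elim: s => [//|[h d] s IH]; rewrite [size _]/= mulSn => /andP[/= /andP[h1 h2] /IH].
rewrite /wts /step_blocks /= !oddD => ->.
case: (ends g (opp h)) h2 => // _ _; case: (ends g h) h1 => // _ _ /=.
by case: (odd (_ * _)); case: (odd m); case: (odd N).
Qed.

Lemma wts_hairs (s : seq (half g)) : all (@hair_ok g) s ->
  odd (wts (hair_blocks s)) = odd (size s * (m + N).+1).
Proof.
elim: s => [//|h s IH]; rewrite [size _]/= mulSn => /andP[/andP[h1 h2] /IH].
rewrite /wts /hair_blocks /= !oddD => ->.
case: (ends g (opp h)) h2 => // _ _ /=.
by rewrite ?oddD /=; case: (odd (_ * _)); case: (odd m); case: (odd N).
Qed.

(** e accounts for the reordering, and c, modulo 2, for the number of edges whose preferred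
    direction changes. *)
Lemma sgn_change M M' e c : valid M -> kequiv (mlist M) (mlist M') e ->
  odd (nflip M') = odd (nflip M + c) ->
  sgn m N M' = (-1) ^+ (e + N * c) * sgn m N M.
Proof.
move=> vM eM nM; have [cM' kM] := eM (validC vM).
rewrite /sgn -(koszul_cocycle _ (complete_order _) (validC vM) cM') kM exprD.
rewrite [RHS]mulrACA [X in X * _ = _]mulrC; congr (_ * _).
rewrite -exprD; apply: sign_eq.
by rewrite !oddD !oddM nM oddD; case: (odd N); case: (odd c); case: (odd _).
Qed.

Definition swap_ab M := Marking (hP M) (hQ M) (pb M) (pa M) (pc M).
Definition swap_bc M := Marking (hP M) (hQ M) (pa M) (pc M) (pb M).

Lemma hair_ok_paths M : valid M -> [/\ all (@hair_ok g) (hP M), all (@hair_ok g) (hQ M),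
  all (@hair_ok g) (unzip1 (pa M).2), all (@hair_ok g) (unzip1 (pb M).2) &
  all (@hair_ok g) (unzip1 (pc M).2)].
Proof.
by move=> vM; have := validH vM; rewrite /hairs /steps /unzip1 !map_cat !all_cat => /and5P[].
Qed.

(** N + 1 comes from exchanging the two initial edges, the other term from exchanging two runs of
    steps of weights a (m + N) and b (m + N) modulo 2. No edge changes direction. *)
Lemma swap_abP M : valid M -> valid (swap_ab M) /\
  sgn m N (swap_ab M) = (-1) ^+ (N.+1 + (m + N) * (size (pa M).2 * size (pb M).2)) * sgn m N M.
Proof.
move=> vM; have PE : mP (swap_ab M) = mP M by rewrite -(validPb vM).
have QE : mQ (swap_ab M) = mQ M by rewrite -(validQb vM).
have [_ _ ha hb hc] := hair_ok_paths vM.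
have ke : kequiv (mlist M) (mlist (swap_ab M))
    (N.+1 + (m + N) * (size (pa M).2 * size (pb M).2)).
  have h1 := @kequiv_swap [:: inl (mP M); inl (mQ M)] (ed (pa M).1) [::] (ed (pb M).1)
     (ed (pc M).1 :: hair_blocks (hP M) ++ hair_blocks (hQ M) ++ step_blocks (pa M).2 ++ step_blocks (pb M).2 ++ step_blocks (pc M).2) erefl.
  have h2 := @kequiv_blocks ([:: inl (mP M); inl (mQ M); ed (pb M).1; ed (pa M).1; ed (pc M).1] ++ hair_blocks (hP M) ++ hair_blocks (hQ M)) (step_blocks (pa M).2) (step_blocks (pb M).2) (step_blocks (pc M).2).
  rewrite -!catA in h2; rewrite /mlist /base PE QE.
  apply: kequiv_parity (kequiv_trans h1 h2).
  rewrite !oddD !oddM !wts_steps // !oddM !oddD /=.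
  by case: (odd m); case: (odd N); case: (odd (size _)); case: (odd (size _)).
have nf : odd (nflip (swap_ab M)) = odd (nflip M + 0).
  congr odd; rewrite addn0 /nflip /fdarts /hairs /steps /unzip1 /unzip2 /= !map_cat !count_cat.
  lia.
split; last by rewrite (sgn_change vM ke nf) muln0 addn0.
have vC' := (ke (validC vM)).1.
case: (vM) => _ vH vP vQ vPb vPc vQb vQc vhP vhQ vsP vsQ vca vcb vcc; split; rewrite ?PE ?QE //=.
by move: vH; rewrite /hairs /steps /unzip1 /= !map_cat !all_cat => /and5P[-> -> -> -> ->].
Qed.

Lemma swap_bcP M : valid M -> valid (swap_bc M) /\
  sgn m N (swap_bc M) = (-1) ^+ (N.+1 + (m + N) * (size (pb M).2 * size (pc M).2)) * sgn m N M.
Proof.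
move=> vM; have [_ _ ha hb hc] := hair_ok_paths vM.
have ke : kequiv (mlist M) (mlist (swap_bc M))
    (N.+1 + (m + N) * (size (pb M).2 * size (pc M).2)).
  have h1 := @kequiv_swap [:: inl (mP M); inl (mQ M); ed (pa M).1] (ed (pb M).1) [::] (ed (pc M).1)
     (hair_blocks (hP M) ++ hair_blocks (hQ M) ++ step_blocks (pa M).2 ++ step_blocks (pb M).2 ++ step_blocks (pc M).2) erefl.
  have h2 := @kequiv_blocks ([:: inl (mP M); inl (mQ M); ed (pa M).1; ed (pc M).1; ed (pb M).1] ++ hair_blocks (hP M) ++ hair_blocks (hQ M) ++ step_blocks (pa M).2) (step_blocks (pb M).2) (step_blocks (pc M).2) [::].
  rewrite -!catA !cats0 in h2; rewrite /mlist /base.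
  apply: kequiv_parity (kequiv_trans h1 h2).
  rewrite !oddD !oddM !wts_steps // !oddM !oddD /=.
  by case: (odd m); case: (odd N); case: (odd (size _)); case: (odd (size _)).
have nf : odd (nflip (swap_bc M)) = odd (nflip M + 0).
  congr odd; rewrite addn0 /nflip /fdarts /hairs /steps /unzip1 /unzip2 /= !map_cat !count_cat.
  lia.
split; last by rewrite (sgn_change vM ke nf) muln0 addn0.
have vC' := (ke (validC vM)).1.
case: (vM) => _ vH vP vQ vPb vPc vQb vQc vhP vhQ vsP vsQ vca vcb vcc; split => //=.
by move: vH; rewrite /hairs /steps /unzip1 /= !map_cat !all_cat => /and5P[-> -> -> -> ->].
Qed.

(** Read backwards, a hair is followed by the edge that used to precede it, so it is paired anew
    with the opposite of the preceding half-edge; the former last edge becomes the initial one. *)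
Fixpoint rsteps (d : half g) (s : seq (half g * half g)) :=
  if s is (h, d') :: s' then rcons (rsteps d' s') (h, opp d) else [::].
Definition rpath (p : half g * seq (half g * half g)) := (opp (pend p), rsteps p.1 p.2).
Definition reverse M := Marking (hQ M) (hP M) (rpath (pa M)) (rpath (pb M)) (rpath (pc M)).

Lemma size_rsteps d (s : seq (half g * half g)) : size (rsteps d s) = size s.
Proof. by elim: s d => //= -[h d'] s IH d; rewrite size_rcons IH. Qed.

Lemma last_rsteps d (s : seq (half g * half g)) :
  last (opp (last d (unzip2 s))) (unzip2 (rsteps d s)) = opp d.
Proof. by case: s => [|[h d'] s] //=; rewrite /unzip2 map_rcons last_rcons. Qed.

Lemma pend_rpath p : pend (rpath p) = opp p.1.
Proof. exact: last_rsteps. Qed.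

Lemma chain_rcons d (s : seq (half g * half g)) h d' : chain d (rcons s (h, d'))
  = [&& chain d s, ends g h == ends g (opp (last d (unzip2 s))) & ends g d' == ends g h].
Proof.
elim: s d => [|[k d1] s IH] d /=; first by rewrite !andbT.
by rewrite IH !andbA.
Qed.

Lemma chain_rsteps d (s : seq (half g * half g)) : chain d s ->
  chain (opp (last d (unzip2 s))) (rsteps d s).
Proof.
elim: s d => [|[h d'] s IH] d //= /and3P[/eqP e1 /eqP e2 c].
by rewrite chain_rcons IH //= last_rsteps oppK e2 e1 !eqxx.
Qed.

Lemma step_blocks_cat (s t : seq (half g * half g)) :
  step_blocks (s ++ t) = step_blocks s ++ step_blocks t.
Proof. by rewrite /step_blocks map_cat flatten_cat. Qed.

Lemma unzip1_rsteps d (s : seq (half g * half g)) : perm_eq (unzip1 (rsteps d s)) (unzip1 s).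
Proof.
elim: s d => //= -[h d'] s IH d; rewrite /unzip1 map_rcons perm_rcons perm_cons; exact: IH.
Qed.

Lemma unzip2_rsteps d (s : seq (half g * half g)) :
  perm_eq (opp (last d (unzip2 s)) :: unzip2 (rsteps d s)) (map (@opp g) (d :: unzip2 s)).
Proof.
elim: s d => //= -[h d'] s IH d; rewrite /unzip2 map_rcons -rcons_cons perm_rcons perm_cons.
exact: IH.
Qed.

(** Each step exchanges its edge with the one held at the head of the path, at the cost N + 1, and
    reversing the sequence of steps transposes every pair of blocks of weight m + N. *)
Lemma kequiv_rpath u d w (s : seq (half g * half g)) z : all (@hair_ok g) (unzip1 s) ->
  kequiv (u ++ ed d :: w ++ step_blocks s ++ z)
         (u ++ ed (last d (unzip2 s)) :: w ++ step_blocks (rsteps d s) ++ z)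
         (size s * N.+1 + (m + N) * 'C(size s, 2)).
Proof.
elim: s d w => [|[h d'] s IH] d w; first by move=> _ c; split=> //; rewrite koszulxx bin_small // muln0 mul0n.
case/andP => hh hs.
have h1 := @kequiv_swap u (ed d) (w ++ [:: vx (opp h); vx h; ed h]) (ed d') (step_blocks s ++ z) erefl.
have h2 := IH d' (w ++ step_blocks [:: (h, opp d)]) hs.
have h3 := @kequiv_blocks (u ++ ed (last d' (unzip2 s)) :: w) (step_blocks [:: (h, opp d)])
   (step_blocks (rsteps d' s)) z.
rewrite -?catA ?cat_cons -?catA /= in h1 h2 h3.
have := kequiv_trans (kequiv_trans h1 h2) h3.
rewrite [rsteps d _]/= -cats1 step_blocks_cat -!catA /=; apply: kequiv_parity.
have hb : all (@hair_ok g) (unzip1 [:: (h, opp d)]) by move: hh => /= ->.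
have hs' : all (@hair_ok g) (unzip1 (rsteps d' s)) by rewrite (eq_all_r (perm_mem (unzip1_rsteps d' s))).
rewrite binS bin1 !oddD !oddM (wts_steps hb) (wts_steps hs') size_rsteps !oddM !oddD /=.
by case: (odd m); case: (odd N); case: (odd (size _)); case: (odd 'C(_, _)).
Qed.

(** Exchanging P and Q contributes N, the reversed path edges N (3 + a + b + c), the reordering of
    the paths (N + 1)(a + b + c) and the binomial terms, and the exchange of the hair blocks at P
    and Q the last term. Modulo 2 the terms without m + N add up to a + b + c. *)
Definition revexp (a b c p q : nat) :=
  (a + b + c + (m + N) * ('C(a, 2) + 'C(b, 2) + 'C(c, 2)) + (m + N).+1 * (p * q))%N.

Lemma reverseP M : valid M -> valid (reverse M) /\
  sgn m N (reverse M) = (-1) ^+ (revexp (size (pa M).2) (size (pb M).2) (size (pc M).2)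
     (size (hP M)) (size (hQ M))) * sgn m N M.
Proof.
move=> vM; have PE : mP (reverse M) = mQ M by [].
have QE : mQ (reverse M) = mP M by rewrite /mQ pend_rpath oppK.
have [okP okQ ha hb hc] := hair_ok_paths vM.
pose e := (N + size (hP M) * size (hQ M) * (m + N).+1 +
  ((size (pa M).2 * N.+1 + (m + N) * 'C(size (pa M).2, 2)) +
   (size (pb M).2 * N.+1 + (m + N) * 'C(size (pb M).2, 2)) +
   (size (pc M).2 * N.+1 + (m + N) * 'C(size (pc M).2, 2))))%N.
have ke : kequiv (mlist M) (mlist (reverse M)) e.
  have wP : wt (inl (mP M)) = N by case: (mP M) (validP vM).
  have wQ : wt (inl (mQ M)) = N by case: (mQ M) (validQ vM).
  have h1 := @kequiv_swap [::] (inl (mP M)) [::] (inl (mQ M))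
     ([:: ed (pa M).1; ed (pb M).1; ed (pc M).1] ++ hair_blocks (hP M) ++ hair_blocks (hQ M) ++ step_blocks (pa M).2 ++ step_blocks (pb M).2 ++ step_blocks (pc M).2) (etrans wP (esym wQ)).
  rewrite wP in h1.
  have h2 := @kequiv_blocks [:: inl (mQ M); inl (mP M); ed (pa M).1; ed (pb M).1; ed (pc M).1]
     (hair_blocks (hP M)) (hair_blocks (hQ M)) (step_blocks (pa M).2 ++ step_blocks (pb M).2 ++ step_blocks (pc M).2).
  pose HB := hair_blocks (hQ M) ++ hair_blocks (hP M).
  have h3 := @kequiv_rpath [:: inl (mQ M); inl (mP M)] (pa M).1 ([:: ed (pb M).1; ed (pc M).1] ++ HB)
    (pa M).2 (step_blocks (pb M).2 ++ step_blocks (pc M).2) ha.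
  have h4 := @kequiv_rpath [:: inl (mQ M); inl (mP M); ed (pend (pa M))] (pb M).1
    ([:: ed (pc M).1] ++ HB ++ step_blocks (rsteps (pa M).1 (pa M).2))
    (pb M).2 (step_blocks (pc M).2) hb.
  have h5 := @kequiv_rpath [:: inl (mQ M); inl (mP M); ed (pend (pa M)); ed (pend (pb M))] (pc M).1
    (HB ++ step_blocks (rsteps (pa M).1 (pa M).2) ++ step_blocks (rsteps (pb M).1 (pb M).2))
    (pc M).2 [::] hc.
  rewrite /HB -!catA ?cats0 /= -?catA in h1 h2 h3 h4 h5.
  have := kequiv_trans (kequiv_trans h1 h2) (kequiv_trans h3 (kequiv_trans h4 h5)).
  rewrite /mlist /base PE QE; apply: kequiv_parity.
  rewrite /e -!addnA ![odd (_ + _)]oddD; congr (_ (+) (_ (+) _)).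
  by rewrite !oddM !wts_hairs // !oddM; do 3!case: (odd _).
(* Hairs keep their outward direction; only the 3 + a + b + c path edges are reversed. *)
have nf : odd (nflip (reverse M)) = odd (nflip M + (3 + size (pa M).2 + size (pb M).2 + size (pc M).2)).
  have cf (s : seq (half g)) : count snd (map (@opp g) s) = (size s - count snd s)%N.
    rewrite -(count_predC snd s) addKn count_map; exact: eq_count.
  have cp (p : half g * seq (half g * half g)) : count snd ((rpath p).1 :: unzip2 (rpath p).2)
      = ((size p.2).+1 - count snd (p.1 :: unzip2 p.2))%N.
    by rewrite (seq.permP (unzip2_rsteps _ _)) cf /= size_map.
  have cq (p : half g * seq (half g * half g)) : (count snd (p.1 :: unzip2 p.2) <= (size p.2).+1)%N.
    by apply: leq_trans (count_size _ _) _; rewrite /= size_map.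
  have cr (p : half g * seq (half g * half g)) : count snd (unzip1 (rpath p).2) = count snd (unzip1 p.2).
    exact: (seq.permP (unzip1_rsteps _ _)).
  have cE M1 : nflip M1 = (count snd ((pa M1).1 :: unzip2 (pa M1).2) +
     count snd ((pb M1).1 :: unzip2 (pb M1).2) + count snd ((pc M1).1 :: unzip2 (pc M1).2) +
     (count snd (hP M1) + count snd (hQ M1) + (count snd (unzip1 (pa M1).2) +
     count snd (unzip1 (pb M1).2) + count snd (unzip1 (pc M1).2))))%N.
    rewrite /nflip /fdarts /hairs /steps /unzip1 /unzip2 !map_cat /= ?count_cat /= ?count_cat /= ?count_cat /=.
    lia.
  rewrite !cE; rewrite [pa (reverse M)]/= [pb (reverse M)]/= [pc (reverse M)]/=.
  rewrite !cp !cr [hP (reverse M)]/= [hQ (reverse M)]/=.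
  have := cq (pa M); have := cq (pb M); have := cq (pc M); lia.
split; last first.
  rewrite (sgn_change vM ke nf); congr (_ * _); apply: sign_eq.
  rewrite /e /revexp !(oddD, oddM) /=.
  rewrite oddD.
  move: (odd 'C(_, _)) (odd 'C(_, _)) (odd 'C(_, _)) => c1 c2 c3.
  move: (odd (size (pa M).2)) (odd (size (pb M).2)) (odd (size (pc M).2)) => a1 a2 a3.
  move: (odd (size (hP M))) (odd (size (hQ M))) (odd N) (odd m) => b1 b2 n o.
  by case: n; case: o; case: a1; case: a2; case: a3; case: b1; case: b2; case: c1; case: c2; case: c3.
have vC' := (ke (validC vM)).1.
case: (vM) => _ vH vP vQ vPb vPc vQb vQc vhP vhQ vsP vsQ vca vcb vcc; split; rewrite ?PE ?QE ?pend_rpath ?oppK //=; try exact: chain_rsteps.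
- have ar (p : half g * seq (half g * half g)) : all (@hair_ok g) (unzip1 (rpath p).2) = all (@hair_ok g) (unzip1 p.2).
    exact: (eq_all_r (perm_mem (unzip1_rsteps _ _))).
  rewrite /hairs /steps /unzip1 !map_cat !all_cat; apply/and5P; split=> //.
  + exact: etrans (ar (pa M)) ha.
  + exact: etrans (ar (pb M)) hb.
  + exact: etrans (ar (pc M)) hc.
Qed.

End Moves.

Ltac count_lia :=
  repeat match goal with |- context [nat_of_bool ?b] => move: (nat_of_bool b) => ? end;
  repeat match goal with |- context [count ?a ?b] => move: (count a b) => ? end; lia.

(** * Markings of a given graph *)

Section Groups.
Variable g : ograph.
Implicit Types (M : marking (half g)) (d h x : half g) (v : vertex g).

(** An entry pairs a vertex with all half-edges that the marking places there. From these lists,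
    assembled in [groups], valences and frame half-edges are read off. *)
Fixpoint pgroups d (s : seq (half g * half g)) : seq (vertex g * seq (half g)) :=
  if s is (h, d') :: s' then
    [:: (ends g h, [:: opp d; h; d']), (ends g (opp h), [:: opp h]) & pgroups d' s']
  else [::].

Definition hgroups (s : seq (half g)) : seq (vertex g * seq (half g)) :=
  map (fun h => (ends g (opp h), [:: opp h])) s.

Definition groups M :=
  [:: (mP M, [:: (pa M).1; (pb M).1; (pc M).1] ++ hP M),
      (mQ M, [:: opp (pend (pa M)); opp (pend (pb M)); opp (pend (pc M))] ++ hQ M) &
      hgroups (hP M) ++ hgroups (hQ M) ++
      pgroups (pa M).1 (pa M).2 ++ pgroups (pb M).1 (pb M).2 ++ pgroups (pc M).1 (pc M).2].

Definition vertex_of (A B : Type) (x : A + B) : option A := if x is inl v then Some v else None.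

Lemma perm_vertices M : perm_eq (pmap (@vertex_of _ _) (mlist M)) (map fst (groups M)).
Proof.
have hE (s : seq (half g)) : pmap (@vertex_of _ _) (hair_blocks s) = map fst (hgroups s).
  by elim: s => //= h s IH; rewrite -[in RHS]IH.
have sE d (s : seq (half g * half g)) a :
    count a (pmap (@vertex_of _ _) (step_blocks s)) = count a (map fst (pgroups d s)).
  by elim: s d => //= -[h d'] s /= IH d; rewrite (IH d'); lia.
apply/seq.permP => a; rewrite /mlist /groups !pmap_cat !map_cons !map_cat /= !count_cat !hE.
by rewrite (sE (pa M).1) (sE (pb M).1) (sE (pc M).1).
Qed.

Lemma perm_halves M : perm_eq (flatten (map snd (groups M)))
  ((fdarts M ++ hairs M) ++ map (@opp g) (fdarts M ++ hairs M)).
Proof.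
have hE (s : seq (half g)) : flatten (map snd (hgroups s)) = map (@opp g) s.
  by elim: s => //= h s ->.
have sE d (s : seq (half g * half g)) a :
    (count a (flatten (map snd (pgroups d s))) + a (opp (last d (unzip2 s))) + a d =
     count a (d :: unzip2 s) + count a (map (@opp g) (d :: unzip2 s)) + count a (unzip1 s)
      + count a (map (@opp g) (unzip1 s)))%N.
  by elim: s d => [|[h d'] s /= IH] d /=; [lia | have := IH d'; lia].
apply/seq.permP => a; rewrite /groups /fdarts /hairs /steps /unzip1 /unzip2.
have := sE (pa M).1 (pa M).2 a; have := sE (pb M).1 (pb M).2 a; have := sE (pc M).1 (pc M).2 a.
rewrite /unzip1 /unzip2 /pend /= !map_cat !flatten_cat !hE /= ?count_cat /= ?map_cat ?flatten_cat ?hE ?count_cat /= ?count_cat /unzip2.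
count_lia.
Qed.

Lemma half_eq (x y : half g) : x.1 = y.1 -> x = y \/ x = opp y.
Proof.
by case: x y => [e b] [f c] /= ->; case: b; case: c; rewrite /opp /=; auto.
Qed.

Lemma uniq_map_inj_in (T U : eqType) (f : T -> U) (s : seq T) :
  uniq (map f s) -> {in s &, injective f}.
Proof.
elim: s => //= z s IH /andP[zs us] x y; rewrite !inE => /predU1P[->|xs] /predU1P[->|ys] //.
- by move=> e; case/negP: zs; rewrite e map_f.
- by move=> e; case/negP: zs; rewrite -e map_f.
- exact: IH.
Qed.

Section Valid.
Variable M : marking (half g).
Hypothesis vM : valid M.

Lemma uniq_halves : uniq (flatten (map snd (groups M))).
Proof.
have [us _] := edge_dart (validC vM); rewrite (perm_uniq (perm_halves M)).
move: (_ ++ hairs M) us => L us.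
rewrite cat_uniq (map_inj_uniq (inv_inj (@oppK g))) (map_uniq us) andbT.
apply/hasPn => _ /mapP[x xL ->]; apply/negP => oL.
have /= e := uniq_map_inj_in us xL oL erefl.
by case: x e {xL oL} => e [].
Qed.

Lemma mem_halves x : x \in flatten (map snd (groups M)).
Proof.
have [_ /(_ x.1)/mapP[y yL e]] := edge_dart (validC vM).
rewrite (perm_mem (perm_halves M)) mem_cat.
by case: (half_eq e) => ->; rewrite ?yL ?map_f ?orbT.
Qed.

Lemma uniq_groups : uniq (map fst (groups M)).
Proof.
rewrite -(perm_uniq (perm_vertices M)).
by apply: (@pmap_uniq _ _ _ inl) (complete_uniq (validC vM)); case.
Qed.

Lemma mem_groups v : v \in map fst (groups M).
Proof.
rewrite -(perm_mem (perm_vertices M)) mem_pmap.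
by apply/mapP; exists (inl v) => //; apply: mem_complete (validC vM).
Qed.

Lemma group_ends u l : (u, l) \in groups M -> {in l, forall x, ends g x = u}.
Proof.
have pE d s : chain d s -> (u, l) \in pgroups d s -> {in l, forall x, ends g x = u}.
  elim: s d => //= -[h d'] s IH d /and3P[/eqP e1 /eqP e2 c]; rewrite !inE => /or3P[||/(IH _ c)] //.
    by case/eqP => -> -> x; rewrite !inE => /or3P[] /eqP->; rewrite ?e1 ?e2.
  by case/eqP => -> -> x; rewrite !inE => /eqP->.
have hE s : (u, l) \in hgroups s -> {in l, forall x, ends g x = u}.
  by case/mapP => h _ [-> ->] x; rewrite inE => /eqP->.
rewrite !inE !mem_cat => /or3P[||/or4P[||/(pE _ _ (validca vM))|/orP[/(pE _ _ (validcb vM))|/(pE _ _ (validcc vM))]]] //;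
  try exact: hE.
- case/eqP=> -> -> x; rewrite !inE => /or4P[/eqP->|/eqP->|/eqP->|xP]; rewrite ?(validPb vM) ?(validPc vM) //.
  by apply/eqP; apply: (allP (validhP vM)).
- case/eqP=> -> -> x; rewrite !inE => /or4P[/eqP->|/eqP->|/eqP->|xP]; rewrite ?(validQb vM) ?(validQc vM) //.
  by apply/eqP; apply: (allP (validhQ vM)).
Qed.

(** The listed half-edges are attached to u. Conversely every half-edge occurs in some group and
    different groups belong to different vertices, so none is missing. *)
Lemma group_halves u l : (u, l) \in groups M -> l =i halves u.
Proof.
move=> uG x; rewrite inE; apply/idP/eqP => [xl|ex]; first exact: group_ends uG _ xl.
have /flattenP[_ /mapP[[v k] vG ->] /= xk] := mem_halves x.
have ev := group_ends vG xk; rewrite ex in ev; rewrite -{v}ev in vG.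
by case: (uniq_map_inj_in uniq_groups uG vG erefl) => ->.
Qed.

Lemma group_uniq u l : (u, l) \in groups M -> uniq l.
Proof.
move=> uG; have := uniq_halves; elim: (groups M) uG => //= p s IH.
by rewrite inE cat_uniq => /predU1P[<- /and3P[]|/IH h /and3P[_ _ /h]].
Qed.

Lemma fdart_ends x : x \in fdarts M -> ~~ is_ext (ends g x) && ~~ is_ext (ends g (opp x)).
Proof.
have pE d s : chain d s -> all (@hair_ok g) (unzip1 s) -> ~~ is_ext (ends g d) ->
    ~~ is_ext (ends g (opp (last d (unzip2 s)))) -> x \in d :: unzip2 s ->
    ~~ is_ext (ends g x) && ~~ is_ext (ends g (opp x)).
  elim: s d => [|[h d'] s IH] d /=.
    by move=> _ _ dE tE; rewrite inE => /eqP->; rewrite dE.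
  case/and3P => /eqP e1 /eqP e2 c /andP[/andP[h1 h2] hs] dE tE.
  rewrite inE => /predU1P[->|]; first by rewrite dE -e1.
  by apply: IH => //; rewrite e2.
have [_ _ ha hb hc] := hair_ok_paths vM.
rewrite /fdarts /steps /unzip2 !map_cat => xM.
have {xM}/or3P[] : [|| x \in (pa M).1 :: unzip2 (pa M).2, x \in (pb M).1 :: unzip2 (pb M).2 |
     x \in (pc M).1 :: unzip2 (pc M).2].
  move: xM; rewrite /unzip2 !(inE, mem_cat).
  by case/or4P => [->|->|->|/or3P[]->]; rewrite ?orbT.
- exact: (pE _ _ (validca vM) ha (validP vM) (validQ vM)).
- by apply: (pE _ _ (validcb vM) hb); rewrite ?(validPb vM) ?(validP vM) // [ends _ _](validQb vM) (validQ vM).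
- by apply: (pE _ _ (validcc vM) hc); rewrite ?(validPc vM) ?(validP vM) // [ends _ _](validQc vM) (validQ vM).
Qed.

(** For internal v these are the frame half-edges at v. In a marked graph there are three at P and
    at Q and two at every other internal vertex, which characterises the pair P, Q without the
    marking. *)
Definition fr v := [set x | (ends g x == v) && ~~ is_ext (ends g (opp x))].

Lemma mem_starts : [/\ (pa M).1 \in fdarts M, (pb M).1 \in fdarts M & (pc M).1 \in fdarts M].
Proof. by rewrite /fdarts !inE !eqxx ?orbT. Qed.

Lemma mem_pend p : p = pa M \/ p = pb M \/ p = pc M -> pend p \in fdarts M.
Proof.
move=> pE; have : pend p \in p.1 :: unzip2 p.2 by apply: mem_last.
rewrite /fdarts /steps /unzip2 !map_cat !(inE, mem_cat).
by case: pE => [->|[->|->]] /orP[] ->; rewrite ?orbT.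
Qed.

Lemma frP : fr (mP M) =i [:: (pa M).1; (pb M).1; (pc M).1] /\ uniq [:: (pa M).1; (pb M).1; (pc M).1].
Proof.
have G : (mP M, [:: (pa M).1; (pb M).1; (pc M).1] ++ hP M) \in groups M by rewrite inE eqxx.
split; last by have := group_uniq G; rewrite cat_uniq => /andP[].
move=> x; rewrite inE (_ : (ends g x == mP M) = (x \in [:: (pa M).1; (pb M).1; (pc M).1] ++ hP M)); last by rewrite (group_halves G x) inE.
have [okP _ _ _ _] := hair_ok_paths vM; have [sa sb sc] := mem_starts.
rewrite mem_cat; case xs: (x \in [:: _; _; _]) => /=.
  by move: xs; rewrite !inE => /or3P[] /eqP->; [case/andP: (fdart_ends sa)|case/andP: (fdart_ends sb)|case/andP: (fdart_ends sc)].
by apply/negP => /andP[/(allP okP)/andP[_ ->]].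
Qed.

Lemma frQ : fr (mQ M) =i [:: opp (pend (pa M)); opp (pend (pb M)); opp (pend (pc M))] /\
  uniq [:: opp (pend (pa M)); opp (pend (pb M)); opp (pend (pc M))].
Proof.
have G : (mQ M, [:: opp (pend (pa M)); opp (pend (pb M)); opp (pend (pc M))] ++ hQ M) \in groups M.
  by rewrite !inE eqxx orbT.
split; last by have := group_uniq G; rewrite cat_uniq => /andP[].
move=> x; rewrite inE (_ : (ends g x == mQ M) = (x \in [:: opp (pend (pa M)); opp (pend (pb M)); opp (pend (pc M))] ++ hQ M)); last by rewrite (group_halves G x) inE.
have [_ okQ _ _ _] := hair_ok_paths vM.
rewrite mem_cat; case xs: (x \in [:: _; _; _]) => /=; last first.
  by apply/negP => /andP[/(allP okQ)/andP[_ ->]].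
have h p : p = pa M \/ p = pb M \/ p = pc M -> ~~ is_ext (ends g (pend p)).
  by move=> /mem_pend/fdart_ends/andP[].
by move: xs; rewrite !inE => /or3P[] /eqP->; rewrite oppK h; auto.
Qed.

Lemma card_list (T : finType) (A : {set T}) (s : seq T) : A =i s -> uniq s -> #|A| = size s.
Proof. by move=> As us; rewrite (eq_card As); apply/card_uniqP. Qed.

End Valid.
End Groups.

(** * Two markings of a graph differ by symmetries *)

Section Unique.
Variable g : ograph.
Implicit Types (M : marking (half g)) (d h x : half g) (v : vertex g).

Lemma pgroups_mem d s u l : (u, l) \in pgroups d s ->
  (exists h d0 d1, [/\ h \in unzip1 s, d0 \in d :: unzip2 s, d1 \in d :: unzip2 s,
     u = ends g h & l = [:: opp d0; h; d1]])
  \/ (exists2 h, h \in unzip1 s & u = ends g (opp h)).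
Proof.
elim: s d => //= -[h d'] s IH d; rewrite !inE => /or3P[/eqP[-> ->]|/eqP[-> ->]|/IH].
- by left; exists h, d, d'; rewrite !inE !eqxx !orbT.
- by right; exists h; rewrite // inE eqxx.
case=> [[h0 [d0 [d1 [h0s d0s d1s -> ->]]]]|[h0 h0s ->]].
  by left; exists h0, d0, d1; rewrite inE h0s orbT /= !(in_cons d) d0s d1s !orbT.
by right; exists h0; rewrite // inE h0s orbT.
Qed.

Definition is_path M (p : half g * seq (half g * half g)) := [\/ p = pa M, p = pb M | p = pc M].

Lemma path_fdarts M p : is_path M p -> {subset p.1 :: unzip2 p.2 <= fdarts M}.
Proof.
move=> pP x; rewrite /fdarts /steps /unzip2 !map_cat !(inE, mem_cat).
by case: pP => -> /orP[] ->; rewrite ?orbT.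
Qed.

Lemma path_groups M p : is_path M p -> {subset pgroups p.1 p.2 <= groups M}.
Proof.
move=> pP x; rewrite !inE !mem_cat.
by case: pP => -> ->; rewrite ?orbT.
Qed.

Section Valid.
Variable M : marking (half g).
Hypothesis vM : valid M.

Lemma path_hairs p : is_path M p -> all (@hair_ok g) (unzip1 p.2).
Proof. by have [_ _ ha hb hc] := hair_ok_paths vM; case=> ->. Qed.

Lemma path_chain p : is_path M p -> chain p.1 p.2.
Proof. by case=> ->; case: vM. Qed.

Lemma path_end p : is_path M p -> ends g (opp (pend p)) = mQ M.
Proof. by case=> ->; case: vM. Qed.

Lemma path_start p : is_path M p -> ends g p.1 = mP M.
Proof. by case=> ->; case: vM. Qed.

Lemma fr_interior h d d' : (ends g h, [:: opp d; h; d']) \in groups M -> hair_ok h ->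
  d \in fdarts M -> d' \in fdarts M ->
  fr (ends g h) =i [:: opp d; d'] /\ uniq [:: opp d; d'].
Proof.
move=> G /andP[_ ho] dM d'M; split; last first.
  by have := group_uniq vM G; rewrite /= !inE negb_or -andbA => /and4P[_ -> _ _].
move=> x; rewrite inE (_ : (ends g x == ends g h) = (x \in [:: opp d; h; d'])); last first.
  by rewrite (group_halves vM G) inE.
rewrite !inE; case: (eqVneq x (opp d)) => [->|_] /=; first by rewrite oppK; case/andP: (fdart_ends vM dM).
case: (eqVneq x d') => [->|_] /=; first by rewrite orbT; case/andP: (fdart_ends vM d'M).
by rewrite orbF; case: eqP => // ->; rewrite ho.
Qed.

Lemma group_kind v : ~~ is_ext v -> [\/ v = mP M, v = mQ M |
  exists h d d', [/\ hair_ok h, d \in fdarts M, d' \in fdarts M, v = ends g h &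
     (v, [:: opp d; h; d']) \in groups M]].
Proof.
move=> iv; have /mapP[[u l] uG /= vE] := mem_groups vM v; rewrite -{u}vE in uG.
have hE s : all (@hair_ok g) s -> (v, l) \in hgroups s -> False.
  by move=> /allP ok /mapP[h /ok/andP[_ h2] [vE _]]; rewrite vE h2 in iv.
have [okP okQ _ _ _] := hair_ok_paths vM.
have pE p : is_path M p -> (v, l) \in pgroups p.1 p.2 -> exists h d d', [/\ hair_ok h, d \in fdarts M, d' \in fdarts M, v = ends g h &
     (v, [:: opp d; h; d']) \in groups M].
  move=> pP vp; have := pgroups_mem vp; have /allP ok := path_hairs pP.
  case=> [[h [d [d' [hp dp d'p vE lE]]]]|[h /ok/andP[_ h2] vE]]; last by rewrite vE h2 in iv.
  exists h, d, d'; rewrite ok // !(path_fdarts pP) //; split=> //.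
  by rewrite -lE (path_groups pP).
move: uG; rewrite !inE !mem_cat => /or3P[/eqP[-> _]|/eqP[-> _]|/or4P[/hE|/hE|/pE|/orP[/pE|/pE]]];
  try by [constructor 1|constructor 2|case].
- by move=> /(_ (Or31 _ _ erefl)) h; constructor 3.
- by move=> /(_ (Or32 _ _ erefl)) h; constructor 3.
- by move=> /(_ (Or33 _ _ erefl)) h; constructor 3.
Qed.

Lemma neqPQ : mP M <> mQ M.
Proof. by have := uniq_groups vM; rewrite /= inE negb_or => /andP[/andP[/eqP]]. Qed.

Lemma card_frP : #|fr (mP M)| = 3.
Proof. by have [e u] := frP vM; rewrite (card_list e u). Qed.

Lemma card_frQ : #|fr (mQ M)| = 3.
Proof. by have [e u] := frQ vM; rewrite (card_list e u). Qed.

Lemma card_fr3 v : ~~ is_ext v -> #|fr v| = 3 -> v = mP M \/ v = mQ M.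
Proof.
move=> iv c3; case: (group_kind iv) => [->|->|[h [d [d' [ok dM d'M vE G]]]]]; [by left|by right|].
rewrite vE in G; have [e u] := fr_interior G ok dM d'M.
by move: c3; rewrite vE (card_list e u).
Qed.

Lemma mem_hP h : (h \in hP M) = (ends g h == mP M) && is_ext (ends g (opp h)).
Proof.
apply/idP/andP => [hM|[/eqP eh xh]].
  have [/allP/(_ _ hM)/andP[_ ->] _ _ _ _] := hair_ok_paths vM.
  by rewrite (allP (validhP vM)).
have G : (mP M, [:: (pa M).1; (pb M).1; (pc M).1] ++ hP M) \in groups M by rewrite inE eqxx.
have : h \in [:: (pa M).1; (pb M).1; (pc M).1] ++ hP M by rewrite (group_halves vM G) inE eh.
have [fE _] := frP vM; rewrite mem_cat -fE => /orP[|//].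
by rewrite inE xh andbF.
Qed.

End Valid.

Section Two.
Variables M M' : marking (half g).
Hypotheses (vM : valid M) (vM' : valid M').

(** An interior vertex has just two frame half-edges and one hair, so the path can continue in only
    one way. Neither path can stop before the other: it would stop at a vertex with three frame
    half-edges where the other one sees two. *)
Lemma path_eq d s s' : chain d s -> chain d s' ->
  {subset pgroups d s <= groups M} -> {subset pgroups d s' <= groups M'} ->
  {subset d :: unzip2 s <= fdarts M} -> {subset d :: unzip2 s' <= fdarts M'} ->
  all (@hair_ok g) (unzip1 s) -> all (@hair_ok g) (unzip1 s') ->
  ends g (opp (last d (unzip2 s))) = mQ M -> ends g (opp (last d (unzip2 s'))) = mQ M' ->
  s = s'.
Proof.
elim: s s' d => [|[h k] s IH] [|[h' k'] s'] d //=.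
- move=> _ /and3P[/eqP e1 _ _] _ G _ F _ /andP[ok _] e2 _.
  have [||f1 f2] := fr_interior vM' (G _ (mem_head _ _)) ok; try by apply: F; rewrite !inE eqxx ?orbT.
  by have := card_frQ vM; rewrite -e2 -e1 (card_list f1 f2).
- move=> /and3P[/eqP e1 _ _] _ G _ F _ /andP[ok _] _ _ e2.
  have [||f1 f2] := fr_interior vM (G _ (mem_head _ _)) ok; try by apply: F; rewrite !inE eqxx ?orbT.
  by have := card_frQ vM'; rewrite -e2 -e1 (card_list f1 f2).
move=> /and3P[/eqP e1 /eqP e2 c] /and3P[/eqP e1' /eqP e2' c'] G G' F F' /andP[ok oks] /andP[ok' oks'] E E'.
have g1 := G _ (mem_head _ _); have g1' := G' _ (mem_head _ _).
have [||f1 f2] := fr_interior vM g1 ok; try by apply: F; rewrite !inE eqxx ?orbT.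
have [||f1' f2'] := fr_interior vM' g1' ok'; try by apply: F'; rewrite !inE eqxx ?orbT.
have ehh : ends g h' = ends g h by rewrite e1 e1'.
have kk : k' = k.
  have := f1' k'; rewrite ehh f1 !inE eqxx orbT => /orP[/eqP kd|/eqP//].
  by move: f2'; rewrite /= kd inE eqxx.
have hh : h' = h.
  have := group_halves vM g1 h'; rewrite !inE ehh eqxx => /or3P[/eqP hd|/eqP//|/eqP hk].
    have dM : d \in fdarts M by apply: F; rewrite inE eqxx.
    by case/andP: ok' => _; rewrite hd oppK; case/andP: (fdart_ends vM dM) => /negbTE->.
  have kM : k \in fdarts M by apply: F; rewrite !inE eqxx orbT.
  by case/andP: ok' => _; rewrite hk; case/andP: (fdart_ends vM kM) => _ /negbTE->.
clear ok' g1' f1' f2' ehh e1' e2'; subst h' k'.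
congr (_ :: _); apply: (IH s' k) => //.
- by move=> x xs; apply: G; rewrite !inE xs !orbT.
- by move=> x xs; apply: G'; rewrite !inE xs !orbT.
- by move=> x xs; apply: F; rewrite inE xs orbT.
- by move=> x xs; apply: F'; rewrite inE xs orbT.
Qed.

Lemma seq1_eq (T : eqType) (s t : seq T) : (size s <= 1)%N -> (size t <= 1)%N -> s =i t -> s = t.
Proof.
case: s t => [|x [|? ?]] [|y [|? ?]] //= _ _ st.
- by have := st y; rewrite !inE eqxx.
- by have := st x; rewrite !inE eqxx.
- by have := st x; rewrite !inE eqxx => /esym/eqP->.
Qed.

Lemma same_start : (pa M).1 = (pa M').1 -> (pb M).1 = (pb M').1 -> (pc M).1 = (pc M').1 -> M = M'.
Proof.
move=> ea eb ec.
have pE p p' : is_path M p -> is_path M' p' -> p.1 = p'.1 -> p = p'.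
  move=> pP pP' e; case: p p' e pP pP' => [d s] [d' s'] /= <- pP pP'; congr (_, _).
  apply: (path_eq (path_chain vM pP) (path_chain vM' pP')).
  - exact: (path_groups pP).
  - exact: (path_groups pP').
  - exact: (path_fdarts pP).
  - exact: (path_fdarts pP').
  - exact: (path_hairs vM pP).
  - exact: (path_hairs vM' pP').
  - exact: (path_end vM pP).
  - exact: (path_end vM' pP').
have Ea : pa M = pa M' by apply: pE; [constructor 1|constructor 1|].
have Eb : pb M = pb M' by apply: pE; [constructor 2|constructor 2|].
have Ec : pc M = pc M' by apply: pE; [constructor 3|constructor 3|].
have PE : mP M = mP M' by rewrite /mP Ea.
have QE : mQ M = mQ M' by rewrite /mQ Ea.
have EP : hP M = hP M'.
  apply: seq1_eq; [by case: vM|by case: vM'|move=> h].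
  by rewrite (mem_hP vM) (mem_hP vM') PE.
have EQ : hQ M = hQ M'.
  (* A hair at Q is a hair at P of the reversed marking. Only validity is used here, so the
     parameters 0 0 are arbitrary. *)
  have [v1 _] := reverseP 0 0 vM; have [v2 _] := reverseP 0 0 vM'.
  apply: seq1_eq; [by case: vM|by case: vM'|move=> h].
  have := mem_hP v1 h; have := mem_hP v2 h.
  by rewrite /= -[mP (reverse M)]/(mQ M) -[mP (reverse M')]/(mQ M') QE => -> ->.
by case: M M' Ea Eb Ec EP EQ => [? ? ? ? ?] [? ? ? ? ?] /= -> -> -> -> ->.
Qed.
End Two.

Section Invariant.
Variables (m N : nat) (X : nat * nat * nat * nat * nat -> rat).
Hypotheses
 (Xab : forall a b c p q, X (b, a, c, p, q) = (-1) ^+ (N.+1 + (m + N) * (a * b)) * X (a, b, c, p, q))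
 (Xbc : forall a b c p q, X (a, c, b, p, q) = (-1) ^+ (N.+1 + (m + N) * (b * c)) * X (a, b, c, p, q))
 (Xrev : forall a b c p q, X (a, b, c, q, p) = (-1) ^+ (revexp m N a b c p q) * X (a, b, c, p, q)).

(** Under each of the symmetries both factors change by the same sign, so the product is independent
    of the marking. *)
Definition inv M := sgn m N M * X (mtype M).

Lemma inv_ab M : valid M -> inv (swap_ab M) = inv M.
Proof.
move=> vM; rewrite /inv (swap_abP m N vM).2 /mtype /= Xab mulrACA -exprD addnn.
by rewrite -signr_odd odd_double mul1r.
Qed.

Lemma inv_bc M : valid M -> inv (swap_bc M) = inv M.
Proof.
move=> vM; rewrite /inv (swap_bcP m N vM).2 /mtype /= Xbc mulrACA -exprD addnn.
by rewrite -signr_odd odd_double mul1r.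
Qed.

Lemma inv_rev M : valid M -> inv (reverse M) = inv M.
Proof.
move=> vM; rewrite /inv (reverseP m N vM).2 /mtype /= !size_rsteps Xrev mulrACA -exprD addnn.
by rewrite -signr_odd odd_double mul1r.
Qed.

(** If P agrees, the two markings have the same three starting half-edges up to order. Path
    exchanges align the first and the second of them, the third follows, and the starts determine
    the marking. *)
Lemma inv_sameP M M' : valid M -> valid M' -> mP M = mP M' -> inv M = inv M'.
Proof.
move=> v v' PE.
have [f u] := frP v'; rewrite -PE in f.
have mem M1 : valid M1 -> mP M1 = mP M -> forall x,
   (x \in [:: (pa M1).1; (pb M1).1; (pc M1).1]) = (x \in [:: (pa M').1; (pb M').1; (pc M').1]).
  by move=> v1 PE1 x; have [f1 _] := frP v1; rewrite -f1 PE1 f.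
wlog ea : M v PE f mem / (pa M).1 = (pa M').1.
  move=> H; have := mem M v erefl (pa M').1; rewrite !inE eqxx /=.
  have [v1 _] := swap_abP m N v; have [v2 _] := swap_bcP m N v; have [v3 _] := swap_abP m N v2.
  have P1 : mP (swap_ab M) = mP M by rewrite /mP /= (validPb v).
  have P3 : mP (swap_ab (swap_bc M)) = mP M by rewrite /mP /= (validPc v).
  case/or3P => /eqP e.
  - exact: H.
  - by rewrite -(inv_ab v); apply: H; rewrite ?P1.
  - by rewrite -(inv_bc v) -(inv_ab v2); apply: H; rewrite ?P3.
wlog eb : M v PE f mem ea / (pb M).1 = (pb M').1.
  move=> H; have := mem M v erefl (pb M').1; rewrite !inE !eqxx orbT.
  have [v2 _] := swap_bcP m N v.
  case/or3P => /eqP e.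
  - by move: u; rewrite /= !inE -ea -e eqxx.
  - exact: H.
  - by rewrite -(inv_bc v); apply: H.
have ec : (pc M).1 = (pc M').1.
  have := mem M v erefl (pc M').1; rewrite !inE !eqxx !orbT ea eb.
  case/or3P => /eqP e //; move: u; rewrite /= !inE -e eqxx ?orbT ?andbF //.
by rewrite (same_start v v' ea eb ec).
Qed.

Lemma inv_eq M M' : valid M -> valid M' -> inv M = inv M'.
Proof.
move=> v v'; case: (card_fr3 v' (validP v) (card_frP v)) => e; first exact: inv_sameP.
have [vr _] := reverseP m N v'.
by rewrite -(inv_rev v'); apply: inv_sameP.
Qed.

End Invariant.
End Unique.

Lemma oiso_sym g h : oiso g h -> oiso h g.
Proof.
case=> fx [fi [fe [[fxB fiB feB] [eE oE]]]].
case: fxB => fx' X1 X2; case: fiB => fi' I1 I2; case: feB => fe' E1 E2.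
exists fx', fi', fe'; split; first by split; [exists fx|exists fi|exists fe].
split=> [e b|].
  rewrite -{2}[e]E2 eE; case: (ends g (fe' e, b)) => x /=; by rewrite ?X1 ?I1.
rewrite oE -map_comp -[LHS]map_id; apply: eq_map; case=> [[x|x]|x] /=; by rewrite ?X1 ?I1 ?E1.
Qed.

(** * Linear functionals from equivariant functions of the type *)

Section Functional.
Variables (m N : nat) (X : nat * nat * nat * nat * nat -> rat).
Hypotheses
 (Xab : forall a b c p q, X (b, a, c, p, q) = (-1) ^+ (N.+1 + (m + N) * (a * b)) * X (a, b, c, p, q))
 (Xbc : forall a b c p q, X (a, c, b, p, q) = (-1) ^+ (N.+1 + (m + N) * (b * c)) * X (a, b, c, p, q))
 (Xrev : forall a b c p q, X (a, b, c, q, p) = (-1) ^+ (revexp m N a b c p q) * X (a, b, c, p, q)).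

Local Notation cls := (cls m N).

(** The value 0 on graphs without a marking is consistent, because the orientation relations
    preserve the existence of a marking. *)
Definition phi (g : ograph) : rat :=
  match pselect (exists M : marking (half g), valid M) with
  | left e => inv m N X (projT1 (cid e))
  | right _ => 0
  end.

Lemma phiE g (M : marking (half g)) : valid M -> phi g = inv m N X M.
Proof.
move=> vM; rewrite /phi; case: pselect => [e|[]]; last by exists M.
exact: (inv_eq Xab Xbc Xrev) (projT2 (cid e)) vM.
Qed.

Lemma phi0 g : ~ (exists M : marking (half g), valid M) -> phi g = 0.
Proof. by move=> nM; rewrite /phi; case: pselect. Qed.

Lemma phi_iso g h : oiso g h -> phi g = phi h.
Proof.
move=> gh; have [[M vM]|nM] := pselect (exists M : marking (half g), valid M).
  have [M' [vM' tM sM]] := marking_iso m N gh vM.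
  by rewrite (phiE vM) (phiE vM') /inv tM sM.
rewrite (phi0 nM) phi0 // => -[M vM]; apply: nM.
by have [M' [vM' _ _]] := marking_iso m N (oiso_sym gh) vM; exists M'.
Qed.

Lemma flip_flip g (e : edge g) : @flip (flip e) e = g.
Proof.
case: g e => x i n E o e; apply: ograph_eq => // -[f b].
rewrite !ffunE; congr (E _); rewrite /flip_half /=.
by case: eqP; rewrite ?negbK.
Qed.

Lemma phi_flip g (e : edge g) : phi (flip e) = (-1) ^+ N * phi g.
Proof.
have [[M vM]|nM] := pselect (exists M : marking (half g), valid M).
  have [M' [vM' tM sM _]] := marking_flip m N e vM.
  rewrite (phiE vM) (phiE vM') /inv tM sM. exact: esym (mulrA _ _ _).
rewrite (phi0 nM) mulr0 phi0 // => -[M vM]; apply: nM.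
have [M' [vM' _ _ _]] := marking_flip m N (e : edge (flip e)) vM.
by rewrite flip_flip in M' vM'; exists M'.
Qed.

Lemma phi_reorder g (o : total_order_of (element g)) :
  phi (reorder o) = koszul (@degree m N _ _ _) (val (order g)) (val o) * phi g.
Proof.
have [[M vM]|nM] := pselect (exists M : marking (half g), valid M).
  have [M' [vM' tM sM]] := marking_reorder m N o vM.
  rewrite (phiE vM) (phiE vM') /inv tM sM; exact: esym (mulrA _ _ _).
rewrite (phi0 nM) mulr0 phi0 // => -[M vM]; apply: nM.
by exists M; case: vM => *; split.
Qed.

Lemma sgn_sq g (M : marking (half g)) : sgn m N M * sgn m N M = 1.
Proof. by rewrite /sgn mulrACA koszul_sq mul1r -exprD addnn -signr_odd odd_double. Qed.

(** Counterpart of [same_type_cls]: it shows that the generators satisfy no relations beyond those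
    imposed by path exchanges and reversal, since every function with these symmetries extends
    linearly. *)
Lemma functional_exists : exists F : graph_space m N -> rat,
  (forall a x y, F (a *: x + y) = a * F x + F y) /\
  forall g (M : marking (half g)), valid M -> F (sgn m N M *: cls g) = X (mtype M).
Proof.
pose Phi : chains -> rat^o := fglift (phi : ograph -> rat^o).
have PhiU g : Phi << g >> = phi g by rewrite /Phi liftU scale1r.
have PhiP a x y : Phi (a *: x + y) = a * Phi x + Phi y by rewrite /Phi raddfD /= linearZ.
have Phi00 : Phi 0 = 0 by rewrite /Phi raddf0.
have Phi0 x : x \in relations m N -> Phi x = 0.
  move=> /asboolP; elim=> [//|a u y Ru _ IH].
  rewrite PhiP IH addr0; apply/eqP; rewrite mulf_eq0; apply/orP; right; apply/eqP.
  case: Ru => [g h gh|g e|g o].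
  - by rewrite -[- _]scaleN1r addrC PhiP !PhiU (phi_iso gh) mulN1r addNr.
  - by rewrite -scaleNr addrC PhiP !PhiU phi_flip mulNr addNr.
  - by rewrite -scaleNr addrC PhiP !PhiU phi_reorder mulNr addNr.
have Fp x : Phi (generic_quotient.repr (proj m N x)) = Phi x.
  have /projP/Phi0 : proj m N (generic_quotient.repr (proj m N x)) = proj m N x by rewrite proj_repr.
  by rewrite -[- _]scaleN1r addrC PhiP mulN1r => /eqP; rewrite addrC subr_eq0 => /eqP.
exists (fun c => Phi (generic_quotient.repr c)); split=> [a x y|g M vM].
  by rewrite -{1}[x]proj_repr -{1}[y]proj_repr -linearP Fp PhiP.
rewrite /Defs.cls -linearZ Fp -[_ *: _]addr0 PhiP Phi00 addr0 PhiU (phiE vM) /inv.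
by rewrite mulrA sgn_sq mul1r.
Qed.

End Functional.

Local Close Scope ring_scope.

(** * Marked graphs are two-loop hairy *)

Section Adjacency.
Variable g : ograph.
Implicit Types (x d h : half g) (u v w : vertex g) (A : {set edge g}) (W : {set vertex g}).

Lemma adjacentP A u w : reflect (exists2 x : half g, x.1 \in A & ends g x = u /\ ends g (opp x) = w)
  (adjacent A u w).
Proof.
apply: (iffP exists_inP) => [[e eA /existsP[b /andP[/eqP e1 /eqP e2]]]|[[e b] /= eA [e1 e2]]].
  by exists (e, b).
by exists e => //; apply/existsP; exists b; rewrite e1 -e2 /opp /= !eqxx.
Qed.

Lemma adjacent_sym A : symmetric (adjacent A).
Proof.
move=> u w; apply/adjacentP/adjacentP => -[x xA [e1 e2]]; by exists (opp x); rewrite ?oppK.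
Qed.

Lemma connect_adj_sym A : connect_sym (adjacent A).
Proof. exact: (sym_connect_sym (adjacent_sym A)). Qed.

Lemma adj_half A x : x.1 \in A -> connect (adjacent A) (ends g x) (ends g (opp x)).
Proof. by move=> xA; apply/connect1/adjacentP; exists x. Qed.

Lemma closed_all A u (S : pred (vertex g)) : (forall w, connect (adjacent A) u w) -> S u ->
  (forall x, x.1 \in A -> S (ends g x) -> S (ends g (opp x))) -> forall w, S w.
Proof.
move=> con Su cl w; have /connectP[p pu ->] := con w.
elim: p u Su pu {con w} => //= w p IH u Su /andP[/adjacentP[x xA [e1 e2]] pw].
by apply: IH pw; rewrite -e2; apply: cl => //; rewrite e1.
Qed.

(** Removing the edge isolates its univalent vertex, which is a tree. The other part keeps all
    remaining vertices and edges, hence Betti number 2, and is not a tree. *)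
Lemma leaf_tree_type (e : edge g) b (x : 'I_(nx g)) : admissible g ->
  betti1 [set: vertex g] [set: edge g] = 2 -> ends g (e, b) = inl x -> tree_type e.
Proof.
case/and4P => _ /andP[_ /forall_inP con] /forallP vx /forallP vi b2 ex.
have {}con u w : connect (adjacent [set: edge g]) u w.
  by have /forall_inP/(_ w) := con u (in_setT _); apply; rewrite inE.
have /eqP/cards1P[h hE] := eqP (vx x).
have h1 y : ends g y = inl x -> y = (e, b).
  move=> ey; have : y \in halves (inl x : vertex g) by rewrite inE ey.
  rewrite hE inE => /eqP->; apply/esym/eqP; rewrite -in_set1 -hE inE ex //.
have ne_y : ends g (e, ~~ b) != inl x.
  by apply/eqP => /h1 [] /eqP; case: (b).
pose A : {set edge g} := [set~ e].
have stuck w : connect (adjacent A) (inl x) w -> w = inl x.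
  case/connectP => -[|w' p] /= => [_ ->//|/andP[/adjacentP[y yA [e1 _]] _] _].
  by move: yA; rewrite (h1 _ e1) !inE eqxx.
have part1 : component A (inl x) = [set inl x].
  apply/setP => w; rewrite !inE; apply/idP/eqP => [/stuck//|->]; exact: connect0.
have tree1 : is_tree (component A (inl x)) (edges_within (component A (inl x)) A).
  rewrite part1 /is_tree /betti1 cards1; apply/andP; split; last first.
    rewrite (_ : edges_within _ _ = set0) ?cards0 //.
    apply/setP => f; rewrite !inE; apply/negP => /andP[fe /forallP/(_ false)]; rewrite !inE => /eqP/h1[fE _].
    by rewrite fE eqxx in fe.
  apply/andP; split; first by apply/set0Pn; exists (inl x); rewrite inE.
  by apply/forall_inP => u; rewrite inE => /eqP->; apply/forall_inP => w; rewrite inE => /eqP->; apply: connect0.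
pose y := ends g (e, ~~ b).
have part2 w : w != inl x -> w \in component A y.
  have : (w == inl x) || (w \in component A y); last by case: eqP.
  move: w; apply: (@closed_all setT (inl x)) => [|//|z _]; first by [].
    by rewrite eqxx.
  case: (eqVneq z.1 e) => [ze _|nze].
    case: (half_eq (x := z) (y := (e, b)) ze) => ->.
      by apply/orP; right; rewrite inE; apply: connect0.
    by rewrite oppK ex eqxx.
  have zA : z.1 \in A by rewrite !inE.
  case/orP => [/eqP/h1 zE|]; first by rewrite zE eqxx in nze.
  rewrite !inE => cz; apply/orP; right; apply: connect_trans cz _; exact: adj_half.
have part2E : component A y = [set~ inl x].
  apply/setP => w; rewrite [RHS]inE; case: (eqVneq w (inl x)) => [->|nw] /=.
    rewrite !inE eqxx; apply/negP => cyx; have /stuck/eqP : connect (adjacent A) (inl x) y.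
      by rewrite connect_adj_sym.
    by rewrite (negbTE ne_y).
  rewrite part2 // !inE nw //.
have tree2 : ~~ is_tree (component A y) (edges_within (component A y) A).
  rewrite part2E; rewrite /is_tree negb_and; apply/orP; right.
  have -> : edges_within [set~ inl x] A = A.
    apply/setP => f; rewrite inE; case fA : (f \in A) => //=; apply/forallP => c.
    rewrite !inE; apply/eqP => /h1 [fe]; by move: fA; rewrite fe !inE eqxx.
  move: b2; rewrite /betti1 !cardsT !cardsC1 => b2; apply/eqP.
  have : 0 < #|{: edge g}| by apply/card_gt0P; exists e.
  have : 0 < #|{: vertex g}| by apply/card_gt0P; exists y.
  lia.
have nc : ~~ connect (adjacent A) (inl x) y.
  by apply/negP => /stuck /eqP; rewrite (negbTE ne_y).
rewrite /tree_type -/A; move: ex nc tree1 tree2; rewrite /y; case: (b) => /= ->.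
  by rewrite connect_adj_sym => -> -> /negbTE->.
by move=> -> -> /negbTE->.
Qed.

End Adjacency.

(** * Numerical invariants and connectedness of a marked graph *)

Section Hairy.
Variable g : ograph.
Implicit Types (M : marking (half g)) (x d h : half g) (u v w : vertex g).

Definition iverts M := [:: mP M, mQ M & map (ends g) (unzip1 (steps M))].

Lemma iverts_filter M : valid M ->
  perm_eq (filter (fun v => ~~ is_ext v) (map fst (groups M))) (iverts M).
Proof.
move=> vM; have [okP okQ ha hb hc] := hair_ok_paths vM.
have hE s : all (@hair_ok g) s -> filter (fun v => ~~ is_ext v) (map fst (hgroups s)) = [::].
  by elim: s => //= h s IH /andP[/andP[_ ->] /IH].
have pE d s : all (@hair_ok g) (unzip1 s) ->
    filter (fun v => ~~ is_ext v) (map fst (pgroups d s)) = map (ends g) (unzip1 s).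
  by elim: s d => //= -[h d'] s IH d /= /andP[/andP[-> ->] /= /IH->].
rewrite /groups /iverts /steps /unzip1 !map_cons !map_cat /= (negbTE (validP vM)) (negbTE (validQ vM)) /=.
by rewrite !filter_cat (hE _ okP) (hE _ okQ) !pE.
Qed.

Section Valid.
Variable M : marking (half g).
Hypothesis vM : valid M.

Lemma uniq_iverts : uniq (iverts M).
Proof. by rewrite -(perm_uniq (iverts_filter vM)) filter_uniq // uniq_groups. Qed.

Lemma mem_iverts v : (v \in iverts M) = ~~ is_ext v.
Proof. by rewrite -(perm_mem (iverts_filter vM)) mem_filter (mem_groups vM) andbT. Qed.

Lemma perm_groups : perm_eq (map fst (groups M)) (enum {: vertex g}).
Proof.
by apply: uniq_perm (uniq_groups vM) (enum_uniq _) _ => v; rewrite mem_enum (mem_groups vM).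
Qed.

Lemma size_pgroups d (s : seq (half g * half g)) : size (pgroups d s) = (size s).*2.
Proof. by elim: s d => //= -[h d'] s IH d /=; rewrite IH. Qed.

Lemma card_vertices : #|{: vertex g}| = 2 + (size (hP M) + size (hQ M)) + (size (steps M)).*2.
Proof.
rewrite cardE -(perm_size perm_groups) size_map /= ?size_cat !size_map !size_pgroups /steps ?size_cat; lia.
Qed.

Lemma perm_edges_enum : perm_eq (map fst (fdarts M ++ hairs M)) (enum {: edge g}).
Proof.
have [us ms] := edge_dart (validC vM).
by apply: uniq_perm us (enum_uniq _) _ => e; rewrite mem_enum ms.
Qed.

Lemma card_edges : #|{: edge g}| = 3 + (size (hP M) + size (hQ M)) + (size (steps M)).*2.
Proof.
rewrite cardE -(perm_size perm_edges_enum) size_map !size_cat /= /unzip1 /unzip2 !size_map /steps ?size_cat; lia.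
Qed.

Lemma betti_marking : betti1 [set: vertex g] [set: edge g] = 2.
Proof. by rewrite /betti1 !cardsT card_vertices card_edges; lia. Qed.

Lemma valence_group v l : (v, l) \in groups M -> valence v = size l.
Proof.
by move=> G; rewrite /valence (card_list (s := l)) ?(group_uniq vM G) // => x; rewrite (group_halves vM G).
Qed.

Lemma valence_ext v : is_ext v -> valence v = 1.
Proof.
move=> xv; have /mapP[[u l] uG /= vE] := mem_groups vM v; rewrite -{u}vE in uG.
rewrite (valence_group uG).
have hE s : (v, l) \in hgroups s -> size l = 1 by case/mapP => h _ [_ ->].
have pE d s : all (@hair_ok g) (unzip1 s) -> (v, l) \in pgroups d s -> size l = 1.
  elim: s d => //= -[h d'] s IH d /andP[/andP[h1 _] /IH {}IH]; rewrite !inE.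
  by case/or3P => [/eqP[e _]|/eqP[_ ->]|/IH] //; rewrite -e xv in h1.
have [_ _ ha hb hc] := hair_ok_paths vM.
move: uG; rewrite !inE !mem_cat.
case/or3P => [/eqP[e _]|/eqP[e _]|/or4P[/hE|/hE|/(pE _ _ ha)|/orP[/(pE _ _ hb)|/(pE _ _ hc)]]] //.
- by have := validP vM; rewrite -e xv.
- by have := validQ vM; rewrite -e xv.
Qed.

Lemma valence_P : valence (mP M) = 3 + size (hP M).
Proof. by rewrite (@valence_group _ ([:: (pa M).1; (pb M).1; (pc M).1] ++ hP M)) // inE eqxx. Qed.

Lemma valence_Q : valence (mQ M) = 3 + size (hQ M).
Proof.
by rewrite (@valence_group _ ([:: opp (pend (pa M)); opp (pend (pb M)); opp (pend (pc M))] ++ hQ M)) // !inE eqxx orbT.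
Qed.

Lemma valence_step h : h \in unzip1 (steps M) -> valence (ends g h) = 3.
Proof.
have pE d s : h \in unzip1 s -> exists l, (ends g h, l) \in pgroups d s /\ size l = 3.
  elim: s d => //= -[k d'] s IH d; rewrite inE => /predU1P[->|/(IH d')[l [lG l3]]].
    by eexists; split; [exact: mem_head|].
  by exists l; rewrite !inE lG !orbT.
rewrite /steps /unzip1 !map_cat !mem_cat => /or3P[] /pE => [/(_ (pa M).1)|/(_ (pb M).1)|/(_ (pc M).1)] [l [lG l3]];
  by rewrite -l3; apply: valence_group; rewrite !inE !mem_cat lG ?orbT.
Qed.

Lemma defect_marking : defect g = size (hP M) + size (hQ M).
Proof.
have -> : defect g = \sum_(v : vertex g) (valence v - 3).
  rewrite /defect big_sumType /= [X in _ = X + _]big1 // => x _.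
  by rewrite valence_ext.
rewrite (bigID (fun v => is_ext v)) /= big1 ?add0n => [|v xv]; last by rewrite valence_ext.
rewrite (eq_bigl (fun v => v \in iverts M)) => [|v]; last by rewrite mem_iverts.
rewrite -big_uniq ?uniq_iverts //= !big_cons valence_P valence_Q !addKn big_map big_seq big1.
  by rewrite addn0.
by move=> h /valence_step->.
Qed.

Lemma valence_int v : ~~ is_ext v -> 3 <= valence v.
Proof.
rewrite -mem_iverts !inE => /or3P[/eqP->|/eqP->|/mapP[h hs ->]].
- by rewrite valence_P.
- by rewrite valence_Q.
- by rewrite valence_step.
Qed.

Lemma card_ext : hodge_degree g = size (hairs M).
Proof.
have h1 : #|[pred v : vertex g | ~~ is_ext v]| = ni g.
  rewrite -[RHS]card_ord -(card_codom (f := @inr 'I_(nx g) 'I_(ni g))) => [|x y []//].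
  apply: eq_card => -[x|x]; rewrite !inE /=; first by apply/esym/codomP => -[].
  by apply/esym/codomP; exists x.
have h2 : #|[pred v : vertex g | ~~ is_ext v]| = 2 + size (steps M).
  transitivity #|iverts M|; first by apply: eq_card => v; rewrite inE mem_iverts.
  by rewrite (card_uniqP uniq_iverts) /= !size_map.
have := card_vertices; rewrite card_sum !card_ord -h1 h2 /hodge_degree /hairs /steps /unzip1 ?size_cat ?size_map ?size_cat.
lia.
Qed.

Lemma chain_connect (A : {set edge g}) d (s : seq (half g * half g)) : chain d s ->
  {subset map fst (d :: unzip2 s) <= A} ->
  forall v, v \in ends g (opp (last d (unzip2 s))) :: map (ends g) (unzip1 s) ->
  connect (adjacent A) (ends g d) v.
Proof.
elim: s d => [|[h k] s IH] d /=.
  by move=> _ sA v; rewrite inE => /eqP->; apply: adj_half; apply: sA; rewrite inE.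
move=> /and3P[/eqP e1 /eqP e2 c] sA v.
have cd : connect (adjacent A) (ends g d) (ends g k).
  by rewrite e2 e1; apply: adj_half; apply: sA; rewrite inE eqxx.
rewrite !inE orbCA => /predU1P[->|vs]; first by rewrite -e2.
apply: connect_trans cd _; apply: IH => // e es; apply: sA; by rewrite inE es orbT.
Qed.

Lemma chain_split d s x : chain d s -> uniq (map fst (d :: unzip2 s)) -> x \in d :: unzip2 s ->
  connect (adjacent [set~ x.1]) (ends g d) (ends g x) /\
  connect (adjacent [set~ x.1]) (ends g (opp x)) (ends g (opp (last d (unzip2 s)))).
Proof.
elim: s d => [|[h k] s IH] d /=; first by move=> _ _; rewrite inE => /eqP->; split; apply: connect0.
move=> /and3P[/eqP e1 /eqP e2 c] /andP[du us]; rewrite inE => /predU1P[->|xs].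
  split; first exact: connect0.
  rewrite -e1 -e2; apply: (chain_connect c) => [e es|]; last by rewrite inE eqxx.
  by rewrite !inE; apply: contraNneq du => <-.
have [c1 c2] := IH k c us xs; split=> //; apply: connect_trans c1.
rewrite e2 e1; apply: adj_half; rewrite !inE; apply: contraNneq du => ->.
exact: (map_f fst xs).
Qed.

Lemma connected_marking : connected [set: vertex g] [set: edge g].
Proof.
have cP v : connect (adjacent [set: edge g]) (mP M) v.
  have pE p : is_path M p -> forall v, v \in ends g (opp (pend p)) :: map (ends g) (unzip1 p.2) ->
      connect (adjacent [set: edge g]) (mP M) v.
    move=> pP w wp; rewrite -(path_start vM pP); apply: (chain_connect (path_chain vM pP)) wp.
    by move=> ? _; rewrite inE.
  have iE w : ~~ is_ext w -> connect (adjacent [set: edge g]) (mP M) w.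
    rewrite -mem_iverts !inE => /or3P[/eqP->|/eqP->|]; first exact: connect0.
      by apply: (pE (pa M)); [constructor 1|rewrite inE eqxx].
    rewrite /steps /unzip1 !map_cat !mem_cat => /or3P[] ws.
    - by apply: (pE (pa M)); [constructor 1|rewrite inE ws orbT].
    - by apply: (pE (pb M)); [constructor 2|rewrite inE ws orbT].
    - by apply: (pE (pc M)); [constructor 3|rewrite inE ws orbT].
  case: (boolP (is_ext v)) => [xv|/iE//].
  have : 0 < valence v by rewrite valence_ext.
  rewrite /valence => /card_gt0P[x]; rewrite inE => /eqP ex.
  have /mapP[y] := (edge_dart (validC vM)).2 x.1; rewrite mem_cat => /orP[yF|yH] exy.
    have := fdart_ends vM yF; case: (half_eq exy) => xy; rewrite -xy ?oppK ex xv ?andbF //.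
  have /andP[h1 h2] := allP (validH vM) _ yH.
  apply: connect_trans (iE _ h1) _; rewrite -ex.
  case: (half_eq exy) => xy; first by rewrite -xy ex xv in h1.
  by rewrite xy; apply: adj_half; rewrite inE.
apply/andP; split; first by apply/set0Pn; exists (mP M).
apply/forall_inP => u _; apply/forall_inP => w _.
by apply: connect_trans (cP w); rewrite connect_adj_sym.
Qed.

Lemma admissible_marking : 0 < size (hairs M) -> admissible g.
Proof.
move=> h0; apply/and4P; split.
- by move: card_ext; rewrite /hodge_degree => ->.
- exact: connected_marking.
- by apply/forallP => x; rewrite valence_ext.
- by apply/forallP => v; apply: valence_int.
Qed.

End Valid.
End Hairy.

(** * Tree-type edges and absence of cut vertices *)

Section Punctured.
Variables (g : ograph) (W : {set vertex g}) (A : {set edge g}) (v : vertex g).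
Implicit Types (x d h : half g).

Definition plink : rel (vertex g + edge g) := fun c c' =>
  [&& c \in punctured W A v, c' \in punctured W A v & incident c c'].

Lemma plink_sym : connect_sym plink.
Proof.
apply: sym_connect_sym => c c'; rewrite /plink andbCA; congr [&& _, _ & _].
by case: c c' => [u|e] [w|f].
Qed.

Lemma cut_vertexN t : (forall c, c \in punctured W A v -> connect plink c t) -> ~~ cut_vertex W A v.
Proof.
move=> ct; rewrite negbK; apply/forall_inP => c cP; apply/forall_inP => d dP.
by apply: connect_trans (ct c cP) _; rewrite plink_sym; apply: ct.
Qed.

Lemma plink_half x : x.1 \in A -> ends g x \in W -> ends g x != v ->
  connect plink (inr x.1) (inl (ends g x)).
Proof.
move=> xA xW xv; apply: connect1; rewrite /plink /punctured !inE xA xW xv /=.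
by apply/existsP; exists x.2; case: x {xA xW xv}.
Qed.

Definition path_nodes d (s : seq (half g * half g)) : seq (vertex g + edge g) :=
  map (fun x : half g => inr x.1) (d :: unzip2 s) ++ map (fun h => inl (ends g h)) (unzip1 s).

(** The far end of the path is absent from the hypothesis since it may be the removed point v.
    [suffix_connect] is the mirror image, where the start may be v. *)
Lemma prefix_connect d s : chain d s -> {subset map fst (d :: unzip2 s) <= A} ->
  (forall w, w \in ends g d :: map (ends g) (unzip1 s) -> (w \in W) && (w != v)) ->
  forall c, c \in path_nodes d s -> connect plink c (inl (ends g d)).
Proof.
elim: s d => [|[h k] s IH] d /=.
  move=> _ sA sW c; rewrite inE => /eqP->.
  by have /andP[? ?] := sW _ (mem_head _ _); apply: plink_half => //; apply: sA; rewrite inE.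
move=> /and3P[/eqP e1 /eqP e2 ch] sA sW c.
have [/andP[dW dv] /andP[kW kv]] : (ends g d \in W) && (ends g d != v) /\ (ends g k \in W) && (ends g k != v).
  by split; apply: sW; rewrite !inE ?e2 eqxx ?orbT.
have dA : d.1 \in A by apply: sA; rewrite inE eqxx.
have c1 : connect plink (inl (ends g k)) (inl (ends g d)).
  apply: (connect_trans (y := inr d.1)); last exact: plink_half.
  rewrite plink_sym e2 e1; apply: (plink_half (x := opp d)); by rewrite -?e1 -?e2.
have {}IH := IH k ch _ _; rewrite /path_nodes /= !inE mem_cat inE => /or4P[/eqP->|/eqP->|cs|/predU1P[->|cs]].
- exact: plink_half.
- apply: connect_trans c1; apply: plink_half => //; by apply: sA; rewrite !inE eqxx orbT.
- apply: connect_trans (IH _ _ c _) c1.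
  + by move=> e es; apply: sA; rewrite inE es orbT.
  + by move=> w; rewrite e2 => ws; apply: sW; rewrite inE ws orbT.
  + by rewrite /path_nodes /= inE mem_cat cs orbT.
- by rewrite -e2.
- apply: connect_trans (IH _ _ c _) c1.
  + by move=> e es; apply: sA; rewrite inE es orbT.
  + by move=> w; rewrite e2 => ws; apply: sW; rewrite inE ws orbT.
  + by rewrite /path_nodes /= inE mem_cat cs !orbT.
Qed.

Lemma suffix_connect d s : chain d s -> {subset map fst (d :: unzip2 s) <= A} ->
  (forall w, w \in ends g (opp (last d (unzip2 s))) :: map (ends g) (unzip1 s) -> (w \in W) && (w != v)) ->
  forall c, c \in path_nodes d s -> connect plink c (inl (ends g (opp (last d (unzip2 s))))).
Proof.
elim: s d => [|[h k] s IH] d /=.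
  move=> _ sA sW c; rewrite inE => /eqP->.
  by have /andP[? ?] := sW _ (mem_head _ _); apply: (plink_half (x := opp d)) => //; apply: sA; rewrite inE.
move=> /and3P[/eqP e1 /eqP e2 ch] sA sW c.
have /andP[kW kv] : (ends g k \in W) && (ends g k != v).
  by apply: sW; rewrite !inE e2 eqxx orbT.
have dA : d.1 \in A by apply: sA; rewrite inE eqxx.
have kA : k.1 \in A by apply: sA; rewrite !inE eqxx orbT.
have {}IH : forall c, c \in path_nodes k s -> connect plink c (inl (ends g (opp (last k (unzip2 s))))).
  apply: IH => //; first by move=> e es; apply: sA; rewrite inE es orbT.
  by move=> w; rewrite inE => /predU1P[->|ws]; apply: sW; rewrite !inE ?eqxx ?ws ?orbT.
have c1 : connect plink (inl (ends g k)) (inl (ends g (opp (last k (unzip2 s))))).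
  apply: (connect_trans (y := inr k.1)); first by rewrite plink_sym; apply: plink_half.
  by apply: IH; rewrite /path_nodes inE eqxx.
rewrite /path_nodes /= !inE mem_cat inE => /or4P[/eqP->|/eqP->|cs|/predU1P[->|cs]].
- apply: connect_trans c1; rewrite e2 e1; apply: (plink_half (x := opp d)); by rewrite -?e1 -?e2.
- by apply: IH; rewrite /path_nodes inE eqxx.
- by apply: IH; rewrite /path_nodes /= inE mem_cat cs orbT.
- by rewrite -e2.
- by apply: IH; rewrite /path_nodes /= inE mem_cat cs !orbT.
Qed.

End Punctured.

Section Hairy.
Variable g : ograph.
Implicit Types (M : marking (half g)) (x d h : half g) (u v w : vertex g).

Lemma perm_fdarts M : perm_eq (fdarts M)
  (((pa M).1 :: unzip2 (pa M).2) ++ ((pb M).1 :: unzip2 (pb M).2) ++ ((pc M).1 :: unzip2 (pc M).2)).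
Proof.
apply/seq.permP => a; rewrite /fdarts /steps /unzip2 !map_cat /= ?count_cat /= ?count_cat /= ?count_cat.
count_lia.
Qed.

(** When a frame edge is removed, the rest of its path still joins its two ends to P and Q, and
    these are joined along another path. Hence a frame edge is not tree-type. *)
Lemma fdarts_connect M x : valid M -> x \in fdarts M ->
  connect (adjacent [set~ x.1]) (ends g x) (ends g (opp x)).
Proof.
move=> vM xM; set A := [set~ x.1].
have [us _] := edge_dart (validC vM).
have {us} : uniq (map fst (fdarts M)) by move: us; rewrite map_cat cat_uniq => /andP[].
rewrite (perm_uniq (perm_map fst (perm_fdarts M))) !map_cat !cat_uniq has_cat negb_or.
case/and3P => ua /andP[/hasPn nab /hasPn nac] /and3P[ub /hasPn nbc uc].
have key p p' : is_path M p -> is_path M p' -> uniq (map fst (p.1 :: unzip2 p.2)) ->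
    x \in p.1 :: unzip2 p.2 -> x.1 \notin map fst (p'.1 :: unzip2 p'.2) ->
    connect (adjacent A) (ends g x) (ends g (opp x)).
  move=> pP pP' u xp xp'; have [c1 c2] := chain_split (path_chain vM pP) u xp.
  rewrite (path_start vM pP) in c1; rewrite -/(pend p) (path_end vM pP) in c2.
  rewrite connect_adj_sym in c1; rewrite connect_adj_sym in c2.
  apply: connect_trans c1 (connect_trans _ c2).
  rewrite -(path_start vM pP') -(path_end vM pP').
  apply: (chain_connect (path_chain vM pP')) => [e ep|]; last by rewrite inE eqxx.
  by rewrite !inE; apply: contraNneq xp' => <-.
move: xM; rewrite (perm_mem (perm_fdarts M)) !mem_cat => /or3P[] xp.
- apply: (key (pa M) (pb M)) => //; [by constructor 1|by constructor 2|].
  by apply/negP => xb; have /negP[] := nab _ xb; apply: map_f.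
- apply: (key (pb M) (pa M)) => //; [by constructor 2|by constructor 1|].
  by apply: nab; apply: map_f.
- apply: (key (pc M) (pa M)) => //; [by constructor 3|by constructor 1|].
  by apply: nac; apply: map_f.
Qed.

Lemma connect_half (A : {set edge g}) x : connect (adjacent A) (ends g x) (ends g (opp x)) ->
  connect (adjacent A) (ends g (x.1, false)) (ends g (x.1, true)).
Proof. by case: x => e [] //=; rewrite connect_adj_sym. Qed.

Lemma chain_cat d (s1 : seq (half g * half g)) h k s2 : chain d (s1 ++ (h, k) :: s2) ->
  chain d s1 /\ chain k s2.
Proof.
elim: s1 d => [|[h0 k0] s1 IH] d /=; first by case/and3P.
by case/and3P => -> -> /IH[-> ->].
Qed.

Section Valid.
Variable M : marking (half g).
Hypotheses (vM : valid M) (hM : 0 < size (hairs M)).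

Lemma tree_typeE e : tree_type e = (e \in map fst (hairs M)).
Proof.
have [us /(_ e) ms] := edge_dart (validC vM).
apply/idP/idP => [te|/mapP[[e' b] /(allP (validH vM))/andP[_ hx] /= ->]].
  move: ms; rewrite map_cat mem_cat => /orP[/mapP[x xM ex]|//].
  have := connect_half (fdarts_connect vM xM); rewrite -ex => cx.
  by move: te; rewrite /tree_type cx.
move: hx; rewrite /opp /=; case E: (ends g (e', ~~ b)) => [y|//] _.
exact: leaf_tree_type (admissible_marking vM hM) (betti_marking vM) E.
Qed.

Lemma frame_edgesE e : (e \in frame_edges g) = (e \in map fst (fdarts M)).
Proof.
rewrite inE tree_typeE; have [us /(_ e)] := edge_dart (validC vM).
rewrite map_cat cat_uniq in us; case/and3P: us => _ /hasPn nh _.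
rewrite map_cat mem_cat; case eh : (e \in map fst (hairs M)); last by rewrite orbF => ->.
by move=> _; apply/esym/negbTE; apply: nh.
Qed.

Lemma frame_verticesE v : (v \in frame_vertices g) = ~~ is_ext v.
Proof.
apply/imsetP/idP => [[x]|iv].
  rewrite inE frame_edgesE => /mapP[y yM exy] ->; have /andP[h1 h2] := fdart_ends vM yM.
  by case: (half_eq exy) => ->.
case: (group_kind vM iv) => [->|->|[h [d [d' [ok dM d'M -> G]]]]].
- by exists (pa M).1 => //; rewrite inE frame_edgesE map_f // inE eqxx.
- exists (opp (pend (pa M))) => //; rewrite inE frame_edgesE.
  have pM : pend (pa M) \in fdarts M by apply: (@path_fdarts _ _ (pa M)); [constructor 1|apply: mem_last].
  exact: (map_f fst pM).
- exists d'; first by rewrite inE frame_edgesE map_f.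
  by have := group_ends vM G (x := d'); rewrite !inE eqxx !orbT => ->.
Qed.

Lemma hair_unique h h' : hair_ok h -> hair_ok h' -> ends g h = ends g h' -> h = h'.
Proof.
move=> ok ok' eh; have /andP[ih xh] := ok; have /andP[_ xh'] := ok'.
have sz1 (s : seq (half g)) : size s <= 1 -> h \in s -> h' \in s -> h = h'.
  by case: s => [|a [|? ?]] //= _; rewrite !inE => /eqP-> /eqP->.
case: (group_kind vM ih) => [eP|eQ|[k [d [d' [okk dM d'M ek G]]]]].
- by apply: (sz1 (hP M)); rewrite ?(validsP vM) // (mem_hP vM) -?eh eP eqxx.
- have [v1 _] := reverseP 0 0 vM.
  have QE : mQ M = mP (reverse M) by [].
  rewrite QE in eQ; apply: (sz1 (hP (reverse M))); rewrite ?(validsP v1) // (mem_hP v1) -?eh eQ eqxx //.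
- have key y : hair_ok y -> ends g y = ends g h -> y = k.
    move=> oky ey; have := group_halves vM G y; rewrite !inE ey eqxx => /or3P[/eqP E|/eqP//|/eqP E].
      by case/andP: oky => _; rewrite E oppK; case/andP: (fdart_ends vM dM) => /negbTE->.
    by case/andP: oky => _; rewrite E; case/andP: (fdart_ends vM d'M) => _ /negbTE->.
  by rewrite (key h) // (key h').
Qed.

Lemma hair_marking (e : edge g) : tree_type e -> hair e.
Proof.
move=> te; apply/andP; split=> //; move: te; rewrite tree_typeE => /mapP[[e' b] hH /= ->].
have ok := allP (validH vM) _ hH; have /andP[ih xh] := ok.
apply/existsP; exists (~~ b); rewrite negbK (valence_ext vM xh) eqxx frame_verticesE ih /=.
apply/forallP => f; apply/implyP => /andP[tf /existsP[b' /eqP ef]].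
move: tf ef; rewrite tree_typeE => /mapP[[f' c] kH /= ->] ef.
have ok' := allP (validH vM) _ kH; have /andP[ik xk] := ok'.
have bc : b' = c.
  by case: (eqVneq b' c) => // nbc; move: ih xk; rewrite -ef /opp /= (_ : ~~ c = b') ?(negbTE _) //;
   [move=> /negbTE->|move: nbc; case: (b'); case: (c)].
by rewrite bc in ef; case: (hair_unique ok' ok ef) => ->.
Qed.

Lemma path_vertex_frame p w : is_path M p -> w \in map (ends g) (unzip1 p.2) -> w \in iverts M.
Proof.
rewrite !inE /steps /unzip1 !map_cat !mem_cat.
by case=> -> ->; rewrite ?orbT.
Qed.

Lemma path_edges_frame p : is_path M p -> {subset map fst (p.1 :: unzip2 p.2) <= frame_edges g}.
Proof.
move=> pP e /mapP[x xp ->]; rewrite frame_edgesE map_f //; exact: path_fdarts xp.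
Qed.

Lemma punctured_cases v c : c \in punctured (frame_vertices g) (frame_edges g) v ->
  [\/ c = inl (mP M) /\ mP M != v, c = inl (mQ M) /\ mQ M != v |
   exists2 p, is_path M p & c \in path_nodes p.1 p.2].
Proof.
case: c => [u|e]; rewrite inE.
  rewrite frame_verticesE -(mem_iverts vM) !inE => /andP[/or3P[/eqP->|/eqP->|us] nv]; [by constructor 1|by constructor 2|].
  constructor 3; move: us; rewrite /steps /unzip1 !map_cat !mem_cat.
  case/or3P => /mapP[h hs ->]; [exists (pa M); first by constructor 1|exists (pb M); first by constructor 2|exists (pc M); first by constructor 3];
   by rewrite /path_nodes mem_cat; apply/orP; right; apply/mapP; exists h.
rewrite frame_edgesE => /mapP[x]; rewrite (perm_mem (perm_fdarts M)) !mem_cat => xs ->; constructor 3.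
case/or3P: xs => xs; [exists (pa M); first by constructor 1|exists (pb M); first by constructor 2|exists (pc M); first by constructor 3];
   by rewrite /path_nodes mem_cat; apply/orP; left; apply/mapP; exists x.
Qed.

Lemma path_vertices_ok v p : is_path M p -> v \notin map (ends g) (unzip1 p.2) ->
  forall w, w \in map (ends g) (unzip1 p.2) -> (w \in frame_vertices g) && (w != v).
Proof.
move=> pP vp w wp; rewrite frame_verticesE -(mem_iverts vM) (path_vertex_frame pP wp) /=.
by apply: contraNneq vp => <-.
Qed.

Local Notation pl v := (plink (frame_vertices g) (frame_edges g) v).

Lemma suffix_path v p : is_path M p -> v \notin map (ends g) (unzip1 p.2) -> v != mQ M ->
  forall c, c \in path_nodes p.1 p.2 -> connect (pl v) c (inl (mQ M)).
Proof.
move=> pP vp vQ c cp; have := suffix_connect (v := v) (path_chain vM pP) (path_edges_frame pP) _ cp.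
rewrite -/(pend p) (path_end vM pP); apply=> w; rewrite inE => /predU1P[->|]; last exact: path_vertices_ok.
by rewrite eq_sym vQ frame_verticesE (validQ vM).
Qed.

Lemma prefix_path v p : is_path M p -> v \notin map (ends g) (unzip1 p.2) -> v != mP M ->
  forall c, c \in path_nodes p.1 p.2 -> connect (pl v) c (inl (mP M)).
Proof.
move=> pP vp vP c cp; have := prefix_connect (v := v) (path_chain vM pP) (path_edges_frame pP) _ cp.
rewrite (path_start vM pP); apply=> w; rewrite inE => /predU1P[->|]; last exact: path_vertices_ok.
by rewrite eq_sym vP frame_verticesE (validP vM).
Qed.

Lemma steps_notP p : is_path M p -> mP M \notin map (ends g) (unzip1 p.2).
Proof.
move=> pP; have := uniq_iverts vM; rewrite /= inE negb_or => /andP[/andP[_]] + _.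
by apply: contra; rewrite /steps /unzip1 !map_cat !mem_cat; case: pP => -> ->; rewrite ?orbT.
Qed.

Lemma steps_notQ p : is_path M p -> mQ M \notin map (ends g) (unzip1 p.2).
Proof.
move=> pP; have := uniq_iverts vM; rewrite /= => /and3P[_ + _].
by apply: contra; rewrite /steps /unzip1 !map_cat !mem_cat; case: pP => -> ->; rewrite ?orbT.
Qed.

Lemma no_cut_P : ~~ cut_vertex (frame_vertices g) (frame_edges g) (mP M).
Proof.
have PQ : mP M != mQ M by apply/eqP/(neqPQ vM).
apply: (cut_vertexN (t := inl (mQ M))) => c /punctured_cases[[_]|[-> _]|[p pP cp]].
- by rewrite eqxx.
- exact: connect0.
- by apply: suffix_path cp => //; apply: steps_notP.
Qed.

Lemma no_cut_Q : ~~ cut_vertex (frame_vertices g) (frame_edges g) (mQ M).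
Proof.
have QP : mQ M != mP M by apply/eqP => /esym; apply: (neqPQ vM).
apply: (cut_vertexN (t := inl (mP M))) => c /punctured_cases[[-> _]|[_]|[p pP cp]].
- exact: connect0.
- by rewrite eqxx.
- by apply: prefix_path cp => //; apply: steps_notQ.
Qed.

(** The removed vertex splits its path: one piece still leads to P, the other to Q, and P and Q are
    joined along the second path. *)
Lemma no_cut_a h : h \in unzip1 (pa M).2 -> ~~ cut_vertex (frame_vertices g) (frame_edges g) (ends g h).
Proof.
move=> ha; set v := ends g h.
have Pa : is_path M (pa M) by constructor 1.
have Pb : is_path M (pb M) by constructor 2.
have Pc : is_path M (pc M) by constructor 3.
have va : v \in map (ends g) (unzip1 (pa M).2) by apply: map_f.
have vP : v != mP M by apply: contraTneq va => ->; apply: steps_notP.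
have vQ : v != mQ M by apply: contraTneq va => ->; apply: steps_notQ.
have := uniq_iverts vM; rewrite /iverts /steps /unzip1 !map_cat -!/(unzip1 _).
rewrite -[_ :: _]/([:: _; _] ++ _) cat_uniq => /and3P[_ _].
rewrite !cat_uniq has_cat negb_or => /and3P[ua /andP[/hasPn nab /hasPn nac] _].
have vb : v \notin map (ends g) (unzip1 (pb M).2) by apply/negP => /nab /negP[].
have vc : v \notin map (ends g) (unzip1 (pc M).2) by apply/negP => /nac /negP[].
have cPQ : connect (pl v) (inl (mP M)) (inl (mQ M)).
  apply: (connect_trans (y := inr (pb M).1.1)).
    by rewrite plink_sym; apply: prefix_path Pb vb vP _ _; rewrite /path_nodes inE eqxx.
  by apply: suffix_path Pb vb vQ _ _; rewrite /path_nodes inE eqxx.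
apply: (cut_vertexN (t := inl (mQ M))) => c cW.
case: (punctured_cases cW) => [[-> _] //|[-> _]|[p [] -> cp]]; first exact: connect0.
- have /mapP[[h0 k] hk /= hE] := ha.
  have paE : pa M = ((pa M).1, (pa M).2) by case: (pa M).
  have ch := path_chain vM Pa; have en := path_end vM Pa; have ed := path_edges_frame Pa.
  have vf w : w \in map (ends g) (unzip1 (pa M).2) -> w \in frame_vertices g.
    by move=> /(path_vertex_frame Pa); rewrite (mem_iverts vM) frame_verticesE.
  move: ch en ed vf ua cp; rewrite /pend; case/splitPr: hk => s1 s2.
  move=> /chain_cat[ch1 ch2]; rewrite /unzip1 /unzip2 !map_cat last_cat /= => en ed vf.
  rewrite cat_uniq /= negb_or => /and3P[_ /andP[n1 n2] /andP[n3 _]].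
  rewrite -hE -/v in n1 n3.
  rewrite /path_nodes /unzip1 /unzip2 /= !map_cat !inE !mem_cat !inE -hE -/v => cp.
  have {cp} : (c \in path_nodes (pa M).1 s1) || (c \in path_nodes k s2) || (c == inl v).
    rewrite /path_nodes /unzip1 /unzip2 /= !inE !mem_cat.
    move: cp; rewrite -!orbA; repeat case/orP => [->|]; rewrite ?orbT //.
    by move=> ->; rewrite !orbT.
  case/orP => [/orP[cp|cp]|/eqP cv]; last by move: cW; rewrite cv !inE eqxx andbF.
    apply: connect_trans cPQ; rewrite -(path_start vM Pa).
    apply: (prefix_connect ch1) cp => [e es|w].
      by apply: ed; move: es; rewrite /= !inE map_cat mem_cat orbA => ->.
    rewrite inE => /predU1P[->|ws].
      by rewrite (path_start vM Pa) frame_verticesE (validP vM) eq_sym.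
    rewrite vf ?map_cat ?mem_cat ?ws //=; by apply: contraNneq n1 => <-.
  rewrite -en; apply: (suffix_connect ch2) cp => [e es|w].
    by apply: ed; move: es; rewrite /= !inE map_cat mem_cat inE => ->; rewrite !orbT.
  rewrite inE en => /predU1P[->|ws]; first by rewrite frame_verticesE (validQ vM) eq_sym.
  rewrite vf ?map_cat ?mem_cat /= ?inE ?ws ?orbT //=; by apply: contraNneq n3 => <-.
- exact: suffix_path Pb vb vQ _ cp.
- exact: suffix_path Pc vc vQ _ cp.
Qed.


End Valid.

Lemma two_loop_marking M : valid M -> 0 < size (hairs M) -> two_loop_hairy g.
Proof.
move=> vM hM; apply/and4P; split.
- exact: admissible_marking hM.
- by rewrite (betti_marking vM).
- apply/forall_inP => v; rewrite (frame_verticesE vM hM) -(mem_iverts vM) !inE.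
  (* Vertices on the second and third path are handled by bringing that path to the front. *)
  have [v1 _] := swap_abP 0 0 vM; have [v2 _] := swap_bcP 0 0 vM; have [v3 _] := swap_abP 0 0 v2.
  have szE M1 : size (hairs M1) = size (hP M1) + size (hQ M1) + (size (pa M1).2 + size (pb M1).2 + size (pc M1).2).
    by rewrite /hairs /steps /unzip1 !size_cat size_map !size_cat; lia.
  have h1 : 0 < size (hairs (swap_ab M)) by move: hM; rewrite !szE /=; lia.
  have h3 : 0 < size (hairs (swap_ab (swap_bc M))) by move: hM; rewrite !szE /=; lia.
  case/or3P => [/eqP->|/eqP->|/mapP[h hs ->]].
  + exact: no_cut_P.
  + exact: no_cut_Q.
  + move: hs; rewrite /steps /unzip1 !map_cat !mem_cat => /or3P[] hs.
    * exact: no_cut_a vM hM _ hs.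
    * exact: no_cut_a v1 h1 _ hs.
    * exact: no_cut_a v3 h3 _ hs.
- by apply/forallP => e; apply/implyP; apply: hair_marking vM hM _.
Qed.

End Hairy.

(** * Two-loop hairy graphs admit a marking *)

Section Structure.
Variable g : ograph.
Implicit Types (x y d h p : half g) (u v w : vertex g).
Hypothesis tl : two_loop_hairy g.

Let adm : admissible g. Proof. by case/and4P: tl. Qed.
Let b2 : betti1 [set: vertex g] [set: edge g] = 2. Proof. by case/and4P: tl => _ /eqP. Qed.
Let tthair (e : edge g) : tree_type e -> hair e.
Proof. by case/and4P: tl => _ _ _ /forallP/(_ e)/implyP. Qed.

Let val_ext v : is_ext v -> valence v = 1.
Proof. by case: v => // x _; case/and4P: adm => _ _ /forallP/(_ x)/eqP. Qed.
Let val_int v : ~~ is_ext v -> 3 <= valence v.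
Proof. by case: v => // x _; case/and4P: adm => _ _ _ /forallP/(_ x). Qed.

Lemma ext_inj x y : is_ext (ends g x) -> ends g x = ends g y -> x = y.
Proof.
move=> xe exy; have /eqP/cards1P[z zE] := val_ext xe.
have : x \in halves (ends g x) by rewrite inE.
have : y \in halves (ends g x) by rewrite inE exy.
by rewrite zE !inE => /eqP-> /eqP->.
Qed.

Lemma ext_tree x : is_ext (ends g x) -> tree_type x.1.
Proof.
by case: x => e b; case E: (ends g (e, b)) => [z|//] _; apply: leaf_tree_type E.
Qed.

Lemma hair_ends h : tree_type h.1 -> exists2 k : half g, k.1 = h.1 &
  [/\ valence (ends g k) = 1, ends g (opp k) \in frame_vertices g &
   forall x, tree_type x.1 -> ends g x = ends g (opp k) -> x.1 = h.1].
Proof.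
move=> /tthair/andP[_ /existsP[b /and3P[/eqP v1 fv /forallP all]]].
exists (h.1, b) => //; split=> // x tx ex; apply/eqP; apply: (implyP (all x.1)).
by rewrite tx; apply/existsP; exists x.2; rewrite -surjective_pairing ex.
Qed.

(** Otherwise the inner end of the hair would be univalent as well and could lie in the frame only
    through the hair itself, which is tree-type. *)
Lemma ext_opp x : is_ext (ends g x) -> ~~ is_ext (ends g (opp x)).
Proof.
move=> xe; apply/negP => oe; have [k kx [_ /imsetP[y yf ey] _]] := hair_ends (ext_tree xe).
have ke : is_ext (ends g (opp k)) by case: (half_eq kx) => ->; rewrite ?oppK.
have /(_ ke)/(_ ey) := @ext_inj (opp k) y; move=> yE; move: yf; rewrite !inE -yE /= kx.
by rewrite (ext_tree xe).
Qed.

Lemma hair_okN x : is_ext (ends g x) -> hair_ok (opp x).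
Proof. by move=> xe; rewrite /hair_ok oppK xe ext_opp. Qed.

Definition isF x := ~~ is_ext (ends g x) && ~~ is_ext (ends g (opp x)).

Lemma isF_opp x : isF (opp x) = isF x.
Proof. by rewrite /isF oppK andbC. Qed.

Lemma frame_edgeE x : (x.1 \in frame_edges g) = isF x.
Proof.
rewrite inE; apply/idP/idP => [nt|/andP[i1 i2]].
  apply/andP; split; apply: contra nt; [exact: ext_tree|exact: (@ext_tree (opp x))].
apply/negP => /hair_ends[k kx [v1 _ _]].
have : ~~ is_ext (ends g k) by case: (half_eq kx) => ->.
by move=> /val_int; rewrite v1.
Qed.

Lemma hair_ok_unique h h' : hair_ok h -> hair_ok h' -> ends g h = ends g h' -> h = h'.
Proof.
move=> /andP[i1 x1] /andP[i2 x2] eh.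
have [k kh [v1 _ all]] := hair_ends (ext_tree x1 : tree_type h.1).
have ok : opp k = h.
  case: (half_eq kh) => kE; last by rewrite kE oppK.
  by move: (val_int i1); rewrite -kE v1.
have := all h' (ext_tree x2 : tree_type h'.1); rewrite ok => /(_ (esym eh)) e1.
case: (half_eq e1) => // hE; move: i2; rewrite hE x1 //.
Qed.

Definition hs v := [set x | (ends g x == v) && is_ext (ends g (opp x))].

Lemma card_hs v : ~~ is_ext v -> #|hs v| <= 1.
Proof.
move=> iv; apply/card_le1_eqP => x y; rewrite !inE => /andP[/eqP ex xe] /andP[/eqP ey ye].
by apply: hair_ok_unique; rewrite /hair_ok ?ex ?ey ?iv ?xe ?ye.
Qed.

Definition frn v := #|fr v|.

Lemma valence_fr v : valence v = frn v + #|hs v|.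
Proof.
rewrite /valence -[LHS](cardsID (hs v)) addnC; congr (_ + _); apply: eq_card => x; rewrite !inE.
  by case: (ends g x == v); rewrite ?andbF //= andbT.
by case: (ends g x == v) => //=; rewrite andbT.
Qed.

Lemma fr_ge2 v : ~~ is_ext v -> 2 <= frn v.
Proof. by move=> iv; have := val_int iv; have := card_hs iv; rewrite valence_fr; lia. Qed.

Lemma sum_ends (S : {set half g}) : \sum_(v : vertex g) #|[set x in S | ends g x == v]| = #|S|.
Proof.
rewrite -sum1_card (partition_big (ends g) xpredT) //=; apply: eq_bigr => v _.
by rewrite -sum1_card; apply: eq_bigl => x; rewrite inE.
Qed.

(** Euler characteristic: dropping the external vertices with their edges leaves ne - nx edges on ni
    vertices, and Betti number 2 gives ne - nx - ni = 1. So there are two branch vertices with three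
    frame half-edges each, or a single one with four; the latter is excluded later by the absence of
    cut vertices. *)
Lemma sum_fr : \sum_(v : vertex g | ~~ is_ext v) (frn v - 2) = 2.
Proof.
pose XS := [set x : half g | is_ext (ends g x)].
have cX : #|XS| = nx g.
  rewrite -sum_ends big_sumType /= [X in _ + X]big1 ?addn0 => [|v _]; last first.
    by apply: eq_card0 => x; rewrite !inE; case: eqP => [->|]; rewrite ?andbF.
  rewrite (eq_bigr (fun _ => 1)) => [|x _]; first by rewrite sum1_card card_ord.
  rewrite -(val_ext (v := inl x)) //; apply: eq_card => y; rewrite !inE.
  by case: eqP => [->|]; rewrite ?andbF.
have sF : \sum_(v : vertex g | ~~ is_ext v) frn v = 2 * ne g - 2 * nx g.
  pose FS := [set x : half g | isF x].
  have -> : \sum_(v : vertex g | ~~ is_ext v) frn v = #|FS|.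
    rewrite -sum_ends [RHS](bigID (fun v => is_ext v)) /= [X in _ = X + _]big1 ?add0n => [|v ve].
      apply: eq_bigr => v iv; apply: eq_card => x; rewrite !inE /isF.
      by case: eqP => [->|]; rewrite ?andbF //= iv andbT.
    by apply: eq_card0 => x; rewrite !inE /isF; case: eqP => [->|]; rewrite ?ve ?andbF.
  have cH : #|{: half g}| = 2 * ne g by rewrite card_prod card_ord card_bool mulnC.
  have cO : #|@opp g @: XS| = nx g by rewrite card_imset // => x y /(congr1 (@opp g)); rewrite !oppK.
  have d1 : [disjoint XS & @opp g @: XS].
    rewrite disjoint_subset; apply/subsetP => x; rewrite !inE => xe; apply/imsetP => -[y].
    by rewrite inE => ye xE; have := ext_opp ye; rewrite -xE xe.
  have -> : FS = ~: (XS :|: @opp g @: XS).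
    apply/setP => x; rewrite !inE negb_or /isF; congr (_ && _).
    rewrite -[x in RHS]oppK mem_imset ?inE // => y z /(congr1 (@opp g)); by rewrite !oppK.
  have := cardsC (XS :|: @opp g @: XS); rewrite cardsU disjoint_setI0 // cards0 cX cO cH; lia.
have cI : #|[pred v : vertex g | ~~ is_ext v]| = ni g.
  rewrite -[RHS]card_ord -(card_codom (f := @inr 'I_(nx g) 'I_(ni g))) => [|x y []//].
  apply: eq_card => -[x|x]; rewrite !inE /=; first by apply/esym/codomP => -[].
  by apply/esym/codomP; exists x.
have : \sum_(v : vertex g | ~~ is_ext v) frn v
     = \sum_(v : vertex g | ~~ is_ext v) (frn v - 2) + 2 * ni g.
  have <- : \sum_(v : vertex g | ~~ is_ext v) 2 = 2 * ni g.
    by rewrite (sum_nat_const [pred v : vertex g | ~~ is_ext v] 2) cI mulnC.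
  rewrite -big_split /=; apply: eq_bigr => v iv.
  by rewrite subnK // fr_ge2.
move: b2; rewrite sF /betti1 !cardsT card_sum !card_ord; lia.
Qed.

Definition br v := frn v != 2.

Lemma branch_ex : exists P : vertex g, ~~ is_ext P /\ 3 <= frn P.
Proof.
have : \sum_(v : vertex g | ~~ is_ext v) (frn v - 2) != 0 by rewrite sum_fr.
rewrite sum_nat_eq0 negb_forall => /existsP[v]; rewrite negb_imply => /andP[iv n0].
by exists v; split=> //; lia.
Qed.

Lemma branch_two (P Q : vertex g) : ~~ is_ext P -> ~~ is_ext Q -> P != Q -> br P -> br Q ->
  [/\ frn P = 3, frn Q = 3 & forall v, ~~ is_ext v -> br v -> v = P \/ v = Q].
Proof.
move=> iP iQ PQ bP bQ; have := sum_fr; rewrite (bigD1 P) // (bigD1 Q) /=; last by rewrite iQ eq_sym.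
move: bP bQ (fr_ge2 iP) (fr_ge2 iQ); rewrite /br => bP bQ gP gQ s; split; [lia|lia|].
move=> v iv bv; case: (eqVneq v P) => [->|vP]; [by left|]; case: (eqVneq v Q) => [->|vQ]; [by right|].
move: s; rewrite (bigD1 v) /= ?iv ?vP ?vQ //; have := fr_ge2 iv; move: bv; rewrite /br; lia.
Qed.

(** Exchanges the two frame half-edges at a vertex that is no branch. Extended by the identity it is
    an involution of all half-edges, so that [step] is a permutation and its orbits are cycles. *)
Definition turn x := if isF x && ~~ br (ends g x) then odflt x [pick y in fr (ends g x) | y != x] else x.

Lemma fr_self x : isF x -> x \in fr (ends g x).
Proof. by case/andP => _ h; rewrite inE eqxx. Qed.

Lemma turnP x : isF x -> ~~ br (ends g x) -> turn x != x /\ fr (ends g x) =i [:: x; turn x].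
Proof.
move=> Fx nb; rewrite /turn Fx nb /=; move: nb; rewrite negbK => /cards2P[a [b [ab frE]]].
have xf := fr_self Fx; case: pickP => [y /= /andP[yf yx]|none] /=.
  split=> // z; move: xf yf; rewrite frE !inE => /orP[]/eqP E /orP[]/eqP E'; subst x y; rewrite ?eqxx // in yx *.
  by rewrite orbC.
move: xf (none a) (none b); rewrite frE !inE !eqxx !orbT /= => /orP[]/eqP-> ; rewrite ?eqxx //= ?(negbTE ab) //.
by rewrite eq_sym (negbTE ab).
Qed.

Lemma turn_ends x : ends g (turn x) = ends g x.
Proof.
case: (boolP (isF x && ~~ br (ends g x))) => [/andP[Fx nb]|/negbTE n]; last by rewrite /turn n.
have [_ /(_ (turn x))] := turnP Fx nb; rewrite !inE eqxx orbT => /andP[/eqP-> _] //.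
Qed.

Lemma turn_isF x : isF (turn x) = isF x.
Proof.
case: (boolP (isF x && ~~ br (ends g x))) => [/andP[Fx nb]|/negbTE n]; last by rewrite /turn n.
have [_ /(_ (turn x))] := turnP Fx nb; rewrite !inE eqxx orbT => /andP[/eqP e h].
by rewrite Fx /isF h e andbT; case/andP: Fx.
Qed.

Lemma turnK : involutive turn.
Proof.
move=> x; case: (boolP (isF x && ~~ br (ends g x))) => [/andP[Fx nb]|/negbTE n]; last first.
  by rewrite {2}/turn n /turn n.
have [t1 f1] := turnP Fx nb.
have [||t2 f2] := @turnP (turn x); rewrite ?turn_isF ?turn_ends //.
have := f1 (turn (turn x)); rewrite -(turn_ends x) f2 !inE eqxx orbT (negbTE t2) orbF.
by move/esym/eqP.
Qed.

Definition step x := turn (opp x).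

Lemma step_inj : injective step.
Proof. by move=> x y /(inv_inj turnK) /(inv_inj (@oppK g)). Qed.

Lemma step_isF x : isF (step x) = isF x.
Proof. by rewrite /step turn_isF isF_opp. Qed.

Lemma iter_isF n x : isF (iter n step x) = isF x.
Proof. by elim: n => //= n IH; rewrite step_isF. Qed.

Lemma opp_neq x : x != opp x.
Proof. by case: x => e []; apply/eqP => -[]. Qed.

End Structure.

(** * Walks along the frame from a branch vertex *)

Section Walk.
Variable g : ograph.
Implicit Types (x y d h p : half g) (u v w : vertex g).
Hypothesis tl : two_loop_hairy g.
Variable P : vertex g.
Hypotheses (iP : ~~ is_ext P) (bP : 3 <= frn P).

Let brP : br P. Proof. by rewrite /br; apply/eqP => e; move: bP; rewrite e. Qed.

(** The number of steps until the far end is a branch vertex. The search covers one period of [step]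
    and succeeds there, because just before returning to p the walk arrives at P. *)
Definition len p := find (fun j => br (ends g (opp (iter j (@step g) p)))) (iota 0 (fingraph.order (@step g) p)).
Local Notation dd j p := (iter j (@step g) p).

Lemma frP_ends p : p \in fr P -> ends g p = P /\ isF p.
Proof. by rewrite inE => /andP[/eqP e h]; rewrite /isF e iP h. Qed.

Lemma walk_inj n x y : dd n x = dd n y -> x = y.
Proof. by elim: n => //= n IH /(@step_inj g)/IH. Qed.

Lemma turn_opp j p : turn (opp (dd j p)) = dd j.+1 p.
Proof. by []. Qed.

Section One.
Variable p : half g.
Hypothesis pP : p \in fr P.
Let pE : ends g p = P. Proof. by case: (frP_ends pP). Qed.
Let pF : isF p. Proof. by case: (frP_ends pP). Qed.

Lemma walk_isF j : isF (dd j p). Proof. by rewrite iter_isF. Qed.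

Lemma len_lt : len p < fingraph.order (@step g) p.
Proof.
rewrite /len -[X in _ < X](size_iota 0) -has_find; apply/hasP.
have := fingraph.order_gt0 (@step g) p; case E: (fingraph.order _ _) => [//|n] _.
exists n; first by rewrite mem_iota /= add0n.
have : dd n.+1 p = p by rewrite -E; apply: iter_order; apply: (@step_inj g).
rewrite /= /step => /(congr1 (@turn g)); rewrite turnK => ->.
by rewrite turn_ends pE.
Qed.

Lemma len_br : br (ends g (opp (dd (len p) p))).
Proof.
have := len_lt; rewrite /len -[X in _ < X](size_iota 0) -has_find => h.
by have := nth_find 0 h; rewrite nth_iota ?add0n // -{2}(size_iota 0 (fingraph.order _ _)) -has_find.
Qed.

Lemma len_nbr j : j < len p -> ~~ br (ends g (opp (dd j p))).
Proof.
move=> lj; have := before_find 0 lj; rewrite nth_iota ?add0n; first by move->.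
exact: ltn_trans lj len_lt.
Qed.

Lemma walk_nbr j : 0 < j <= len p -> ~~ br (ends g (dd j p)).
Proof. by case: j => // j /= lj; rewrite /step turn_ends len_nbr. Qed.

Lemma walk_inj_j i j : i <= len p -> j <= len p -> dd i p = dd j p -> i = j.
Proof.
move=> li lj e.
have := fingraph.orbit_uniq (@step g) p; rewrite /fingraph.orbit => u.
have n1 k : k <= len p -> nth p (traject (@step g) p (fingraph.order (@step g) p)) k = dd k p.
  by move=> lk; rewrite nth_traject //; apply: leq_ltn_trans lk len_lt.
apply/eqP; rewrite -(nth_uniq p _ _ u) ?size_traject ?n1 ?e //; exact: leq_ltn_trans len_lt.
Qed.

(** If an edge were met again backwards, the two encounters could be moved towards each other one
    step at a time, down to a half-edge equal to its opposite or a turn that goes straight back. *)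
Lemma walk_opp n j : j + n <= len p -> dd j p <> opp (dd (j + n) p).
Proof.
elim/ltn_ind: n j => -[|[|n]] IH j.
- by rewrite addn0 => _ /eqP; rewrite (negbTE (opp_neq _)).
- rewrite addn1 => lj e.
  have [] := @turnP _ (opp (dd j p)); rewrite ?isF_opp ?walk_isF ?len_nbr //.
  by rewrite turn_opp e oppK eqxx.
- rewrite !addnS => lj e; apply: (IH n _ j.+1); rewrite // ?addSn; first exact: ltnW.
  by rewrite /= {1}/step e oppK /= {1}/step turnK.
Qed.

Lemma walk_oppj i j : i <= len p -> j <= len p -> dd i p <> opp (dd j p).
Proof.
move=> li lj; case: (leqP i j) => [/subnKC E|/ltnW/subnKC E].
  by rewrite -E; apply: walk_opp; rewrite E.
move=> /(congr1 (@opp g)); rewrite oppK => /esym; rewrite -E; apply: walk_opp; by rewrite E.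
Qed.

Let FV := frame_vertices g.
Let FE := frame_edges g.
Local Notation pl := (plink FV FE P).

(** If the walk returned to P, its edges and inner vertices would be closed under incidence away
    from P. As P is no cut vertex they would be the whole punctured frame, and P would have at most
    two frame half-edges instead of at least three. This rules out a frame with a single branch
    vertex. *)
Lemma walk_end : ends g (opp (dd (len p) p)) != P.
Proof.
apply/eqP => eP.
pose S (c : vertex g + edge g) := match c with
  | inl u => [exists j : 'I_(len p).+1, (0 < j) && (u == ends g (dd j p))]
  | inr e => [exists j : 'I_(len p).+1, e == (dd j p).1] end.
have SE j : j <= len p -> S (inr (dd j p).1) by move=> lj; apply/existsP; exists (Ordinal (lj : j < (len p).+1)).
have SV j : 0 < j <= len p -> S (inl (ends g (dd j p))).
  by case/andP=> j0 lj; apply/existsP; exists (Ordinal (lj : j < (len p).+1)); rewrite j0 /=.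
have cl c c' : S c -> pl c c' -> S c'.
  rewrite /plink => Sc /and3P[_ c'P]; move: Sc c'P.
  case: c c' => [u|e] [w|f] //= /existsP[[j lj] /=].
    case/andP=> j0 /eqP -> fP /existsP[b /eqP eb].
    have xF : (f, b) \in fr (ends g (dd j p)).
      have : isF (f, b) by rewrite -(frame_edgeE tl); move: fP; rewrite inE.
      by case/andP => _ h; rewrite inE eb eqxx.
    have nbj : ~~ br (ends g (dd j p)) by apply: walk_nbr; rewrite j0 -ltnS.
    have [_ fE] := turnP (walk_isF j) nbj; move: xF; rewrite fE !inE.
    case/orP => /eqP E; first by have := SE j lj; rewrite -E.
    case: j lj j0 E {eb fE nbj} => // j lj _ E.
    by have := SE j (ltnW lj); rewrite /= /step turnK in E; rewrite -[(dd j p).1]/(opp (dd j p)).1 -E.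
  move/eqP=> ->; rewrite inE => /andP[wF wP] /existsP[b /eqP eb].
  have : w = ends g (dd j p) \/ w = ends g (opp (dd j p)).
    by rewrite -eb; case: (half_eq (x := ((dd j p).1, b)) (y := dd j p) erefl) => ->; auto.
  case=> wE; subst w; rewrite wE in wP *.
    apply: SV; apply/andP; split=> //; by case: (posnP j) => [j0|//]; move: wP; rewrite j0 /= pE eqxx.
  have jl : j < len p.
    by rewrite ltn_neqAle -[j <= _]ltnS lj andbT; apply: contraNneq wP => ->; rewrite eP.
  by rewrite -turn_ends turn_opp; apply: SV.
have cut : ~~ cut_vertex FV FE P.
  case/and4P: tl => _ _ /forall_inP h _; apply: h; apply/imsetP; exists p; rewrite ?pE //.
  by rewrite inE (frame_edgeE tl).
have all c : c \in punctured FV FE P -> S c.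
  have pin : inr p.1 \in punctured FV FE P by rewrite inE (frame_edgeE tl).
  move=> cP; move: cut; rewrite negbK => /forall_inP/(_ _ pin)/forall_inP/(_ c cP)/connectP[s].
  rewrite -/pl.
  have : S (inr p.1) by apply: (SE 0).
  elim: s (inr p.1) => [|c1 s IH] c0 /= Sc0; first by move=> _ ->.
  by case/andP => /(cl _ _ Sc0) Sc1; apply: IH.
have : fr P \subset [set p; opp (dd (len p) p)].
  apply/subsetP => x xP; have [xE xF] := frP_ends xP.
  have /existsP[[j lj] /= /eqP] : S (inr x.1) by apply: all; rewrite inE (frame_edgeE tl).
  case/half_eq => E; rewrite !inE.
    case: (posnP j) => [j0|j0]; first by rewrite E j0 eqxx.
    by have := @walk_nbr j; rewrite j0 -ltnS lj -E xE brP => /(_ isT).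
  move: lj; rewrite ltnS leq_eqVlt => /orP[/eqP jl|jl]; first by rewrite E jl eqxx orbT.
  by have := len_nbr jl; rewrite -E xE brP.
move/subset_leq_card; rewrite cards2; have := bP; rewrite /frn.
by case: (p != _) => /=; lia.
Qed.

End One.

(** A common half-edge is traced back to the start of one walk, which would then lie inside the
    other, impossible as P is a branch vertex. A common edge run in opposite directions is moved
    towards the start of the first walk, until a branch vertex occurs inside a walk or the second
    walk ends at P. *)
Lemma walk_diff p q i j : p \in fr P -> q \in fr P -> p != q -> i <= len p -> j <= len q ->
  dd i p <> dd j q /\ dd i p <> opp (dd j q).
Proof.
have A p' q' : p' \in fr P -> q' \in fr P -> p' != q' -> forall i j, i <= j -> i <= len p' -> j <= len q' -> dd i p' <> dd j q'.
  move=> pP qP pq i' j' ij li lj; rewrite -(subnKC ij) iterD => /walk_inj.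
  case E: (j' - i') => [|n] /=; first by move/eqP: pq.
  move=> e; have [pE _] := frP_ends pP.
  have nl : n < len q' by apply: leq_trans lj; rewrite -E leq_subr.
  by have := len_nbr qP nl; rewrite -turn_ends turn_opp /= -e pE brP.
move=> pP qP pq li lj; split.
  case: (leqP i j) => [ij|/ltnW ji]; first exact: A.
  by move/esym; apply: A; rewrite // eq_sym.
elim: i j li lj => [|i IH] j li lj e.
  have [pE _] := frP_ends pP.
  case: (ltngtP j (len q)) lj => // [jl _|jl _].
    by have := len_nbr qP jl; rewrite -e /= pE brP.
  by have := walk_end qP; rewrite -jl -e /= pE eqxx.
case: (ltngtP j (len q)) lj => // [jl _|jl _].
  apply: (IH j.+1) => //; first exact: ltnW.
  have E : opp (dd i p) = dd j.+1 q by rewrite -turn_opp -e -turn_opp turnK.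
  by rewrite -E oppK.
by have := len_br qP; rewrite -jl -e (negbTE (walk_nbr pP _)).
Qed.

End Walk.

Lemma uniq_cat4 (T : eqType) (A B C D : seq T) :
  uniq A -> uniq B -> uniq C -> uniq D ->
  {in B, forall x, x \notin A} -> {in C, forall x, x \notin A} -> {in D, forall x, x \notin A} ->
  {in C, forall x, x \notin B} -> {in D, forall x, x \notin B} -> {in D, forall x, x \notin C} ->
  uniq (A ++ B ++ C ++ D).
Proof.
move=> uA uB uC uD ab ac ad bc bd cd; rewrite !cat_uniq !has_cat !negb_or uA uB uC uD /= andbT.
by apply/and3P; split; [apply/and3P; split|apply/andP; split|]; apply/hasPn.
Qed.

Section Complete.
Variable g : ograph.
Implicit Types (x y d h p : half g) (u v w : vertex g) (M : marking (half g)).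

Lemma perm_mlist M : perm_eq (mlist M)
  (map (fun v => inl v) (iverts M) ++ map (fun x => inr x.1) (fdarts M) ++
   map (fun h => inl (ends g (opp h))) (hairs M) ++ map (fun h => inr h.1) (hairs M)).
Proof.
have hE (s : seq (half g)) a : count a (hair_blocks s) = (count a (map (fun h => inl (ends g (opp h))) s)
   + count a (map (fun h => inr h.1) s))%N.
  by elim: s => //= h s /= ->; rewrite /vx /ed; count_lia.
have sE (s : seq (half g * half g)) a : count a (step_blocks s) = (count a (map (fun h => inl (ends g (opp h))) (unzip1 s))
   + count a (map (fun h => inr h.1) (unzip1 s)) + count a (map (fun v => inl v) (map (ends g) (unzip1 s)))
   + count a (map (fun x => inr x.1) (unzip2 s)))%N.
  by elim: s => //= -[h d] s /= ->; rewrite /vx /ed; count_lia.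
apply/seq.permP => a; rewrite /mlist /hairs /fdarts /iverts /steps /unzip1 /unzip2 /= !map_cat /= !count_cat /= !count_cat.
rewrite !hE !sE /unzip1 /unzip2 /ed.
count_lia.
Qed.

Lemma complete_marking M :
  uniq (iverts M) -> (forall v, (v \in iverts M) = ~~ is_ext v) ->
  uniq (map fst (fdarts M)) -> all (@isF g) (fdarts M) ->
  uniq (hairs M) -> all (@hair_ok g) (hairs M) ->
  (forall x y, is_ext (ends g x) -> ends g x = ends g y -> x = y) ->
  (forall x : half g, isF x -> x.1 \in map fst (fdarts M)) ->
  (forall h, hair_ok h -> h \in hairs M) ->
  (forall x, is_ext (ends g x) -> hair_ok (opp x)) ->
  (forall v, is_ext v -> exists x, ends g x = v) ->
  complete (mlist M).
Proof.
move=> uv mv uf /allP Ff uh /allP Fh einj cf ch xh xv.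
have Fn h x : hair_ok h -> isF x -> h.1 <> x.1.
  by move=> /andP[_ h2] /andP[f1 f2] /half_eq[E|E]; move: h2; rewrite E ?oppK; [rewrite (negbTE f2)|rewrite (negbTE f1)].
have hfst h h' : hair_ok h -> hair_ok h' -> h.1 = h'.1 -> h = h'.
  by move=> /andP[_ h2] /andP[h1 _] /half_eq[//|E]; move: h2; rewrite E oppK (negbTE h1).
apply: completeP.
  rewrite (perm_uniq (perm_mlist M)); apply: uniq_cat4.
  - by rewrite map_inj_uniq ?uv // => a b [].
  - by rewrite (map_comp inr fst) map_inj_uniq // => a b [].
  - rewrite map_inj_in_uniq // => a b /Fh/andP[_ a2] _ [] /(einj _ _ a2) /(congr1 (@opp g)).
    by rewrite !oppK.
  - by rewrite map_inj_in_uniq // => a b aM bM [] /(hfst _ _ (Fh _ aM) (Fh _ bM)).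
  - by move=> _ /mapP[x _ ->]; apply/mapP => -[].
  - move=> _ /mapP[h hM ->]; apply/mapP => -[v]; rewrite mv => iv [E].
    by have /andP[_] := Fh _ hM; rewrite E (negbTE iv).
  - by move=> _ /mapP[x _ ->]; apply/mapP => -[].
  - by move=> _ /mapP[x _ ->]; apply/mapP => -[].
  - move=> _ /mapP[h hM ->]; apply/mapP => -[x xM [E]].
    exact: (Fn _ _ (Fh _ hM) (Ff _ xM) E).
  - by move=> _ /mapP[x _ ->]; apply/mapP => -[].
move=> z; rewrite (perm_mem (perm_mlist M)).
set A := map _ (iverts M); set B := map _ (fdarts M).
set C := map _ (hairs M); set D := map _ (hairs M).
have : z \in A \/ z \in B \/ z \in C \/ z \in D; last first.
  by rewrite !(mem_cat z); case=> [->|[->|[->|->]]]; rewrite ?orbT.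
case: z => [v|e].
  case: (boolP (is_ext v)) => [/[dup] ve /xv[x xE]|iv]; [right; right; left|left].
    apply/mapP; exists (opp x); last by rewrite oppK xE.
    by apply/ch/xh; rewrite xE.
  by apply: map_f; rewrite mv.
case: (boolP (isF (e, true))) => [/cf/mapP[x xM /= ->]|].
  by right; left; apply/mapP; exists x.
rewrite /isF negb_and !negbK => /orP[] ex; right; right; right; apply/mapP.
  by exists (opp (e, true)) => //; apply/ch/xh.
by exists (e, true) => //; have := xh _ ex; rewrite oppK; apply: ch.
Qed.

End Complete.

(** * The marking built from the three walks *)

Section Build.
Variable g : ograph.
Implicit Types (x y d h p : half g) (u v w : vertex g).
Hypothesis tl : two_loop_hairy g.
Variable P : vertex g.
Hypotheses (iP : ~~ is_ext P) (bP : 3 <= frn P).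
Variables p0 p1 p2 : half g.
Hypotheses (frPE : fr P =i [:: p0; p1; p2]) (up : uniq [:: p0; p1; p2]).
Local Notation dd j p := (iter j (@step g) p).

(** The hair at the vertex of d, with junk value d if there is none. Inside a walk there is one,
    since two frame half-edges do not reach valence 3. *)
Definition hairat d := odflt d [pick h in hs (ends g d)].

Lemma hairatP d : ~~ is_ext (ends g d) -> ~~ br (ends g d) -> hair_ok (hairat d) /\ ends g (hairat d) = ends g d.
Proof.
move=> id nb; rewrite /hairat; case: pickP => [h|none] /=.
  by rewrite inE => /andP[/eqP e x]; rewrite /hair_ok e id x.
have : 3 <= valence (ends g d).
  by case/and4P: tl => /and4P[_ _ _ /forallP vi] _ _ _; move: id; case: (ends g d).
rewrite valence_fr (eq_card0 none) addn0; move: nb; rewrite /br negbK => /eqP->; by [].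
Qed.

Definition wstep p j := (hairat (dd j.+1 p), dd j.+1 p).
Definition wpath p := (p, map (wstep p) (iota 0 (len p))).

Lemma unzip2_wpath p : p :: unzip2 (wpath p).2 = map (fun j => dd j p) (iota 0 (len p).+1).
Proof.
rewrite /= -[1]/(1 + 0) iotaDl /unzip2 -!map_comp; congr (_ :: _); exact: eq_map.
Qed.

Lemma pend_wpath p : pend (wpath p) = dd (len p) p.
Proof.
rewrite /pend -[last _ _]/(last p (p :: unzip2 (wpath p).2)) unzip2_wpath.
by rewrite -addn1 iotaD map_cat last_cat.
Qed.

Lemma chain_wpath p : p \in fr P -> chain p (wpath p).2.
Proof.
move=> pP; have key n k : k + n <= len p -> chain (dd k p) (map (wstep p) (iota k n)).
  elim: n k => //= n IH k; rewrite addnS => kn.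
  have nb : ~~ br (ends g (dd k.+1 p)).
    apply: (walk_nbr iP bP pP); rewrite /=; exact: leq_trans (leq_addr n k.+1) kn.
  have iF : ~~ is_ext (ends g (dd k.+1 p)) by case/andP: (walk_isF iP pP k.+1).
  have [_ ->] := hairatP iF nb.
  by rewrite -(turn_ends (opp (dd k p))) !eqxx /=; apply: (IH k.+1); rewrite addSn.
exact: (key (len p) 0).
Qed.

Let Q := ends g (opp (dd (len p0) p0)).
Let p0P : p0 \in fr P. Proof. by rewrite frPE inE eqxx. Qed.
Let p1P : p1 \in fr P. Proof. by rewrite frPE !inE eqxx orbT. Qed.
Let p2P : p2 \in fr P. Proof. by rewrite frPE !inE eqxx !orbT. Qed.
Let brP : br P. Proof. by rewrite /br; apply/eqP => e; move: bP; rewrite e. Qed.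

Lemma walk_int p j : p \in fr P -> ~~ is_ext (ends g (dd j p)) /\ ~~ is_ext (ends g (opp (dd j p))).
Proof. by move=> pP; case/andP: (walk_isF iP pP j). Qed.

Let iQ : ~~ is_ext Q. Proof. by case: (walk_int (len p0) p0P). Qed.
Let PQ : P != Q. Proof. by rewrite eq_sym; apply: (walk_end tl iP bP). Qed.
Let brQ : br Q. Proof. exact: (len_br iP bP). Qed.

Lemma branch_PQ : [/\ frn P = 3, frn Q = 3 & forall v, ~~ is_ext v -> br v -> v = P \/ v = Q].
Proof. exact: (branch_two tl). Qed.

Lemma end_Q p : p \in fr P -> ends g (opp (dd (len p) p)) = Q.
Proof.
move=> pP; have [_ _ /(_ (ends g (opp (dd (len p) p))))[]] := branch_PQ.
- by case: (walk_int (len p) pP).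
- exact: (len_br iP bP).
- by move=> e; have := walk_end tl iP bP pP; rewrite e eqxx.
- by [].
Qed.

(** The walks arrive at Q by distinct half-edges, and Q has only three frame half-edges. *)
Lemma frQ_ends : fr Q = [set opp (dd (len p) p) | p in fr P].
Proof.
apply/esym/eqP; rewrite eqEcard; apply/andP; split.
  apply/subsetP => _ /imsetP[p pP ->]; rewrite inE (end_Q pP) eqxx oppK.
  by case: (walk_int (len p) pP).
have [_ e3 _] := branch_PQ; rewrite -[#|fr Q|]/(frn Q) e3 card_in_imset ?bP //.
move=> p q pP qP /(congr1 (@opp g)); rewrite !oppK => e; apply/eqP; apply/negPn/negP => npq.
by have [] := walk_diff tl iP bP pP qP npq (leqnn _) (leqnn _).
Qed.

Definition onwalk x := exists p j, [/\ p \in fr P, j <= len p & x = dd j p].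

Lemma onwalk_opp x y : onwalk x -> onwalk y -> x <> opp y.
Proof.
move=> [p [i [pP li ->]]] [q [j [qP lj ->]]].
case: (eqVneq p q) => [E|pq]; last by have [] := walk_diff tl iP bP pP qP pq li lj.
by rewrite -E in lj *; apply: (walk_oppj iP bP pP).
Qed.

Definition covered (c : vertex g + edge g) : Prop :=
  match c with
  | inl u => u = Q \/ exists p j, [/\ p \in fr P, 0 < j <= len p & u = ends g (dd j p)]
  | inr e => exists2 x, onwalk x & e = x.1
  end.

(** As in [walk_end], what the walks cover is closed under incidence away from P, hence is
    everything. Closure at Q holds because every frame half-edge there ends a walk. *)
Lemma coverage c : c \in punctured (frame_vertices g) (frame_edges g) P -> covered c.
Proof.
set FV := frame_vertices g; set FE := frame_edges g.
have cl c1 c2 : covered c1 -> plink FV FE P c1 c2 -> covered c2.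
  rewrite /plink => Sc /and3P[_ c'P]; move: Sc c'P.
  case: c1 c2 => [u|e] [w|f] //.
    move=> Su fP /existsP[b /eqP eb].
    have Fx : isF (f, b) by rewrite -(frame_edgeE tl); move: fP; rewrite inE.
    have xF := fr_self Fx; rewrite eb in xF.
    case: Su => [uQ|[p [j [pP /andP[j0 lj] uE]]]].
      move: xF; rewrite uQ frQ_ends => /imsetP[p pP E]; exists (dd (len p) p); last by move: E; case: (dd _ _) => ? ? [].
      by exists p, (len p).
    have nbj : ~~ br (ends g (dd j p)) by apply: (walk_nbr iP bP pP); rewrite j0.
    have [_ fE] := turnP (walk_isF iP pP j) nbj; move: xF; rewrite uE fE !inE.
    case/orP => /eqP E; first by exists (dd j p); [exists p, j|rewrite -E].
    case: j j0 lj E {fE nbj uE} => // j _ lj E; exists (dd j p); first by exists p, j; split=> //; apply: ltnW.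
    by rewrite /= /step turnK in E; rewrite -[(dd j p).1]/(opp (dd j p)).1 -E.
  case=> x [p [j [pP lj ->]]] -> ; rewrite inE => /andP[wF wP] /existsP[b /eqP eb].
  have : w = ends g (dd j p) \/ w = ends g (opp (dd j p)).
    by rewrite -eb; case: (half_eq (x := ((dd j p).1, b)) (y := dd j p) erefl) => ->; auto.
  case=> wE; rewrite wE in wP *.
    right; exists p, j; split=> //; rewrite lj andbT; case: (posnP j) => [j0|//].
    by move: wP; rewrite j0 /= (frP_ends iP pP).1 eqxx.
  move: lj; rewrite leq_eqVlt => /orP[/eqP->|jl]; first by left; apply: end_Q.
  by right; exists p, j.+1; split=> //; rewrite /= [in RHS]/step turn_ends.
have pin : inr p0.1 \in punctured FV FE P by rewrite inE (frame_edgeE tl) (frP_ends iP p0P).2.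
have cut : ~~ cut_vertex FV FE P.
  case/and4P: tl => _ _ /forall_inP h _; apply: h; apply/imsetP; exists p0; rewrite ?(frP_ends iP p0P).1 //.
  by rewrite inE (frame_edgeE tl) (frP_ends iP p0P).2.
move=> cP; move: cut; rewrite negbK => /forall_inP/(_ _ pin)/forall_inP/(_ c cP)/connectP[s].
rewrite -/(plink FV FE P).
have : covered (inr p0.1) by exists p0 => //; exists p0, 0.
elim: s (inr p0.1) => [|c1 s IH] c0 /= Sc0; first by move=> _ ->.
by case/andP => /(cl _ _ Sc0) Sc1; apply: IH.
Qed.

Definition wM := Marking (enum (hs P)) (enum (hs Q)) (wpath p0) (wpath p1) (wpath p2).

Lemma mem_wpath p x : (x \in p :: unzip2 (wpath p).2) <-> exists2 j, j <= len p & x = dd j p.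
Proof.
rewrite unzip2_wpath; split=> [/mapP[j]|[j lj ->]]; first by rewrite mem_iota => lj ->; exists j.
by apply/mapP; exists j; rewrite // mem_iota.
Qed.

Lemma fdarts_wM x : x \in fdarts wM -> onwalk x.
Proof.
rewrite (perm_mem (perm_fdarts wM)) !mem_cat => /or3P[] /mem_wpath[j lj ->].
- by exists p0, j.
- by exists p1, j.
- by exists p2, j.
Qed.

Lemma onwalk_fdarts x : onwalk x -> x \in fdarts wM.
Proof.
case=> p [j [pP lj ->]]; rewrite (perm_mem (perm_fdarts wM)) !mem_cat.
have : dd j p \in p :: unzip2 (wpath p).2 by apply/mem_wpath; exists j.
by move: pP; rewrite frPE !inE => /or3P[]/eqP-> ->; rewrite ?orbT.
Qed.

Lemma uniq_fdarts_wM : uniq (fdarts wM).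
Proof.
have u p : p \in fr P -> uniq (p :: unzip2 (wpath p).2).
  move=> pP; rewrite unzip2_wpath map_inj_in_uniq ?iota_uniq // => i j.
  by rewrite !mem_iota /= !add0n !ltnS => li lj; apply: (walk_inj_j iP bP pP).
have d p q : p \in fr P -> q \in fr P -> p != q ->
    forall x, x \in q :: unzip2 (wpath q).2 -> x \notin p :: unzip2 (wpath p).2.
  move=> pP qP pq x /mem_wpath[j lj ->]; apply/negP => /mem_wpath[i li E].
  by have [n _] := walk_diff tl iP bP pP qP pq li lj; apply: n.
rewrite (perm_uniq (perm_fdarts wM)) -[X in _ ++ _ ++ X]cats0.
have [[n01 n02] n12] : (p0 != p1 /\ p0 != p2) /\ p1 != p2.
  by move: up; rewrite /= !inE negb_or andbT => /andP[/andP[? ?] ?].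
apply: uniq_cat4 => //; [exact: u|exact: u|exact: u|exact: d|exact: d|exact: d].
Qed.

Lemma steps_wM h d : (h, d) \in steps wM ->
  exists p j, [/\ p \in fr P, j < len p, d = dd j.+1 p & h = hairat d].
Proof.
rewrite !mem_cat => /or3P[] /mapP[j]; rewrite mem_iota => lj [-> ->].
- by exists p0, j.
- by exists p1, j.
- by exists p2, j.
Qed.

Lemma mem_steps_wM p j : p \in fr P -> j < len p -> (hairat (dd j.+1 p), dd j.+1 p) \in steps wM.
Proof.
move=> pP lj; have : (hairat (dd j.+1 p), dd j.+1 p) \in (wpath p).2 by apply/mapP; exists j => //; rewrite mem_iota.
by rewrite !mem_cat; move: pP; rewrite frPE !inE => /or3P[]/eqP-> ->; rewrite ?orbT.
Qed.

Lemma wstep_ok p j : p \in fr P -> j < len p -> [/\ isF (dd j.+1 p), ~~ br (ends g (dd j.+1 p)),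
   hair_ok (hairat (dd j.+1 p)) & ends g (hairat (dd j.+1 p)) = ends g (dd j.+1 p)].
Proof.
move=> pP lj; have nb : ~~ br (ends g (dd j.+1 p)) by apply: (walk_nbr iP bP pP).
have iF := walk_isF iP pP j.+1; have /andP[i1 _] := iF.
by have [h1 h2] := hairatP i1 nb.
Qed.

Lemma ends_steps_wM : map (ends g) (unzip1 (steps wM)) = map (ends g) (unzip2 (steps wM)).
Proof.
rewrite /unzip1 /unzip2 -!map_comp; apply/eq_in_map => -[h d] /steps_wM[p [j [pP lj -> ->]]] /=.
by have [_ _ _] := wstep_ok pP lj.
Qed.

Lemma uniq_iverts_wM : uniq (iverts wM).
Proof.
rewrite /iverts ends_steps_wM.
have PE : mP wM = P by exact: (frP_ends iP p0P).1.
have QE : mQ wM = Q by rewrite /mQ pend_wpath.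
have nb v : v \in map (ends g) (unzip2 (steps wM)) -> ~~ br v.
  by case/mapP => _ /mapP[[h d] /steps_wM[p [j [pP lj -> _]]] ->] ->; have [] := wstep_ok pP lj.
rewrite PE QE /= inE negb_or PQ /=; apply/and3P; split.
- by apply/negP => /nb; rewrite brP.
- by apply/negP => /nb; rewrite brQ.
rewrite map_inj_in_uniq; first by have := uniq_fdarts_wM; rewrite cat_uniq => /and3P[].
move=> x y /mapP[[h d] /steps_wM[p [j [pP lj dE _]]] /= ->] /mapP[[h' d'] /steps_wM[q [i [qP li d'E _]]] /= ->] E.
have [Fx nx _ _] := wstep_ok pP lj; have [Fy _ _ _] := wstep_ok qP li.
rewrite -dE in Fx nx; rewrite -d'E in Fy.
have := fr_self Fy; rewrite -E; have [_ ->] := turnP Fx nx; rewrite !inE => /orP[/eqP//|/eqP d't].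
exfalso; apply: (@onwalk_opp d' (dd j p)).
- by rewrite d'E; exists q, i.+1.
- by exists p, j; split=> //; apply: ltnW.
- by rewrite d't dE /= /step turnK.
Qed.

Lemma valid_wM : valid wM.
Proof.
have PE : mP wM = P by exact: (frP_ends iP p0P).1.
have QE : mQ wM = Q by rewrite /mQ pend_wpath.
have okh : all (@hair_ok g) (hairs wM).
  rewrite !all_cat; apply/and3P; split; apply/allP => h.
  - by rewrite mem_enum inE /hair_ok => /andP[/eqP-> ->]; rewrite iP.
  - by rewrite mem_enum inE /hair_ok => /andP[/eqP-> ->]; rewrite iQ.
  - by case/mapP => -[h' d] /steps_wM[p [j [pP lj dE hE]]] -> /=; rewrite hE dE; have [] := wstep_ok pP lj.
have hsz v : ~~ is_ext v -> size (enum (hs v)) <= 1 by move=> iv; rewrite -cardE (card_hs tl).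
have cint v : ~~ is_ext v -> v != P -> v = Q \/ exists p j, [/\ p \in fr P, 0 < j <= len p & v = ends g (dd j p)].
  move=> iv vP; apply: (coverage (c := inl v)); rewrite inE vP andbT.
  have : 0 < #|fr v| by apply: leq_trans (fr_ge2 tl iv).
  case/card_gt0P => x; rewrite inE => /andP[/eqP xv xo]; apply/imsetP; exists x => //.
  by rewrite inE (frame_edgeE tl) /isF xv iv xo.
have mi v : (v \in iverts wM) = ~~ is_ext v.
  apply/idP/idP => [|iv]; rewrite /iverts ends_steps_wM PE QE !inE.
    case/or3P => [/eqP->|/eqP->|/mapP[d /mapP[[h d'] /steps_wM[p [j [pP lj dE hE]]] /= ->] ->]] //.
    by rewrite dE; case: (walk_int j.+1 pP).
  case: (eqVneq v P) => //= vP; case: (cint v iv vP) => [->|[p [[|j] [pP //= lj ->]]]]; first by rewrite eqxx.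
  by apply/orP; right; apply/mapP; exists (dd j.+1 p) => //; apply/mapP; exists (hairat (dd j.+1 p), dd j.+1 p) => //; apply: mem_steps_wM.
split; rewrite ?PE ?QE ?pend_wpath ?iP ?iQ ?hsz ?chain_wpath ?end_Q //.
- apply: complete_marking => //.
  + exact: uniq_iverts_wM.
  + rewrite map_inj_in_uniq ?uniq_fdarts_wM // => x y /fdarts_wM xD /fdarts_wM yD /half_eq[//|E].
    by case: (onwalk_opp xD yD).
  + by apply/allP => x /fdarts_wM[p [j [pP lj ->]]]; apply: (walk_isF iP pP).
  + have uv := uniq_iverts_wM; rewrite /iverts PE QE /= !inE negb_or -andbA in uv.
    case/and4P: uv => _ nP nQ us.
    rewrite /hairs !cat_uniq !enum_uniq (map_uniq us) /= has_cat negb_or !andbT.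
    apply/andP; split; first (apply/andP; split).
    * apply/hasPn => h; rewrite mem_enum inE => /andP[/eqP hQ' _]; rewrite mem_enum inE hQ' eq_sym.
      by rewrite (negbTE PQ).
    * apply/hasPn => h hsM; rewrite mem_enum inE; apply/negP => /andP[/eqP hP' _].
      by case/negP: nP; rewrite -hP'; apply: map_f.
    * apply/hasPn => h hsM; rewrite mem_enum inE; apply/negP => /andP[/eqP hP' _].
      by case/negP: nQ; rewrite -hP'; apply: map_f.
  + exact: (ext_inj tl).
  + move=> x Fx; have : covered (inr x.1).
      by apply: coverage; rewrite inE (frame_edgeE tl).
    by case=> y /onwalk_fdarts yM ->; apply: map_f.
  + move=> h /[dup] ok /andP[ih xh]; rewrite /hairs !mem_cat !mem_enum !inE xh !andbT.
    case: (eqVneq (ends g h) P) => //= hP'; case: (cint _ ih hP') => [->|[p [[|j] [pP //= lj hE]]]].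
      by rewrite eqxx.
    apply/orP; right; apply/mapP; exists (hairat (dd j.+1 p), dd j.+1 p); first exact: mem_steps_wM.
    have [_ _ ok' e'] := wstep_ok pP lj.
    by apply: (hair_ok_unique tl) => //; rewrite hE e'.
  + exact: (hair_okN tl).
  + move=> v xv; have : 0 < valence v.
      case/and4P: tl => /and4P[_ _ /forallP vx _] _ _ _; case: v xv => // y _; by rewrite (eqP (vx y)).
    by case/card_gt0P => x; rewrite inE => /eqP; exists x.
- exact: (frP_ends iP p1P).1.
- exact: (frP_ends iP p2P).1.
- by apply/allP => h; rewrite mem_enum inE => /andP[].
- by apply/allP => h; rewrite mem_enum inE => /andP[].
Qed.

End Build.

Lemma marking_exists g : two_loop_hairy g -> exists M : marking (half g), valid M.
Proof.
move=> tl; have [P [iP bP]] := branch_ex tl.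
have sz : 3 <= size (enum (fr P)) by rewrite -cardE.
have [p pP] : exists p, p \in fr P by apply/card_gt0P; apply: leq_trans bP.
have bE : br P by rewrite /br; apply/eqP => e; move: bP; rewrite e.
have [e3 _ _] : [/\ frn P = 3, frn (ends g (opp (iter (len p) (@step g) p))) = 3 &
    forall v, ~~ is_ext v -> br v -> v = P \/ v = ends g (opp (iter (len p) (@step g) p))].
  apply: (branch_two tl) => //.
  - by case/andP: (walk_isF iP pP (len p)).
  - by rewrite eq_sym; apply: (walk_end tl iP bP).
  - exact: (len_br iP bP).
have : size (enum (fr P)) = 3 by rewrite -cardE.
case E: (enum (fr P)) => [|p0 [|p1 [|p2 [|? ?]]]] // _.
exists (wM P p0 p1 p2); apply: (valid_wM tl iP bP).
  by move=> x; rewrite -E mem_enum.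
by rewrite -E enum_uniq.
Qed.

Local Open Scope ring_scope.

(** * The differential of a marked graph *)

Section Expand.
Variables (m N : nat) (g : ograph) (M : marking (half g)) (h : half g) (v : 'I_(ni g)).
Hypotheses (vM : valid M) (hQE : hQ M = [:: h]) (QE : mQ M = inr v).

(** The block moved to the new vertex: the hair at Q and the final half-edge of the first path. The
    new vertex becomes one more step of that path, and the old vertex remains as Q without a
    hair. *)
Let S := [set h; opp (pend (pa M))].
Let g' := expand v S.
Definition emb (d : half g) : half g' := (lift ord0 d.1, d.2).
(** The new edge is oriented from the old vertex, here Q, to the new one, whereas the path is read
    towards Q. So the path uses its head, which adds one to [nflip]. *)
Definition newd : half g' := (ord0, true).

Definition expand_marking := Marking (map emb (hP M)) [::]
  (emb (pa M).1, rcons (map (fun s => (emb s.1, emb s.2)) (pa M).2) (emb h, newd))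
  (pmap2 emb (pb M)) (pmap2 emb (pc M)).
Local Notation M' := expand_marking.

Lemma emb_opp d : opp (emb d) = emb (opp d). Proof. by []. Qed.

Lemma ends_emb d : ends g' (emb d) = if d \in S then inr ord0 else expand_vertex (ends g d).
Proof. by rewrite ffunE /expand_ends /= liftK; case: d. Qed.

Lemma ends_new : ends g' newd = inr ord0.
Proof. by rewrite ffunE /expand_ends /= unlift_none. Qed.

Lemma ends_newo : ends g' (opp newd) = inr (lift ord0 v).
Proof. by rewrite ffunE /expand_ends /= unlift_none. Qed.

Lemma hS : h \in S. Proof. by rewrite !inE eqxx. Qed.
Lemma tS : opp (pend (pa M)) \in S. Proof. by rewrite !inE eqxx orbT. Qed.

Lemma hM : hair_ok h /\ ends g h = inr v.
Proof.
have [_ okQ _ _ _] := hair_ok_paths vM.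
have := validhQ vM; rewrite hQE /= andbT => /eqP ->.
by move: okQ; rewrite hQE /= andbT.
Qed.

Lemma S_ends d : d \in S -> ends g d = inr v.
Proof.
rewrite !inE => /orP[] /eqP->; first by case: hM.
exact: QE.
Qed.

Lemma notS d : ends g d != inr v -> (d \in S) = false.
Proof. by move=> ne; apply/negP => /S_ends e; rewrite e eqxx in ne. Qed.

Lemma ends_emb_ne d : ends g d != inr v -> ends g' (emb d) = expand_vertex (ends g d).
Proof. by move=> ne; rewrite ends_emb notS. Qed.

Lemma ext_expand (u : vertex g) : is_ext (expand_vertex u) = is_ext u.
Proof. by case: u. Qed.

Lemma pend_notS p : p = pb M \/ p = pc M -> opp (pend p) \notin S.
Proof.
move=> pP; have [frE] := frQ vM; rewrite /= !inE negb_or andbT => /andP[/andP[n1 n2] _].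
have pF : pend p \in fdarts M.
  by apply: (@path_fdarts _ _ p); [case: pP => ->; [constructor 2|constructor 3]|apply: mem_last].
rewrite negb_or; apply/andP; split; last by case: pP => ->; rewrite eq_sym.
apply/eqP => E; have [/andP[_ ho] _] := hM; move: ho; rewrite -E oppK.
by case/andP: (fdart_ends vM pF) => /negbTE->.
Qed.

Lemma steps_ends k : k \in unzip1 (steps M) -> ends g k != inr v.
Proof.
move=> ks; have := uniq_iverts vM; rewrite /iverts /= -QE => /and3P[_ + _].
by apply: contraNneq => <-; apply: map_f.
Qed.

Lemma P_ne : mP M != inr v.
Proof. by rewrite -QE; apply/eqP/(neqPQ vM). Qed.

Lemma step_blocks_emb (s : seq (half g * half g)) : {subset unzip1 s <= unzip1 (steps M)} ->
  all (@hair_ok g) (unzip1 s) ->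
  step_blocks (map (fun s => (emb s.1, emb s.2)) s) = map (@expand_element g) (step_blocks s).
Proof.
elim: s => [//|[k d] s IH] sub /andP[/andP[_ ko] oks].
pose f (s : half g * half g) := (emb s.1, emb s.2).
have -> : step_blocks (map f ((k, d) :: s)) = [:: vx (opp (emb k)), vx (emb k), ed (emb k), ed (emb d) & step_blocks (map f s)] by [].
rewrite IH //; last by move=> x xs; apply: sub; rewrite inE xs orbT.
have kn : ends g k != inr v by apply/steps_ends/sub; rewrite inE eqxx.
have kon : ends g (opp k) != inr v by apply: contraTneq ko => /= ->.
by rewrite /vx emb_opp (ends_emb_ne kn) (ends_emb_ne kon).
Qed.

Lemma hair_blocks_emb : hair_blocks (map emb (hP M)) = map (@expand_element g) (hair_blocks (hP M)).
Proof.
have [/allP ok _ _ _ _] := hair_ok_paths vM.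
elim: (hP M) ok => [//|k s IH] ok.
have -> : hair_blocks (map emb (k :: s)) = [:: vx (opp (emb k)), ed (emb k) & hair_blocks (map emb s)] by [].
rewrite IH => [|x xs]; last by apply: ok; rewrite inE xs orbT.
rewrite /vx emb_opp ends_emb_ne //; have /andP[_ ko] := ok k (mem_head _ _).
by apply: contraTneq ko => ->.
Qed.

Lemma start_emb p : is_path M p -> ends g' (emb p.1) = expand_vertex (mP M).
Proof. by move=> pP; rewrite ends_emb_ne (path_start vM pP) // P_ne. Qed.

Lemma pend_expand : pend (pa M') = newd.
Proof. by rewrite /pend /= /unzip2 map_rcons last_rcons. Qed.

Lemma mQ_expand : mQ M' = inr (lift ord0 v).
Proof. by rewrite /mQ pend_expand ends_newo. Qed.

Let Pa : is_path M (pa M). Proof. by constructor 1. Qed.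
Let Pb : is_path M (pb M). Proof. by constructor 2. Qed.
Let Pc : is_path M (pc M). Proof. by constructor 3. Qed.

Lemma path_sub p : is_path M p -> {subset unzip1 p.2 <= unzip1 (steps M)}.
Proof. by move=> pP x; rewrite /steps /unzip1 !map_cat !mem_cat; case: pP => -> ->; rewrite ?orbT. Qed.

Lemma mlist_expand : mlist M' =
  map (@expand_element g) (base M ++ hair_blocks (hP M) ++ step_blocks (pa M).2) ++
  [:: expand_element (vx (opp h)); inl (inr ord0); expand_element (ed h); inr ord0] ++
  map (@expand_element g) (step_blocks (pb M).2 ++ step_blocks (pc M).2).
Proof.
have [_ _ oa ob oc] := hair_ok_paths vM.
rewrite /mlist /base mQ_expand /= !map_cat hair_blocks_emb -cats1 step_blocks_cat.
rewrite !step_blocks_emb //; try exact: path_sub.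
rewrite {1}/mP (start_emb Pa) /mP QE /= -!catA; do 5 congr (_ :: _); congr (_ ++ _); congr (_ ++ _).
rewrite /step_blocks /= {1 2}/vx emb_opp !ends_emb hS notS //.
by have [/andP[_ ho] _] := hM; apply: contraTneq ho => ->.
Qed.

(** The part of the sign that does not depend on the path to be lengthened; p is the number of hairs
    at P. *)
Definition kap (p : nat) : nat := (m + N + p * (m + N).+1)%N.

(** The new vertex and edge, of odd total weight, move past the base, the hair at P and the external
    vertex of the hair at Q. The two adjacent edges are exchanged, and the step so formed, of weight
    m + N, moves past the first path. The term N is cancelled in [sgn_expand] by the reversed new
    edge. *)
Lemma expand_kequiv : kequiv m N (expand_seq (mlist M) : seq (element g')) (mlist M')
   (kap (size (hP M)) + N + (m + N) * size (pa M).2).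
Proof.
have [okP okQ oa ob oc] := hair_ok_paths vM.
pose ex := map (@expand_element g).
have wE s : wts m N (ex s : seq (element g')) = wts m N s.
  by rewrite /wts /ex -map_comp; congr sumn; apply: eq_map => -[[x|x]|x].
pose B := base M ++ hair_blocks (hP M).
pose n : element g' := inl (inr ord0); pose e0 : element g' := inr ord0.
have [xh xhE] : {xh : element g' | xh = expand_element (vx (opp h))} by exists (expand_element (vx (opp h))).
pose eh : element g' := expand_element (ed h).
pose R := ex (step_blocks (pb M).2 ++ step_blocks (pc M).2).
have xw : weight m N xh = m.
  by have [/andP[_ ho] _] := hM; rewrite xhE /vx; case: (ends g (opp h)) ho.
have [XB XBE] : {XB : seq (element g') | XB = ex B} by exists (ex B).
have [XA XAE] : {XA : seq (element g') | XA = ex (step_blocks (pa M).2)} by exists (ex (step_blocks (pa M).2)).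
have h1 := @kequiv_blocks m N g' [::] [:: n; e0] (XB ++ [:: xh]) ([:: eh] ++ XA ++ R).
have h2 := @kequiv_blocks m N g' (XB ++ [:: xh; n]) [:: e0] [:: eh] (XA ++ R).
have h3 := @kequiv_blocks m N g' XB [:: xh; n; eh; e0] XA R.
rewrite /= -?catA /= in h1 h2 h3.
have := kequiv_trans (kequiv_trans h1 h2) h3.
have -> : expand_seq (mlist M) = [:: n, e0 & XB ++ [:: xh, eh & XA ++ R]] :> seq (element g').
  by rewrite xhE XBE XAE /R /B /ex /expand_seq /mlist hQE !map_cat -!catA.
have -> : mlist M' = XB ++ XA ++ [:: xh, n, eh, e0 & R].
  by rewrite mlist_expand xhE XBE XAE /R /B /ex !map_cat -!catA.
apply: kequiv_parity.
have wB : odd (wts m N B) = odd (N.+1 + size (hP M) * (m + N).+1).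
  rewrite /B wts_cat oddD wts_hairs // [RHS]oddD; congr (_ (+) _).
  move: (validP vM) (validQ vM); rewrite /wts /=; case: (mP M) => // ? _; case: (mQ M) => // ? _ /=.
  by rewrite !oddD /=; case: (odd N).
have wXB : odd (@wts m N g' XB) = odd (N.+1 + size (hP M) * (m + N).+1) by rewrite XBE wE wB.
have wXA : odd (@wts m N g' XA) = odd (size (pa M).2 * (m + N)) by rewrite XAE wE wts_steps.
rewrite /kap !oddD !oddM !wts_cat !oddD wXB wXA /wts /= xw !oddD !oddM /= !oddD.
by case: (odd m); case: (odd N); case: (odd (size _)); case: (odd (size _)).
Qed.

Lemma nflip_expand : nflip M' = (nflip M).+1.
Proof.
have eE (s : seq (half g)) : count snd (map emb s) = count snd s by rewrite count_map.
have e2 (s : seq (half g * half g)) : count snd (unzip2 (map (fun s => (emb s.1, emb s.2)) s)) = count snd (unzip2 s).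
  by rewrite -eE /unzip2 -!map_comp.
have e1 (s : seq (half g * half g)) : count snd (unzip1 (map (fun s => (emb s.1, emb s.2)) s)) = count snd (unzip1 s).
  by rewrite -eE /unzip1 -!map_comp.
rewrite /nflip /fdarts /hairs /steps hQE /= -cats1 /unzip1 /unzip2 !map_cat !count_cat /= !count_cat.
rewrite -!/(unzip1 _) -!/(unzip2 _) !e1 !e2 !eE /=; count_lia.
Qed.

Lemma chain_emb d (s : seq (half g * half g)) : chain d s -> {subset unzip1 s <= unzip1 (steps M)} ->
  chain (emb d) (map (fun s => (emb s.1, emb s.2)) s).
Proof.
elim: s d => [//|[k d'] s IH] d /= /and3P[/eqP e1 /eqP e2 c] sub.
have kn : ends g k != inr v by apply: steps_ends; apply: sub; rewrite inE eqxx.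
rewrite IH // => [|x xs]; last by apply: sub; rewrite inE xs orbT.
by rewrite emb_opp !ends_emb_ne ?e2 -?e1 // !eqxx.
Qed.

Lemma pend_emb p : p = pb M \/ p = pc M -> ends g' (opp (pend (pmap2 emb p))) = inr (lift ord0 v).
Proof.
move=> pP; rewrite pend_map emb_opp ends_emb (negbTE (pend_notS pP)).
by rewrite (path_end vM) ?QE //; case: pP => ->; [constructor 2|constructor 3].
Qed.

Lemma valid_expand : valid M'.
Proof.
have [cM' _] := expand_kequiv (@expand_seq_subproof g (Sub (mlist M) (validC vM))).
have [okP okQ oa ob oc] := hair_ok_paths vM.
have [/andP[hi ho] hv] := hM.
have ok_emb (s : seq (half g)) : all (@hair_ok g) s -> all (fun k => ends g k != inr v) s -> all (@hair_ok g') (map emb s).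
  elim: s => //= k s IH /andP[/andP[k1 k2] ks] /andP[kn /(IH ks)->]; rewrite andbT.
  rewrite /hair_ok emb_opp !ends_emb_ne ?ext_expand ?k1 //.
  by apply: contraTneq k2 => ->.
have okp p : is_path M p -> all (@hair_ok g) (unzip1 p.2) -> all (@hair_ok g') (map emb (unzip1 p.2)).
  by move=> pP /ok_emb; apply; apply/allP => k /(path_sub pP)/steps_ends.
have mPE : mP M' = expand_vertex (mP M) by rewrite {1}/mP (start_emb Pa).
have e1 (s : seq (half g * half g)) : unzip1 (map (fun s => (emb s.1, emb s.2)) s) = map emb (unzip1 s).
  by rewrite /unzip1 -!map_comp.
split; rewrite ?mPE ?mQ_expand ?size_map //.
- rewrite /hairs /steps /= /unzip1 map_cat map_cat map_rcons -!/(unzip1 _) !e1 -cats1 !all_cat /=.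
  rewrite ok_emb ?okP //=; last first.
    by apply/allP => k /(allP (validhP vM))/eqP->; apply: P_ne.
  rewrite !okp // /hair_ok emb_opp !ends_emb hS notS ?ext_expand ?ho //.
  by apply: contraTneq ho => ->.
- by rewrite ext_expand (validP vM).
- exact: start_emb.
- exact: start_emb.
- by apply: pend_emb; left.
- by apply: pend_emb; right.
- rewrite all_map; apply/allP => k /(allP (validhP vM))/eqP e /=.
  by rewrite ends_emb_ne e ?P_ne.
- exact: (validsP vM).
- rewrite /= chain_rcons chain_emb ?(validca vM) //=; last exact: path_sub.
  rewrite ends_new ends_emb hS eqxx andbT; have -> : last (emb (pa M).1) (unzip2 (map (fun s => (emb s.1, emb s.2)) (pa M).2)) = emb (pend (pa M)).
    exact: (pend_map emb (pa M)).
  by rewrite emb_opp ends_emb tS.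
- exact: (chain_emb (validcb vM) (path_sub Pb)).
- exact: (chain_emb (validcc vM) (path_sub Pc)).
Qed.

Lemma sgn_expand : sgn m N M' = (-1) ^+ (kap (size (hP M)) + (m + N) * size (pa M).2) * sgn m N M.
Proof.
have cE : complete (expand_seq (mlist M) : seq (element g')).
  exact: (@expand_seq_subproof g (Sub (mlist M) (validC vM))).
have [cM' kM] := expand_kequiv cE.
have kE := @koszul_expand m N g (val (order g)) (mlist M).
rewrite /sgn nflip_expand.
rewrite -(koszul_cocycle _ (complete_order (order g')) cE cM') [X in X * _ * _]kE kM.
rewrite [RHS]mulrCA -mulrA; congr (_ * _); rewrite -!exprD; apply: sign_eq.
by rewrite mulnS !oddD; do 3!case: (odd (_ * _)); case: (odd m); case: (odd N).
Qed.

Lemma mtype_expand : mtype M' = ((size (pa M).2).+1, size (pb M).2, size (pc M).2, size (hP M), 0%N).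
Proof. by rewrite /mtype /= size_rcons !size_map. Qed.

End Expand.

(** * The boundary of a generator *)

Section Boundary.
Variables (m N : nat).
Local Notation cls := (cls m N).

(** The generator of the given type. By [same_type_cls] the chosen graph is immaterial; the value 0
    for types that do not occur is not met when p and q are at most 1. *)
Definition cl (t : nat * nat * nat * nat * nat) : graph_space m N :=
  match pselect (exists g, exists M : marking (half g), valid M /\ mtype M = t) with
  | left e => let: exist g e' := cid e in let: exist M _ := cid e' in sgn m N M *: cls g
  | right _ => 0
  end.

Lemma clE g (M : marking (half g)) : valid M -> sgn m N M *: cls g = cl (mtype M).
Proof.
move=> vM; rewrite /cl; case: pselect => [e|[]]; last by exists g, M.
case: (cid e) => g' e'; case: (cid e') => M' [vM' tM'].
exact: same_type_cls.
Qed.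

Lemma cls_cl g (M : marking (half g)) : valid M -> cls g = sgn m N M *: cl (mtype M).
Proof. by move=> vM; rewrite -clE // scalerA sgn_sq scale1r. Qed.

Lemma clE_sign g (M : marking (half g)) s e : valid M -> sgn m N M = (-1) ^+ e * s -> s * s = 1 ->
  s *: cls g = (-1) ^+ e *: cl (mtype M).
Proof.
move=> vM sM ss; rewrite (cls_cl vM) sM scalerA; congr (_ *: _).
by rewrite mulrCA ss mulr1.
Qed.

Section AtQ.
Variables (g : ograph) (M : marking (half g)) (h : half g) (v : 'I_(ni g)).
Hypotheses (vM : valid M) (hQE : hQ M = [:: h]) (QE : mQ M = inr v).
Local Notation a := (size (pa M).2).
Local Notation b := (size (pb M).2).
Local Notation c := (size (pc M).2).
Local Notation p := (size (hP M)).

Lemma expand_a : sgn m N M *: cls (expand v [set h; opp (pend (pa M))])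
  = (-1) ^+ (kap m N p + (m + N) * a) *: cl (a.+1, b, c, p, 0%N).
Proof.
rewrite (clE_sign (M := expand_marking M h v) (e := kap m N p + (m + N) * a)) ?sgn_sq //.
- by rewrite mtype_expand.
- exact: (valid_expand m N).
- exact: sgn_expand.
Qed.

(** The second path is brought to the front, lengthened and put back. The signs of the two
    exchanges, for lengths a, b and a, b + 1, differ by (m + N) a, which turns (m + N) b into (m +
    N)(a + b). *)
Lemma expand_b : sgn m N M *: cls (expand v [set h; opp (pend (pb M))])
  = (-1) ^+ (kap m N p + (m + N) * (a + b)) *: cl (a, b.+1, c, p, 0%N).
Proof.
have [v1 s1] := swap_abP m N vM.
have Q1 : mQ (swap_ab M) = inr v by rewrite /mQ /= (validQb vM) QE.
have v2 := valid_expand m N v1 hQE Q1; have s2 := sgn_expand m N v1 hQE Q1.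
have [v3 s3] := swap_abP m N v2.
pose M2 := swap_ab (expand_marking (swap_ab M) h v).
have t3 : mtype M2 = (a, b.+1, c, p, 0%N).
  by rewrite /mtype /= size_rcons !size_map.
rewrite -t3; apply: clE_sign; rewrite ?sgn_sq //.
rewrite s3 s2 s1; move: (sgn m N M) => s; rewrite !mulrA; congr (_ * _); rewrite -!exprD; apply: sign_eq.
rewrite /= size_rcons !size_map !(oddD, oddM) /=.
rewrite (oddD m N); move: (odd a) (odd b) (odd p) (odd N) (odd m) => x y z n o.
by case: x; case: y; case: z; case: n; case: o.
Qed.

Lemma expand_c : sgn m N M *: cls (expand v [set h; opp (pend (pc M))])
  = (-1) ^+ (kap m N p + (m + N) * (a + b + c)) *: cl (a, b, c.+1, p, 0%N).
Proof.
have [v0 s0] := swap_bcP m N vM; have [v1 s1] := swap_abP m N v0.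
have Q1 : mQ (swap_ab (swap_bc M)) = inr v by rewrite /mQ /= (validQc vM) QE.
have v2 := valid_expand m N v1 hQE Q1; have s2 := sgn_expand m N v1 hQE Q1.
have [v3 s3] := swap_abP m N v2; have [v4 s4] := swap_bcP m N v3.
pose M2 := swap_bc (swap_ab (expand_marking (swap_ab (swap_bc M)) h v)).
have t4 : mtype M2 = (a, b, c.+1, p, 0%N).
  by rewrite /mtype /= size_rcons !size_map.
rewrite -t4; apply: clE_sign; rewrite ?sgn_sq //.
rewrite s4 s3 s2 s1 s0; move: (sgn m N M) => s; rewrite !mulrA; congr (_ * _); rewrite -!exprD; apply: sign_eq.
rewrite /= size_rcons !size_map !(oddD, oddM) /=.
rewrite (oddD m N); move: (odd a) (odd b) (odd c) (odd p) (odd N) (odd m) => x y t z n o.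
by case: x; case: y; case: z; case: n; case: o; case: t.
Qed.

Let H := halves (inr v : vertex g).
Let ta := opp (pend (pa M)).
Let tb := opp (pend (pb M)).
Let tc := opp (pend (pc M)).

Lemma halves_Q : H =i [:: ta; tb; tc; h] /\ uniq [:: ta; tb; tc; h].
Proof.
have G : (mQ M, [:: ta; tb; tc] ++ hQ M) \in groups M by rewrite !inE eqxx orbT.
rewrite hQE QE in G; split; last by have := group_uniq vM G.
by move=> x; rewrite (group_halves vM G).
Qed.

Definition split_of (t : half g) : {set {set half g}} := [set [set h; t]; H :\: [set h; t]].

Lemma split_ofP t : t \in [:: ta; tb; tc] -> split_of t \in splittings v.
Proof.
move=> tt; have [HE u] := halves_Q.
have hH : h \in H by rewrite HE !inE eqxx !orbT.
have tH : t \in H by rewrite HE; move: tt; rewrite !inE => /or3P[] ->; rewrite ?orbT.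
have ht : h != t.
  by apply: contraTneq u => ->; move: tt; rewrite /= !inE => /or3P[] /eqP->; rewrite eqxx ?orbT ?andbF.
have c4 : #|H| = 4 by rewrite (card_list HE u).
have c2 : #|[set h; t]| = 2 by rewrite cards2 ht.
have sub : [set h; t] \subset H by rewrite subUset !sub1set hH tH.
have c2' : #|H :\: [set h; t]| = 2 by rewrite cardsD (setIidPr sub) c4 c2.
have nS : [set h; t] != H :\: [set h; t].
  by apply/eqP => /setP/(_ h); rewrite !inE eqxx.
rewrite inE; apply/and3P; split.
- apply/and3P; split.
  + by rewrite /cover bigcup_setU !big_set1 -{1}(setIidPr sub) setID.
  + apply/trivIsetP => A B; rewrite !inE => /orP[]/eqP-> /orP[]/eqP->; rewrite ?eqxx // => _.
    * by rewrite -setI_eq0 setIDA setIC -setIDA setDv setI0.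
    * by rewrite disjoint_sym -setI_eq0 setIDA setIC -setIDA setDv setI0.
  + apply/negP; rewrite in_set2 => /orP[] /eqP /(congr1 (fun A : {set half g} => #|A|)).
      by rewrite cards0 c2.
    by rewrite cards0 c2'.
- by rewrite cards2 nS.
- by apply/forall_inP => A; rewrite !inE => /orP[]/eqP->; rewrite ?c2 ?c2'.
Qed.

(** The four half-edges at Q split into two pairs, and such a splitting is determined by the partner
    of the hair. *)
Lemma splittings_Q : splittings v = [set split_of ta; split_of tb; split_of tc].
Proof.
have [HE u] := halves_Q.
apply/setP => P; apply/idP/idP => [vP|Pin]; last first.
  have /or3P : [|| P == split_of ta, P == split_of tb | P == split_of tc].
    by move: Pin; rewrite !inE -orbA.
  by case=> /eqP->; apply: split_ofP; rewrite !inE eqxx ?orbT.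
have c4 : #|H| = 4 by rewrite (card_list HE u).
have := vP; rewrite inE => /and3P[pP /eqP cP /forall_inP ge2].
have hH : h \in H by rewrite HE !inE eqxx !orbT.
have : h \in cover P by rewrite (cover_partition pP).
case/bigcupP => A PA hA.
have [sAH oth] : A \subset H /\ forall T, T \in P -> T = A \/ T = H :\: A.
  by split=> [|T PT]; [case: (splittingsP vP PA PA)|case: (splittingsP vP PA PT)].
have PE : P = [set A; H :\: A].
  apply/eqP; rewrite eqEcard cP cards2; apply/andP; split; last by case: eqP.
  by apply/subsetP => T /oth[->|->]; rewrite !inE eqxx ?orbT.
have c2 : #|A| = 2.
  have nA : A != H :\: A by apply/eqP => e; have := hA; rewrite {1}e inE hA.
  have PB : H :\: A \in P by rewrite PE !inE eqxx orbT.
  have := ge2 _ PA; have := ge2 _ PB; rewrite cardsD (setIidPr sAH) c4; lia.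
have /cards1P[t AE] : #|A :\ h| == 1%N by move: c2; rewrite (cardsD1 h) hA add1n => -[->].
have tA : A = [set h; t] by rewrite -(setD1K hA) AE.
have : t \in H by apply: (subsetP sAH); rewrite tA !inE eqxx orbT.
have th : t != h by have := set11 t; rewrite -AE !inE => /andP[].
by rewrite HE !inE (negbTE th) orbF PE tA -/(split_of t) => /or3P[] /eqP->; rewrite eqxx ?orbT.
Qed.

Lemma split_of_inj : {in [:: ta; tb; tc] &, injective split_of}.
Proof.
have [HE u] := halves_Q.
move=> t t' tt tt' E; have nh x : x \in [:: ta; tb; tc] -> x != h.
  by move=> xx; apply: contraTneq u => <-; move: xx; rewrite /= !inE => /or3P[] /eqP->; rewrite eqxx ?orbT ?andbF.
have : [set h; t] \in split_of t' by rewrite -E !inE eqxx.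
rewrite !inE => /orP[]/eqP/setP E'.
  by have := E' t; rewrite !inE eqxx orbT (negbTE (nh t tt)) /= => /esym/eqP.
by have := E' h; rewrite !inE eqxx.
Qed.

Lemma boundary_Q : sgn m N M *: \sum_(P in splittings v) cls (expand v (new_block P)) =
  (-1) ^+ kap m N p *: ((-1) ^+ ((m + N) * a) *: cl (a.+1, b, c, p, 0%N)
   + (-1) ^+ ((m + N) * (a + b)) *: cl (a, b.+1, c, p, 0%N)
   + (-1) ^+ ((m + N) * (a + b + c)) *: cl (a, b, c.+1, p, 0%N)).
Proof.
have [HE u] := halves_Q.
have e t : t \in [:: ta; tb; tc] -> cls (expand v (new_block (split_of t))) = cls (expand v [set h; t]).
  by move=> tt; apply: cls_new_block (split_ofP tt) _; rewrite !inE eqxx.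
have ia : ta \in [:: ta; tb; tc] by rewrite !inE eqxx.
have ib : tb \in [:: ta; tb; tc] by rewrite !inE eqxx orbT.
have ic : tc \in [:: ta; tb; tc] by rewrite !inE eqxx !orbT.
have [nab nac nbc] : [/\ ta != tb, ta != tc & tb != tc].
  by move: u; rewrite /= !inE !negb_or => /and3P[/and3P[-> -> _] /andP[-> _] _].
have dab : split_of ta != split_of tb by apply: contra nab => /eqP/split_of_inj->.
have dac : split_of ta != split_of tc by apply: contra nac => /eqP/split_of_inj->.
have dbc : split_of tb != split_of tc by apply: contra nbc => /eqP/split_of_inj->.
rewrite splittings_Q setUC big_setU1 /=; last by rewrite !inE negb_or eq_sym dac eq_sym dbc.
rewrite big_setU1 ?inE //= big_set1 !e // !scalerDr expand_a expand_b expand_c !scalerA -!exprD.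
by rewrite addrC.
Qed.

End AtQ.

Lemma splittings_val3 (g : ograph) (v : 'I_(ni g)) : valence (inr v : vertex g) = 3%N ->
  splittings v = set0.
Proof.
move=> v3; apply/setP => P; rewrite [RHS]inE; apply/negP; rewrite inE => /and3P[pP /eqP cP /forall_inP ge2].
have := card_partition pP; rewrite -/(valence _) v3 => e.
have : (\sum_(A in P) 2 <= \sum_(A in P) #|A|)%N by apply: leq_sum.
by rewrite -e sum_nat_const cP.
Qed.

Lemma boundary_cls (g : ograph) :
  boundary (cls g) = \sum_(v : 'I_(ni g)) \sum_(P in splittings v) cls (expand v (new_block P)).
Proof.
rewrite /Defs.cls boundary_proj; rewrite /chain_boundary liftU scale1r.
exact: proj_graph_boundary.
Qed.

Lemma boundary_marking (g : ograph) (M : marking (half g)) u w : valid M -> mP M = inr u -> mQ M = inr w ->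
  boundary (cls g) = \sum_(P in splittings u) cls (expand u (new_block P))
    + \sum_(P in splittings w) cls (expand w (new_block P)).
Proof.
move=> vM PE QE; have uw : u != w by apply/eqP => E; case: (neqPQ vM); rewrite PE QE E.
rewrite boundary_cls (bigD1 u) //= (bigD1 w) 1?eq_sym //= addrA [X in _ + X]big1 ?addr0 // => x /andP[xu xw].
rewrite splittings_val3 ?big_set0 //.
have : (inr x : vertex g) \in iverts M by rewrite (mem_iverts vM).
rewrite !inE PE QE => /or3P[/eqP[E]|/eqP[E]|/mapP[h hs ->]].
- by rewrite E eqxx in xu.
- by rewrite E eqxx in xw.
- exact: (valence_step vM).
Qed.

Lemma boundary_cl_Q (g : ograph) (M : marking (half g)) a b c : valid M -> mtype M = (a, b, c, 0, 1)%N ->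
  boundary (cl (a, b, c, 0, 1)%N) =
  (-1) ^+ kap m N 0 *: ((-1) ^+ ((m + N) * a) *: cl (a.+1, b, c, 0, 0)%N
   + (-1) ^+ ((m + N) * (a + b)) *: cl (a, b.+1, c, 0, 0)%N
   + (-1) ^+ ((m + N) * (a + b + c)) *: cl (a, b, c.+1, 0, 0)%N).
Proof.
move=> vM tM; rewrite -tM -clE // linearZ /=; case: tM => ea eb ec ep eq.
case EP: (mP M) (validP vM) => [//|u] _; case EQ: (mQ M) (validQ vM) => [//|w] _.
rewrite (boundary_marking vM EP EQ) scalerDr.
rewrite splittings_val3 ?big_set0 ?scaler0 ?add0r; last by rewrite -EP (valence_P vM) ep.
case hE: (hQ M) eq => [|h [|? ?]] // _.
by rewrite (boundary_Q vM hE EQ) ea eb ec ep.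
Qed.

(** The expansions at P are those at Q of the reversed marking. They have the same types and signs
    as the ones at Q, up to the reversal sign. *)
Lemma boundary_cl_PQ (g : ograph) (M : marking (half g)) a b c : valid M -> mtype M = (a, b, c, 1, 1)%N ->
  boundary (cl (a, b, c, 1, 1)%N) =
  (1 + (-1) ^+ (revexp m N a b c 1 1)) *: ((-1) ^+ kap m N 1 *: ((-1) ^+ ((m + N) * a) *: cl (a.+1, b, c, 1, 0)%N
   + (-1) ^+ ((m + N) * (a + b)) *: cl (a, b.+1, c, 1, 0)%N
   + (-1) ^+ ((m + N) * (a + b + c)) *: cl (a, b, c.+1, 1, 0)%N)).
Proof.
move=> vM tM; rewrite -tM -clE // linearZ /=; case: tM => ea eb ec ep eq.
case EP: (mP M) (validP vM) => [//|u] _; case EQ: (mQ M) (validQ vM) => [//|w] _.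
rewrite (boundary_marking vM EP EQ) scalerDr.
case hE: (hQ M) eq => [|h [|? ?]] // _; case kE: (hP M) ep => [|k [|? ?]] // _.
rewrite (boundary_Q vM hE EQ) ea eb ec kE /= addrC scalerDl scale1r; congr (_ + _).
have [v1 s1] := reverseP m N vM.
have Q1 : mQ (reverse M) = inr u by rewrite /mQ pend_rpath oppK.
have := boundary_Q v1 kE Q1; rewrite /= !size_rsteps hE ea eb ec /= => <-.
by rewrite s1 ea eb ec hE kE /= !scalerA mulrA -exprD addnn -signr_odd odd_double mul1r.
Qed.

End Boundary.

Local Close Scope ring_scope.

(** * Existence of marked graphs *)

Section Attach.
Variables (g : ograph) (w : vertex g).

Definition att_vertex : vertex g -> 'I_(nx g).+1 + 'I_(ni g) := sum_map (lift ord0) id.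
Definition att_element : element g -> 'I_(nx g).+1 + 'I_(ni g) + 'I_(ne g).+1 :=
  sum_map att_vertex (lift ord0).

Definition att_ends (x : 'I_(ne g).+1 * bool) : 'I_(nx g).+1 + 'I_(ni g) :=
  match unlift ord0 x.1 with
  | Some e => att_vertex (ends g (e, x.2))
  | None => if x.2 then inl ord0 else att_vertex w
  end.

Lemma att_vertex_inj : injective att_vertex.
Proof. by apply: sum_map_inj => //; apply: lift_inj. Qed.

Lemma att_element_inj : injective att_element.
Proof. by apply: sum_map_inj; [apply: att_vertex_inj|apply: lift_inj]. Qed.

Lemma complete_att s : complete s -> complete [:: inl (inl ord0), inr ord0 & map att_element s].
Proof.
move=> cs; apply: completeP => /=.
  rewrite (map_inj_uniq att_element_inj) (complete_uniq cs) inE /= andbT.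
  by apply/andP; split; apply/mapP => -[[[x|x]|x] _].
move=> [[x|x]|x]; rewrite !inE /=.
- case: (unliftP ord0 x) => [y ->|-> //]; apply/orP; right; apply/mapP; exists (inl (inl y)) => //; exact: mem_complete.
- by apply/mapP; exists (inl (inr x)) => //; exact: mem_complete.
- case: (unliftP ord0 x) => [y ->|->]; last by rewrite eqxx.
  by apply/orP; right; apply/mapP; exists (inr y) => //; exact: mem_complete.
Qed.

Definition attach : ograph :=
  @OGraph (nx g).+1 (ni g) (ne g).+1 (finfun att_ends)
    (Sub _ (complete_att (complete_order (order g)))).

Definition aemb (d : half g) : half attach := (lift ord0 d.1, d.2).
Definition ahair : half attach := (ord0, false).

Lemma ends_aemb d : ends attach (aemb d) = att_vertex (ends g d).
Proof. by rewrite ffunE /att_ends /= liftK; case: d. Qed.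

Lemma ends_ahair : ends attach ahair = att_vertex w.
Proof. by rewrite ffunE /att_ends /= unlift_none. Qed.

Lemma ends_ahair_opp : ends attach (opp ahair) = inl ord0.
Proof. by rewrite ffunE /att_ends /= unlift_none. Qed.

Lemma is_ext_att v : is_ext (att_vertex v) = is_ext v.
Proof. by case: v. Qed.

End Attach.

Section AttachMarking.
Variables (g : ograph) (M : marking (half g)).
Hypotheses (vM : valid M) (hQ0 : hQ M = [::]).
Let g' := attach (mQ M).
Local Notation E := (@aemb g (mQ M)).

Definition attach_marking := Marking (map E (hP M)) [:: ahair (mQ M)]
  (pmap2 E (pa M)) (pmap2 E (pb M)) (pmap2 E (pc M)).

Lemma valid_attach : valid attach_marking.
Proof.
have Fo d : E (opp d) = opp (E d) by [].
have Fe d : ends g' (E d) = att_vertex (ends g d) by apply: ends_aemb.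
have mE := @mlist_map g g' E (@att_vertex g) (lift ord0) (fun _ => erefl) Fo Fe M.
have chE d s : chain d s -> chain (E d) (map (fun s => (E s.1, E s.2)) s).
  elim: s d => //= -[k d'] s IH d /= /and3P[/eqP e1 /eqP e2 /IH->].
  by rewrite -Fo !Fe e1 e2 e1 !eqxx.
have PE : mP attach_marking = att_vertex (mP M) by apply: Fe.
have QE : mQ attach_marking = att_vertex (mQ M) by rewrite -[LHS]/(ends g' (opp (pend (pmap2 E (pa M))))) pend_map -Fo Fe.
case: (vM) => vC vH vP vQ vPb vPc vQb vQc vhP vhQ vsP vsQ vca vcb vcc; split;
  rewrite ?PE ?QE ?is_ext_att //= ?size_map ?pend_map -?Fo ?Fe ?vPb ?vPc ?vQb ?vQc //; try exact: chE.
- apply: perm_trans (complete_att vC); move: mE; rewrite /att_element => <-.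
  have -> : mlist attach_marking = base (mmap E M) ++ hair_blocks (map E (hP M)) ++
      [:: inl (inl ord0); inr ord0] ++ step_blocks (pmap2 E (pa M)).2 ++
      step_blocks (pmap2 E (pb M)).2 ++ step_blocks (pmap2 E (pc M)).2.
    by rewrite /mlist /hair_blocks /= /vx ends_ahair_opp.
  have -> : mlist (mmap E M) = base (mmap E M) ++ hair_blocks (map E (hP M)) ++
      step_blocks (pmap2 E (pa M)).2 ++ step_blocks (pmap2 E (pb M)).2 ++ step_blocks (pmap2 E (pc M)).2.
    by rewrite /mlist /= hQ0.
  have /permPl := perm_catCA [:: inl (inl ord0) : element g'; inr ord0] (base (mmap E M) ++ hair_blocks (map E (hP M)))
    (step_blocks (pmap2 E (pa M)).2 ++ step_blocks (pmap2 E (pb M)).2 ++ step_blocks (pmap2 E (pc M)).2).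
  by rewrite -!catA perm_sym.
- have okE s : all (@hair_ok g) s -> all (@hair_ok g') (map E s).
    by rewrite all_map; apply: sub_all => d /=; rewrite /hair_ok -Fo !Fe !is_ext_att.
  have [okP _ oa ob oc] := hair_ok_paths vM.
  have u1 (s : seq (half g * half g)) : unzip1 (map (fun s => (E s.1, E s.2)) s) = map E (unzip1 s).
    by rewrite /unzip1 -!map_comp.
  rewrite /hairs /steps /= /unzip1 !map_cat -!/(unzip1 _) !u1 !all_cat /= !all_cat !okE //=.
  by rewrite /hair_ok ends_ahair ends_ahair_opp is_ext_att vQ.
- by rewrite all_map; apply: sub_all vhP => d /= /eqP; rewrite Fe => ->.
- by rewrite ends_ahair eqxx.
Qed.

Lemma mtype_attach : mtype attach_marking =
  (size (pa M).2, size (pb M).2, size (pc M).2, size (hP M), 1).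
Proof. by rewrite /mtype /= !size_map. Qed.

End AttachMarking.

Definition theta_seq : seq ('I_0 + 'I_2 + 'I_3) :=
  [:: inl (inr ord0); inl (inr ord_max); inr ord0; inr (lift ord0 ord0); inr ord_max].

Lemma complete_theta : complete theta_seq.
Proof.
apply: completeP => // -[[[]//|[[|[|?]] ?]]|[[|[|[|?]]] ?]] //; rewrite !inE.
all: by do ?[rewrite (_ : (_ == _) = true) ?orbT //; apply/eqP; do ?congr (_ _); apply: val_inj].
Qed.

Definition theta : ograph :=
  @OGraph 0 2 3 [ffun x => inr (if x.2 then ord_max else ord0)] (Sub _ complete_theta).

Definition theta_marking : marking (half theta) :=
  Marking [::] [::] ((ord0, false), [::]) ((lift ord0 ord0, false), [::]) ((ord_max, false), [::]).

Lemma valid_theta : valid theta_marking.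
Proof.
have eE d : ends theta d = inr (if d.2 then ord_max else ord0) by rewrite ffunE.
split=> //; rewrite /mP /mQ /pend /opp /= ?eE //.
by rewrite /mlist /base /mP /mQ /pend /opp /= !eE; exact: complete_theta.
Qed.

Definition realizable t := exists g, exists M : marking (half g), valid M /\ mtype M = t.

Lemma realizable_ab a b c p q : realizable (a, b, c, p, q) -> realizable (b, a, c, p, q).
Proof.
case=> g [M [vM [<- <- <- <- <-]]]; exists g, (swap_ab M); split=> //.
by case: (swap_abP 0 0 vM).
Qed.

Lemma realizable_bc a b c p q : realizable (a, b, c, p, q) -> realizable (a, c, b, p, q).
Proof.
case=> g [M [vM [<- <- <- <- <-]]]; exists g, (swap_bc M); split=> //.
by case: (swap_bcP 0 0 vM).
Qed.

Lemma realizable_rev a b c p q : realizable (a, b, c, p, q) -> realizable (a, b, c, q, p).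
Proof.
case=> g [M [vM [<- <- <- <- <-]]]; exists g, (reverse M); split.
  by case: (reverseP 0 0 vM).
by rewrite /mtype /= !size_rsteps.
Qed.

Lemma realizable_attach a b c p : realizable (a, b, c, p, 0) -> realizable (a, b, c, p, 1).
Proof.
case=> g [M [vM [<- <- <- <- /size0nil e]]]; exists (attach (mQ M)), (attach_marking M).
by split; [apply: valid_attach|rewrite mtype_attach].
Qed.

Lemma realizable_expand a b c p : realizable (a, b, c, p, 1) -> realizable (a.+1, b, c, p, 0).
Proof.
case=> g [M [vM [<- <- <- <- e]]].
case hE: (hQ M) e => [|h [|? ?]] // _; case QE: (mQ M) (validQ vM) => [//|v] _.
exists (expand v [set h; opp (pend (pa M))]), (expand_marking M h v).
by split; [apply: (valid_expand 0 0 vM hE QE)|rewrite mtype_expand].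
Qed.

(** Attaching a hair at Q and expanding there lengthens the first path. With path exchanges this
    yields all types without hairs at P and Q from the bare theta graph; hairs at Q and P are
    attached last. *)
Lemma realizable_all a b c p q : p <= 1 -> q <= 1 -> realizable (a, b, c, p, q).
Proof.
have stepa a' b' c' : realizable (a', b', c', 0, 0) -> realizable (a'.+1, b', c', 0, 0).
  by move=> /realizable_attach/realizable_expand.
have r0 : realizable (a, b, c, 0, 0).
  elim: a => [|a IH]; last exact: stepa.
  elim: b => [|b IH]; last exact/realizable_ab/stepa/realizable_ab.
  elim: c => [|c IH]; last exact/realizable_bc/realizable_ab/stepa/realizable_ab/realizable_bc.
  by exists theta, theta_marking; split; first exact: valid_theta.
have r1 := realizable_attach r0; have r2 := realizable_rev r1; have r3 := realizable_attach r2.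
by case: p q => [|[|?]] [|[|?]].
Qed.

Local Open Scope ring_scope.

(** * The operator lengthening one path *)

Definition coefs := nat -> nat -> nat -> rat.

Section Insertion.
Variable e : nat.
Implicit Types z w : coefs.

(** The operator R of the overview, with e = m + N: each term collects what arrives at (a, b, c) by
    lengthening one path. *)
Definition insert z : coefs := fun a b c =>
  (if a is a'.+1 then (-1) ^+ (e * a') * z a' b c else 0) +
  (if b is b'.+1 then (-1) ^+ (e * (a + b')) * z a b' c else 0) +
  (if c is c'.+1 then (-1) ^+ (e * (a + b + c')) * z a b c' else 0).

(** In the equation at (a + 1, b, c) the other two terms have smaller b + c, so they vanish by
    induction and leave z(a, b, c) up to sign. *)
Lemma insert_inj z : (forall a b c, insert z a b c = 0) -> forall a b c, z a b c = 0.
Proof.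
move=> z0 a b c; have [n] := ubnP (b + c); elim: n => // n IH in a b c *; rewrite ltnS => le.
have := z0 a.+1 b c; rewrite /insert.
have -> : (if b is b'.+1 then (-1) ^+ (e * (a.+1 + b')) * z a.+1 b' c else 0) = 0.
  by case: b le => [//|b] le; rewrite IH ?mulr0 //; move: le; rewrite addSn.
have -> : (if c is c'.+1 then (-1) ^+ (e * (a.+1 + b + c')) * z a.+1 b c' else 0) = 0.
  by case: c le => [//|c] le; rewrite IH ?mulr0 //; move: le; rewrite addnS.
by rewrite !addr0 => /eqP; rewrite mulf_eq0 signr_eq0 => /eqP.
Qed.

Definition swap1 (s : nat) z : coefs := fun a b c => (-1) ^+ (s + e * (a * b)) * z b a c.
Definition swap2 (s : nat) z : coefs := fun a b c => (-1) ^+ (s + e * (b * c)) * z a c b.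

Definition equiv s z := (forall a b c, z b a c = (-1) ^+ (s + e * (a * b)) * z a b c) /\
  (forall a b c, z a c b = (-1) ^+ (s + e * (b * c)) * z a b c).

Lemma equiv_insert s z : equiv s z -> equiv s (insert z).
Proof.
have step (x : rat) u v u' v' : odd (u + v) = odd (u' + v') ->
    (-1) ^+ u * ((-1) ^+ v * x) = (-1) ^+ u' * ((-1) ^+ v' * x).
  by move=> h; rewrite !mulrA -!exprD (sign_eq h).
move=> [z1 z2]; split=> a b c; rewrite /insert !mulrDr.
  rewrite [X in X + _ = _]addrC; congr (_ + _ + _).
  - by case: a => [|a]; rewrite ?mulr0 // z1; apply: step; lia.
  - by case: b => [|b]; rewrite ?mulr0 // z1; apply: step; lia.
  - by case: c => [|c]; rewrite ?mulr0 // z1; apply: step; lia.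
rewrite -!addrA; congr (_ + _); last rewrite addrC; last congr (_ + _).
- by case: a => [|a]; rewrite ?mulr0 // z2; apply: step; lia.
- by case: b => [|b]; rewrite ?mulr0 // z2; apply: step; lia.
- by case: c => [|c]; rewrite ?mulr0 // z2; apply: step; lia.
Qed.

(** Mean over the six permutations of the paths, written as words in the two signed
    transpositions. *)
Definition average s z : coefs := fun a b c =>
  (z a b c + swap1 s z a b c + swap2 s z a b c + swap1 s (swap2 s z) a b c
   + swap2 s (swap1 s z) a b c + swap1 s (swap2 s (swap1 s z)) a b c) / 6%:R.

Lemma sign_sqr n : (-1) ^+ n * (-1) ^+ n = 1 :> rat.
Proof. by rewrite -exprD addnn -signr_odd odd_double. Qed.

Lemma swap1E s z a b c : z b a c = (-1) ^+ (s + e * (a * b)) * swap1 s z a b c.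
Proof. by rewrite /swap1 mulrA sign_sqr mul1r. Qed.

Lemma swap2E s z a b c : z a c b = (-1) ^+ (s + e * (b * c)) * swap2 s z a b c.
Proof. by rewrite /swap2 mulrA sign_sqr mul1r. Qed.

Lemma swap1S s z a b c : swap1 s z b a c = (-1) ^+ (s + e * (a * b)) * z a b c.
Proof. by rewrite /swap1 [(b * a)%N]mulnC. Qed.

Lemma swap2S s z a b c : swap2 s z a c b = (-1) ^+ (s + e * (b * c)) * z a b c.
Proof. by rewrite /swap2 [(c * b)%N]mulnC. Qed.

(** Either transposition permutes the six words of [average], once the longest one is written in the
    form that begins with it. *)
Lemma swap_braid s z a b c :
  swap1 s (swap2 s (swap1 s z)) a b c = swap2 s (swap1 s (swap2 s z)) a b c.
Proof.
rewrite /swap1 /swap2 !mulrA -!exprD; congr (_ ^+ _ * _); lia.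
Qed.

Lemma equiv_average s z : equiv s (average s z).
Proof.
split=> a b c; rewrite /average [RHS]mulrA; congr (_ / _); rewrite !mulrDr.
  rewrite (swap1E s z a b c) (swap1S s z a b c) (swap1E s (swap2 s z) a b c) (swap1S s (swap2 s z) a b c)
    (swap1E s (swap2 s (swap1 s z)) a b c) (swap1S s (swap2 s (swap1 s z)) a b c).
  set sg := (-1) ^+ _.
  move: (sg * z a b c) (sg * swap1 s z a b c) (sg * swap2 s z a b c)
    (sg * swap1 s (swap2 s z) a b c) (sg * swap2 s (swap1 s z) a b c)
    (sg * swap1 s (swap2 s (swap1 s z)) a b c) => u1 u2 u3 u4 u5 u6; ring.
rewrite !swap_braid (swap2E s z a b c) (swap2S s z a b c) (swap2E s (swap1 s z) a b c) (swap2S s (swap1 s z) a b c)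
  (swap2E s (swap1 s (swap2 s z)) a b c) (swap2S s (swap1 s (swap2 s z)) a b c).
set sg := (-1) ^+ _.
move: (sg * z a b c) (sg * swap1 s z a b c) (sg * swap2 s z a b c)
  (sg * swap1 s (swap2 s z) a b c) (sg * swap2 s (swap1 s z) a b c)
  (sg * swap2 s (swap1 s (swap2 s z)) a b c) => u1 u2 u3 u4 u5 u6; ring.
Qed.

Lemma parity_ex a : exists x, a = x.*2 \/ a = x.*2.+1.
Proof. by exists a./2; rewrite -{1 3}[a]odd_double_half; case: (odd a); [right|left]. Qed.

(** Unsigned variant of [insert_inj], used for the values on triples of constant parity after
    halving the arguments. *)
Lemma shift_inj z : (forall x y t, (if x is x'.+1 then z x' y t else 0) + (if y is y'.+1 then z x y' t else 0)
   + (if t is t'.+1 then z x y t' else 0) = 0) -> forall x y t, z x y t = 0.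
Proof.
move=> z0 a b c; have [n] := ubnP (b + c); elim: n => // n IH in a b c *; rewrite ltnS => le.
have := z0 a.+1 b c.
have -> : (if b is b'.+1 then z a.+1 b' c else 0) = 0.
  by case: b le => [//|b] le; rewrite IH //; move: le; rewrite addSn.
have -> : (if c is c'.+1 then z a.+1 b c' else 0) = 0.
  by case: c le => [//|c] le; rewrite IH //; move: le; rewrite addnS.
by rewrite !addr0.
Qed.

Hypothesis eo : odd e.

Lemma sign_e n : (-1) ^+ (e * n) = (-1) ^+ odd n :> rat.
Proof. by rewrite -signr_odd oddM eo. Qed.

(** On an all even triple the value is read off from the lengthening of the first path, whose sign
    is +1 as a is even. *)
Definition lift_even z : coefs := fun a b c =>
  if [|| odd a, odd b | odd c] then 0 else z a.+1 b c.

(** For odd a lengthening the first path has the sign -1, which the minus compensates. *)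
Definition lift_odd z : coefs := fun a b c =>
  if [&& odd a, odd b & odd c] then - z a.+1 b c else 0.

Ltac simp_parity :=
  rewrite ?doubleS /= ?sign_e ?(oddD, oddS, odd_double) /= ?orbT ?andbF
    ?(mulr0, addr0, add0r, mul1r, mulN1r, opprK, oppr0).

(** F is z on the all odd triples. The equations at the three triples that arise from (2x, 2y, 2t)
    by raising two entries involve F and the values of z at the three lengthenings of (2x, 2y, 2t).
    A signed sum eliminates the latter and leaves the unsigned shift operator applied to F, so F =
    0. Then the three lengthenings carry equal values, which is what z = R w requires. *)
Lemma insert_even z :
  (forall a b c, ~~ odd (a + b + c) -> z a b c = 0) ->
  (forall a b c, (odd a + odd b + odd c = 2)%N -> insert z a b c = 0) ->
  forall a b c, z a b c = insert (lift_even z) a b c.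
Proof.
move=> zs zi.
pose F x y t := z x.*2.+1 y.*2.+1 t.*2.+1.
have E3 x y t : z x.*2 y.*2.+1 t.*2 - z x.*2.+1 y.*2 t.*2 - (if t is t'.+1 then F x y t' else 0) = 0.
  have := zi x.*2.+1 y.*2.+1 t.*2; case: t => [|t]; rewrite /insert /F ?doubleS /= !sign_e !(oddD, oddS, odd_double) /= => /(_ erefl); lra.
have E2 x y t : z x.*2 y.*2 t.*2.+1 + (if y is y'.+1 then F x y' t else 0) - z x.*2.+1 y.*2 t.*2 = 0.
  have := zi x.*2.+1 y.*2 t.*2.+1; case: y => [|y]; rewrite /insert /F ?doubleS /= !sign_e !(oddD, oddS, odd_double) /= => /(_ erefl); lra.
have E1 x y t : - (if x is x'.+1 then F x' y t else 0) + z x.*2 y.*2 t.*2.+1 - z x.*2 y.*2.+1 t.*2 = 0.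
  have := zi x.*2 y.*2.+1 t.*2.+1; case: x => [|x]; rewrite /insert /F ?doubleS /= !sign_e !(oddD, oddS, odd_double) /= => /(_ erefl); lra.
have F0 : forall x y t, F x y t = 0.
  apply: shift_inj => x y t; move: (E1 x y t) (E2 x y t) (E3 x y t).
  move: (if x is x'.+1 then F x' y t else 0) (if y is y'.+1 then F x y' t else 0)
    (if t is t'.+1 then F x y t' else 0) => u v w; lra.
have E3' x y t : z x.*2 y.*2.+1 t.*2 = z x.*2.+1 y.*2 t.*2.
  by have := E3 x y t; case: t => [|t]; rewrite ?F0; lra.
have E2' x y t : z x.*2 y.*2 t.*2.+1 = z x.*2.+1 y.*2 t.*2.
  by have := E2 x y t; case: y => [|y]; rewrite ?F0; lra.
move=> a b c; have [x xE] := parity_ex a; have [y yE] := parity_ex b; have [t tE] := parity_ex c.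
rewrite /insert /lift_even; case: xE => ->; case: yE => ->; case: tE => ->.
- rewrite zs ?oddD ?odd_double //.
  by case: x => [|x]; case: y => [|y]; case: t => [|t]; simp_parity.
- by rewrite E2'; case: x => [|x]; case: y => [|y]; simp_parity.
- by rewrite E3'; case: x => [|x]; case: t => [|t]; simp_parity.
- by rewrite zs; [case: x => [|x] |]; simp_parity.
- by case: y => [|y]; case: t => [|t]; simp_parity.
- by rewrite zs; [case: y => [|y] |]; simp_parity.
- by rewrite zs; [case: t => [|t] |]; simp_parity.
- by rewrite -[z _ _ _]/(F x y t) F0; simp_parity.
Qed.

(** G is z on the all even triples; U, V, W are z on the triples whose only even entry is the third,
    second, first. The three equations, shifted by one in x, y, t respectively, add up to the
    unsigned shift operator applied to G, so G = 0. What remains expresses U and V by W and makes U,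
    V, W vanish where the even entry is 0 and cannot be shortened. *)
Lemma insert_odd z :
  (forall a b c, odd (a + b + c) -> z a b c = 0) ->
  (forall a b c, (odd a + odd b + odd c = 1)%N -> insert z a b c = 0) ->
  forall a b c, z a b c = insert (lift_odd z) a b c.
Proof.
move=> zs zi.
pose G x y t := z x.*2 y.*2 t.*2.
pose U x y t := z x.*2.+1 y.*2.+1 t.*2.
pose V x y t := z x.*2.+1 y.*2 t.*2.+1.
pose W x y t := z x.*2 y.*2.+1 t.*2.+1.
have D1 x y t : G x y t + (if y is y'.+1 then U x y' t else 0) + (if t is t'.+1 then V x y t' else 0) = 0.
  have := zi x.*2.+1 y.*2 t.*2; case: y => [|y]; case: t => [|t]; rewrite /insert /G /U /V ?doubleS /= !sign_e !(oddD, oddS, odd_double) /= => /(_ erefl); lra.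
have D2 x y t : - (if x is x'.+1 then U x' y t else 0) + G x y t + (if t is t'.+1 then W x y t' else 0) = 0.
  have := zi x.*2 y.*2.+1 t.*2; case: x => [|x]; case: t => [|t]; rewrite /insert /G /U /W ?doubleS /= !sign_e !(oddD, oddS, odd_double) /= => /(_ erefl); lra.
have D3 x y t : - (if x is x'.+1 then V x' y t else 0) - (if y is y'.+1 then W x y' t else 0) + G x y t = 0.
  have := zi x.*2 y.*2 t.*2.+1; case: x => [|x]; case: y => [|y]; rewrite /insert /G /V /W ?doubleS /= !sign_e !(oddD, oddS, odd_double) /= => /(_ erefl); lra.
have G0 : forall x y t, G x y t = 0.
  apply: shift_inj => x y t.
  move: (fun x' => D1 x' y t) (fun y' => D2 x y' t) (fun t' => D3 x y t').
  case: x => [|x]; case: y => [|y]; case: t => [|t] d1 d2 d3;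
   try have /= := d1 x; try have /= := d2 y; try have /= := d3 t; lra.
have W0 y t : W 0%N y t = 0 by have /= := D2 0%N y t.+1; rewrite G0; lra.
have V0 x t : V x 0%N t = 0 by have /= := D3 x.+1 0%N t; rewrite G0; lra.
have U0 x y : U x y 0%N = 0 by have /= := D2 x.+1 y 0%N; rewrite G0; lra.
have V1 x y t : V x y.+1 t = - W x.+1 y t by have /= := D3 x.+1 y.+1 t; rewrite G0; lra.
have U1 x y t : U x y t.+1 = W x.+1 y t by have /= := D2 x.+1 y t.+1; rewrite G0; lra.
move=> a b c; have [x xE] := parity_ex a; have [y yE] := parity_ex b; have [t tE] := parity_ex c.
rewrite /insert /lift_odd; case: xE => ->; case: yE => ->; case: tE => ->.
- rewrite -[z _ _ _]/(G x y t) G0.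
  by case: x => [|x]; case: y => [|y]; case: t => [|t]; simp_parity.
- by rewrite zs; [case: x => [|x]; case: y => [|y] |]; simp_parity.
- by rewrite zs; [case: x => [|x]; case: t => [|t] |]; simp_parity.
- by rewrite -[z _ _ _]/(W x y t); case: x => [|x]; rewrite ?W0 /W; simp_parity.
- by rewrite zs; [case: y => [|y]; case: t => [|t] |]; simp_parity.
- by rewrite -[z _ _ _]/(V x y t); case: y => [|y]; rewrite ?V0 ?V1 /W; simp_parity.
- by rewrite -[z _ _ _]/(U x y t); case: t => [|t]; rewrite ?U0 ?U1 /W; simp_parity.
- by rewrite zs; simp_parity.
Qed.

End Insertion.

Import Num.Theory.

(** * Homology *)

Section Relations.
Variables m N : nat.
Notation e := (m + N)%N.

Lemma cl_swap_ab a b c p q : (p <= 1)%N -> (q <= 1)%N ->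
  cl m N (b, a, c, p, q) = (-1) ^+ (N.+1 + e * (a * b)) *: cl m N (a, b, c, p, q).
Proof.
move=> p1 q1; have [g [M [vM tM]]] := realizable_all a b c p1 q1.
have [vS sS] := swap_abP m N vM; move: (clE m N vS).
by rewrite sS -scalerA (clE m N vM) /mtype /=; case: tM => -> -> -> -> -> <-.
Qed.

Lemma cl_swap_bc a b c p q : (p <= 1)%N -> (q <= 1)%N ->
  cl m N (a, c, b, p, q) = (-1) ^+ (N.+1 + e * (b * c)) *: cl m N (a, b, c, p, q).
Proof.
move=> p1 q1; have [g [M [vM tM]]] := realizable_all a b c p1 q1.
have [vS sS] := swap_bcP m N vM; move: (clE m N vS).
by rewrite sS -scalerA (clE m N vM) /mtype /=; case: tM => -> -> -> -> -> <-.
Qed.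

Lemma cl_reverse a b c p q : (p <= 1)%N -> (q <= 1)%N ->
  cl m N (a, b, c, q, p) = (-1) ^+ revexp m N a b c p q *: cl m N (a, b, c, p, q).
Proof.
move=> p1 q1; have [g [M [vM tM]]] := realizable_all a b c p1 q1.
have [vS sS] := reverseP m N vM; move: (clE m N vS).
by rewrite sS -scalerA (clE m N vM) /mtype /= !size_rsteps; case: tM => -> -> -> -> -> <-.
Qed.

Lemma revexp_ba a b c p q : revexp m N b a c p q = revexp m N a b c p q.
Proof. by rewrite /revexp; lia. Qed.

Lemma revexp_cb a b c p q : revexp m N a c b p q = revexp m N a b c p q.
Proof. by rewrite /revexp; lia. Qed.

End Relations.

(** * Chains as coefficient functions *)

Section Presentation.
Variables m N k : nat.
Notation e := (m + N)%N.
Implicit Types z w : coefs.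

(* Of the two generators of defect 1 that the reversal exchanges, [gen 1] is the one
   with the hair at Q. *)
Definition gen i a b c : graph_space m N :=
  cl m N (a, b, c, nat_of_bool (1 < i)%N, nat_of_bool (0 < i)%N).

Definition chain_of i z : graph_space m N :=
  \sum_(a < k.+1) \sum_(b < k.+1) \sum_(c < k.+1) z a b c *: gen i a b c.

Definition supported i z := forall a b c, (a + b + c + i)%N <> k -> z a b c = 0.

(* In defects 0 and 2 the reversal multiplies a generator by a sign, which has to be +1
   for the generator to be non-zero. *)
Definition unreversed i a b c :=
  (i == 1)%N || ~~ odd (revexp m N a b c (1 < i)%N (0 < i)%N).

(** The conditions remove the ambiguities of a coefficient function: values outside the Hodge
    degree, values on generators killed by the reversal, and permutations of the paths. *)
Definition normal i z := [/\ supported i z,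
  forall a b c, ~~ unreversed i a b c -> z a b c = 0 & equiv e N.+1 z].

(** The reversal fixes the type and acts by -1, so twice the generator is 0. *)
Lemma gen_reversed i a b c : (i < 3)%N -> ~~ unreversed i a b c -> gen i a b c = 0.
Proof.
move=> i3; rewrite negb_or negbK => /andP[i1 r].
have E : (1 < i)%N = (0 < i)%N by case: i i3 i1 {r} => [|[|[|]]].
have := @cl_reverse m N a b c (1 < i)%N (1 < i)%N (leq_b1 _) (leq_b1 _).
rewrite -E in r; rewrite /gen -E -signr_odd r expr1 scaleN1r => /eqP.
by rewrite -addr_eq0 -mulr2n -scaler_nat scaler_eq0 => /orP[//|/eqP].
Qed.

Lemma chain_of_ext i z w : (i < 3)%N ->
  (forall a b c, unreversed i a b c -> z a b c = w a b c) -> chain_of i z = chain_of i w.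
Proof.
move=> i3 zw; apply: eq_bigr => a _; apply: eq_bigr => b _; apply: eq_bigr => c _.
by have [/zw ->//|/(gen_reversed i3) ->] := boolP (unreversed i a b c); rewrite !scaler0.
Qed.

Lemma chain_of0 i z : (forall a b c, z a b c = 0) -> chain_of i z = 0.
Proof. by move=> z0; do 3![apply: big1 => ? _]; rewrite z0 scale0r. Qed.

Lemma chain_of_linear i x z w :
  chain_of i (fun a b c => x * z a b c + w a b c) = x *: chain_of i z + chain_of i w.
Proof.
rewrite /chain_of scaler_sumr -big_split; apply: eq_bigr => a _ /=.
rewrite scaler_sumr -big_split; apply: eq_bigr => b _ /=.
rewrite scaler_sumr -big_split; apply: eq_bigr => c _ /=.
by rewrite scalerDl scalerA.
Qed.

Lemma chain_ofZ i x z : chain_of i (fun a b c => x * z a b c) = x *: chain_of i z.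
Proof.
rewrite -[RHS]addr0 -(@chain_of0 i (fun _ _ _ => 0)) // -chain_of_linear.
by apply: eq_bigr => a _; apply: eq_bigr => b _; apply: eq_bigr => c _; rewrite addr0.
Qed.

Lemma gen_swap_ab i a b c : gen i b a c = (-1) ^+ (N.+1 + e * (a * b)) *: gen i a b c.
Proof. by apply: cl_swap_ab; apply: leq_b1. Qed.

Lemma gen_swap_bc i a b c : gen i a c b = (-1) ^+ (N.+1 + e * (b * c)) *: gen i a b c.
Proof. by apply: cl_swap_bc; apply: leq_b1. Qed.

Lemma chain_of_swap1 i z : chain_of i (swap1 e N.+1 z) = chain_of i z.
Proof.
rewrite /chain_of [RHS]exchange_big /=.
apply: eq_bigr => a _; apply: eq_bigr => b _; apply: eq_bigr => c _.
by rewrite (gen_swap_ab i a b c) scalerA /swap1 mulrC.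
Qed.

Lemma chain_of_swap2 i z : chain_of i (swap2 e N.+1 z) = chain_of i z.
Proof.
apply: eq_bigr => a _; rewrite [RHS]exchange_big /=.
apply: eq_bigr => b _; apply: eq_bigr => c _.
by rewrite (gen_swap_bc i a b c) scalerA /swap2 mulrC.
Qed.

Lemma chain_of_average i z : chain_of i (average e N.+1 z) = chain_of i z.
Proof.
have -> : chain_of i (average e N.+1 z) = chain_of i (fun a b c => 6%:R^-1 * (1 * z a b c +
  (1 * swap1 e N.+1 z a b c + (1 * swap2 e N.+1 z a b c + (1 * swap1 e N.+1 (swap2 e N.+1 z) a b c +
  (1 * swap2 e N.+1 (swap1 e N.+1 z) a b c + swap1 e N.+1 (swap2 e N.+1 (swap1 e N.+1 z)) a b c)))))).
  by apply: eq_bigr => a _; apply: eq_bigr => b _; apply: eq_bigr => c _; rewrite /average mulrC !mul1r !addrA.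
rewrite chain_ofZ !chain_of_linear !(chain_of_swap1, chain_of_swap2) !scale1r.
move: (chain_of i z) => x; have -> : x + (x + (x + (x + (x + x)))) = 6%:R *: x.
  by rewrite scaler_nat !mulrS mulr0n addr0.
by rewrite scalerA mulVf ?scale1r.
Qed.

Lemma chain_of_single i x a b c : (a <= k)%N -> (b <= k)%N -> (c <= k)%N ->
  chain_of i (fun a' b' c' => if [&& a' == a, b' == b & c' == c]%N then x else 0) = x *: gen i a b c.
Proof.
move=> ak bk ck; rewrite /chain_of.
rewrite (bigD1 (Ordinal (ak : (a < k.+1)%N))) //= [X in _ + X]big1 ?addr0.
  rewrite (bigD1 (Ordinal (bk : (b < k.+1)%N))) //= [X in _ + X]big1 ?addr0.
    rewrite (bigD1 (Ordinal (ck : (c < k.+1)%N))) //= [X in _ + X]big1 ?addr0.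
      by rewrite !eqxx.
    move=> c'; rewrite -val_eqE /= => /negbTE->; by rewrite !andbF scale0r.
  move=> b'; rewrite -val_eqE /= => /negbTE->; apply: big1 => c' _.
  by rewrite andbF scale0r.
move=> a'; rewrite -val_eqE /= => /negbTE->; do 2![apply: big1 => ? _].
by rewrite scale0r.
Qed.

Lemma unreversed_ba i a b c : unreversed i b a c = unreversed i a b c.
Proof. by rewrite /unreversed (revexp_ba m N a b). Qed.

Lemma unreversed_cb i a b c : unreversed i a c b = unreversed i a b c.
Proof. by rewrite /unreversed (revexp_cb m N a b). Qed.

Lemma hairy_gen_ex i x : (i < 3)%N -> hairy_complex k i x ->
  exists z, supported i z /\ x = chain_of i z.
Proof.
move=> i3; move: x; apply: span_min.
  by exists (fun _ _ _ => 0); split=> //; rewrite chain_of0.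
move=> s _ y [g [tl hk dg] ->] [w [sw ->]].
have [M vM] := marking_exists tl.
have [u [[[a b] c] [abck gE]]] : exists u abc, (abc.1.1 + abc.1.2 + abc.2 + i = k)%N /\
    cls m N g = u *: gen i abc.1.1 abc.1.2 abc.2.
  have := card_ext vM; rewrite hk !size_cat size_map !size_cat => kE.
  have := defect_marking vM; rewrite dg => iE.
  have [P1 Q1] := (validsP vM, validsQ vM).
  have kE' : (size (pa M).2 + size (pb M).2 + size (pc M).2 + i = k)%N by lia.
  rewrite (cls_cl m N vM) /mtype.
  (* A generator of defect 1 with its hair at P is turned into [gen 1] by the reversal. *)
  have [i1|i1] := boolP ((size (hP M) == 1%N) && (size (hQ M) == 0%N)).
    exists (sgn m N M * (-1) ^+ revexp m N (size (pa M).2) (size (pb M).2) (size (pc M).2) 0 1).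
    exists (size (pa M).2, size (pb M).2, size (pc M).2); split=> //=.
    have {}iE : i = 1%N by lia.
    by case/andP: i1 => /eqP-> /eqP->; rewrite /gen iE /= -(scalerA (sgn m N M)) -cl_reverse.
  exists (sgn m N M), (size (pa M).2, size (pb M).2, size (pc M).2); split=> //=.
  rewrite /gen; congr (_ *: cl m N (_, _, _, _, _)); lia.
exists (fun a' b' c' => s * (if [&& a' == a, b' == b & c' == c]%N then u else 0) + w a' b' c').
split=> [a' b' c' h|].
  rewrite sw //; case: ifP => [/and3P[/eqP aE /eqP bE /eqP cE]|_]; last by rewrite mulr0 addr0.
  by case: h; rewrite aE bE cE.
rewrite chain_of_linear chain_of_single ?gE //=; move: abck => /=; lia.
Qed.

Lemma normal_form i x : (i < 3)%N -> hairy_complex k i x ->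
  exists z, normal i z /\ x = chain_of i z.
Proof.
move=> i3 /(hairy_gen_ex i3)[z [sz ->]].
exists (fun a b c => if unreversed i a b c then average e N.+1 z a b c else 0).
have [e1 e2] := equiv_average e N.+1 z.
split; last first.
  rewrite -chain_of_average; by apply: chain_of_ext => // a b c ->.
split=> [a b c h|a b c /negbTE->//|].
  case: ifP => // _; rewrite /average /swap1 /swap2 !sz ?mulr0 ?addr0 ?mul0r //; lia.
split=> a b c; [rewrite (unreversed_ba i a b c)|rewrite (unreversed_cb i a b c)].
  by case: ifP => _; [exact: e1|rewrite mulr0].
by case: ifP => _; [exact: e2|rewrite mulr0].
Qed.


Lemma hairy_gen i a b c : (0 < k)%N -> (i < 3)%N -> (a + b + c + i = k)%N ->
  hairy_complex k i (gen i a b c).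
Proof.
move=> k0 i3 abc.
have [g [M [vM tM]]] := realizable_all a b c (leq_b1 (1 < i)%N) (leq_b1 (0 < i)%N).
rewrite /gen -tM -clE //; rewrite -[_ *: _]addr0; apply: spanD; last exact: span0.
case: tM => sa sb sc sP sQ.
have sE : size (hairs M) = k by rewrite !size_cat size_map !size_cat sa sb sc sP sQ; lia.
exists g => //; split.
- by apply: (two_loop_marking vM); rewrite sE.
- by rewrite (card_ext vM).
- by rewrite (defect_marking vM) sP sQ; lia.
Qed.

Lemma hairy_chain_of i z : (0 < k)%N -> (i < 3)%N -> supported i z ->
  hairy_complex k i (chain_of i z).
Proof.
move=> k0 i3 sz.
have add x y : hairy_complex k i x -> hairy_complex k i y -> hairy_complex k i (x + y).
  by move=> hx hy; rewrite -[x]scale1r; apply: span_submod.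
have zero : @hairy_complex m N k i 0 by apply: span0.
rewrite /chain_of; elim/big_ind: _ => [||a _]; [exact: zero|exact: add|].
elim/big_ind: _ => [||b _]; [exact: zero|exact: add|].
elim/big_ind: _ => [||c _]; [exact: zero|exact: add|].
have [/eqP abc|/eqP/sz->] := boolP (a + b + c + i == k)%N; last by rewrite scale0r.
by rewrite -[_ *: _]addr0; apply: span_submod => //; apply: hairy_gen.
Qed.

(** The normality of z is what makes X compatible with the three symmetries, so z itself induces a
    functional. Its value on the chain is the sum of the squares of the values of z, and a vanishing
    sum of rational squares has vanishing terms. *)
Lemma normal_inj i z : (i < 3)%N -> normal i z -> chain_of i z = 0 ->
  forall a b c, z a b c = 0.
Proof.
move=> i3 [sz gz [z1 z2]] cz0.
pose X (t : nat * nat * nat * nat * nat) : rat := let: (a, b, c, p, q) := t in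
  if (p == (1 < i)%N) && (q == (0 < i)%N) then z a b c else
  if (q == (1 < i)%N) && (p == (0 < i)%N) then (-1) ^+ revexp m N a b c p q * z a b c else 0.
have revC a b c p q : revexp m N a b c q p = revexp m N a b c p q by rewrite /revexp; lia.
have Xab a b c p q : X (b, a, c, p, q) = (-1) ^+ (N.+1 + e * (a * b)) * X (a, b, c, p, q).
  by rewrite /X; case: ifP => _; [|case: ifP => _]; rewrite ?mulr0 // z1 // (revexp_ba m N a b) mulrCA.
have Xbc a b c p q : X (a, c, b, p, q) = (-1) ^+ (N.+1 + e * (b * c)) * X (a, b, c, p, q).
  by rewrite /X; case: ifP => _; [|case: ifP => _]; rewrite ?mulr0 // z2 // (revexp_cb m N a b) mulrCA.
have Xrev a b c p q : X (a, b, c, q, p) = (-1) ^+ revexp m N a b c p q * X (a, b, c, p, q).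
  rewrite /X revC.
  have [/andP[/eqP qE /eqP pE]|n1] := boolP ((q == (1 < i)%N) && (p == (0 < i)%N)).
    have [/andP[/eqP pE' /eqP qE']|n2] := boolP ((p == (1 < i)%N) && (q == (0 < i)%N)).
      (* Both conditions hold together only in defect 0 or 2, with p = q; there z vanishes wherever
         the reversal sign is -1. *)
      have [odd0|odd1] := boolP (odd (revexp m N a b c p q)); last first.
        by rewrite -signr_odd (negbTE odd1) mul1r.
      rewrite gz ?mulr0 // /unreversed negb_or negbK -pE' -pE [revexp _ _ _ _ _ _ _](_ : _ = revexp m N a b c p q).
        rewrite odd0 andbT; apply/eqP => i1; move: pE pE'; rewrite i1 => -> //.
      by rewrite {2}pE -qE'.
    by rewrite mulrA sign_sqr mul1r.
  by case: ifP; rewrite ?mulr0.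
have [F [Flin FE]] := functional_exists Xab Xbc Xrev.
have F0 : F 0 = 0 by have := Flin 1 0 0; rewrite scaler0 addr0 mul1r; lra.
have FZ x u : F (x *: u) = x * F u by rewrite -[_ *: _]addr0 Flin F0 addr0.
have FD u v : F (u + v) = F u + F v by rewrite -[u]scale1r Flin mul1r scale1r.
have Fgen a b c : F (gen i a b c) = z a b c.
  have [g [M [vM tM]]] := realizable_all a b c (leq_b1 (1 < i)%N) (leq_b1 (0 < i)%N).
  by rewrite /gen -tM -clE // FE // tM /X !eqxx.
have : \sum_(a < k.+1) \sum_(b < k.+1) \sum_(c < k.+1) z a b c * z a b c = 0.
  transitivity (F (chain_of i z)); last by rewrite cz0.
  rewrite /chain_of (big_morph F FD F0); apply: eq_bigr => a _.
  rewrite (big_morph F FD F0); apply: eq_bigr => b _.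
  by rewrite (big_morph F FD F0); apply: eq_bigr => c _; rewrite FZ Fgen.
have pos (x : rat) : 0 <= x * x by rewrite -expr2 sqr_ge0.
move=> /eqP; rewrite psumr_eq0 => [/allP h1|a _]; last by do 2![apply: sumr_ge0 => ? _].
move=> a b c; have [abc|/eqP/sz//] := boolP (a + b + c + i == k)%N.
have [ak bk ck] : [/\ (a < k.+1)%N, (b < k.+1)%N & (c < k.+1)%N] by split; lia.
have := h1 (Ordinal ak) (mem_index_enum _); rewrite /= psumr_eq0 => [/allP h2|? _]; last by apply: sumr_ge0 => ? _.
have := h2 (Ordinal bk) (mem_index_enum _); rewrite /= psumr_eq0 => [/allP h3|? _]; last exact: pos.
by have := h3 (Ordinal ck) (mem_index_enum _); rewrite /= mulf_eq0 orbb => /eqP.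
Qed.

End Presentation.

Lemma sum_shift (V : zmodType) n (f : nat -> V) : f n = 0 ->
  \sum_(i < n.+1) (if val i is i'.+1 then f i' else 0) = \sum_(i < n.+1) f i.
Proof. by move=> fn; rewrite big_ord_recl add0r big_ord_recr /= fn addr0. Qed.

(** Summation by parts: lengthening moves from the generators to the coefficients. The bound on the
    support keeps the shifted terms within the range of summation. *)
Lemma insert_sum (V : lmodType rat) e k (G : nat -> nat -> nat -> V) (z : coefs) :
  (forall a b c, (k <= a + b + c)%N -> z a b c = 0) ->
  \sum_(a < k.+1) \sum_(b < k.+1) \sum_(c < k.+1) insert e z a b c *: G a b c =
  \sum_(a < k.+1) \sum_(b < k.+1) \sum_(c < k.+1) z a b c *:
    ((-1) ^+ (e * a) *: G a.+1 b c + (-1) ^+ (e * (a + b)) *: G a b.+1 c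
     + (-1) ^+ (e * (a + b + c)) *: G a b c.+1).
Proof.
move=> z0.
pose S3 (f : nat -> nat -> nat -> V) := \sum_(a < k.+1) \sum_(b < k.+1) \sum_(c < k.+1) f a b c.
have S3D f g : S3 (fun a b c => f a b c + g a b c) = S3 f + S3 g.
  rewrite /S3 -big_split; apply: eq_bigr => a _; rewrite -big_split; apply: eq_bigr => b _.
  by rewrite -big_split.
pose f1 a b c := ((-1) ^+ (e * a) * z a b c) *: G a.+1 b c.
pose f2 a b c := ((-1) ^+ (e * (a + b)) * z a b c) *: G a b.+1 c.
pose f3 a b c := ((-1) ^+ (e * (a + b + c)) * z a b c) *: G a b c.+1.
transitivity (S3 f1 + S3 f2 + S3 f3); last first.
  rewrite -(S3D f1 f2) -(S3D _ f3); apply: eq_bigr => a _; apply: eq_bigr => b _; apply: eq_bigr => c _; rewrite /f1 /f2 /f3 !scalerDr !scalerA.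
  by rewrite ![z a b c * _]mulrC.
transitivity (S3 (fun a b c => (if a is a'.+1 then f1 a' b c else 0) +
    (if b is b'.+1 then f2 a b' c else 0) + (if c is c'.+1 then f3 a b c' else 0))).
  apply: eq_bigr => a _; apply: eq_bigr => b _; apply: eq_bigr => c _; rewrite /insert !scalerDl; congr (_ + _ + _).
  - by case: (nat_of_ord a); rewrite ?scale0r.
  - by case: (nat_of_ord b); rewrite ?scale0r.
  - by case: (nat_of_ord c); rewrite ?scale0r.
rewrite !S3D; congr (_ + _ + _).
- rewrite /S3 -(sum_shift (f := fun a => \sum_(b < k.+1) \sum_(c < k.+1) f1 a b c)).
    apply: eq_bigr => -[[|a] ?] _ //=; apply: big1 => b _; exact: big1.
  by apply: big1 => b _; apply: big1 => c _; rewrite /f1 z0 ?mulr0 ?scale0r //; lia.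
- apply: eq_bigr => a _; rewrite -(sum_shift (f := fun b => \sum_(c < k.+1) f2 a b c)).
    apply: eq_bigr => -[[|b] ?] _ //=; exact: big1.
  by apply: big1 => c _; rewrite /f2 z0 ?mulr0 ?scale0r //; lia.
- apply: eq_bigr => a _; apply: eq_bigr => b _; rewrite -(sum_shift (f := fun c => f3 a b c)) //.
  by rewrite /f3 z0 ?mulr0 ?scale0r //; lia.
Qed.

(** * The differential on coefficient functions *)

Section Boundary.
Variables m N k : nat.
Notation e := (m + N)%N.
Implicit Types z : coefs.
Notation sg n := ((-1) ^+ n : rat).

Lemma boundary_chain1 z : supported k 1 z ->
  boundary (chain_of m N k 1 z) = sg (kap m N 0) *: chain_of m N k 0 (insert e z).
Proof.
move=> sz; rewrite /chain_of (insert_sum _ (k := k)) => [|a b c h]; last by apply: sz; lia.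
rewrite linear_sum scaler_sumr; apply: eq_bigr => a _.
rewrite linear_sum scaler_sumr; apply: eq_bigr => b _.
rewrite linear_sum scaler_sumr; apply: eq_bigr => c _.
have [g [M [vM tM]]] := @realizable_all a b c 0 1 erefl erefl.
by rewrite linearZ /= scalerA mulrC -scalerA /gen /= (boundary_cl_Q m N vM tM).
Qed.

(** The factor 2 is 1 plus the reversal sign, which is +1 wherever z may be non-zero. The sign
    inside rewrites generators with the hair at P as [gen 1]. *)
Lemma boundary_chain2 z : supported k 2 z ->
  (forall a b c, ~~ unreversed m N 2 a b c -> z a b c = 0) ->
  boundary (chain_of m N k 2 z) = (2%:R * sg (kap m N 1)) *:
    chain_of m N k 1 (fun a b c => sg (revexp m N a b c 0 1) * insert e z a b c).
Proof.
move=> sz gz; pose G a b c := cl m N (a, b, c, 1, 0)%N.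
have -> : chain_of m N k 1 (fun a b c => sg (revexp m N a b c 0 1) * insert e z a b c) =
    \sum_(a < k.+1) \sum_(b < k.+1) \sum_(c < k.+1) insert e z a b c *: G a b c.
  apply: eq_bigr => a _; apply: eq_bigr => b _; apply: eq_bigr => c _.
  by rewrite /G (@cl_reverse m N a b c 0 1) // scalerA mulrC.
rewrite /chain_of (insert_sum _ (k := k)) => [|a b c h]; last by apply: sz; lia.
rewrite linear_sum scaler_sumr; apply: eq_bigr => a _.
rewrite linear_sum scaler_sumr; apply: eq_bigr => b _.
rewrite linear_sum scaler_sumr; apply: eq_bigr => c _.
have [un|/gz->] := boolP (unreversed m N 2 a b c); last by rewrite !scale0r linear0 scaler0.
have [g [M [vM tM]]] := @realizable_all a b c 1 1 erefl erefl.
rewrite linearZ /= /gen /= (boundary_cl_PQ m N vM tM).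
move: un; rewrite /unreversed /= => /negbTE un; rewrite -[sg (revexp m N a b c 1 1)]signr_odd un expr0.
by rewrite scalerA [RHS]scalerA !scalerA; congr (_ *: _); ring.
Qed.

End Boundary.

(** * Vanishing in each case *)

Section Vanishing.
Variables m N k : nat.
Hypothesis k_gt0 : (0 < k)%N.
Implicit Types z : coefs.
Notation e := (m + N)%N.
Notation sg n := ((-1) ^+ n : rat).

Lemma odd_bin2 a : odd 'C(a, 2) = odd a./2.
Proof. by elim: a => // a IH; rewrite binS bin1 oddD IH; lia. Qed.

(** The halves add up to half of a + b + c minus the number of odd entries, so the reversal sign
    depends only on that number and on a + b + c modulo 4. *)
Lemma odd_revexp a b c p q : odd e ->
  odd (revexp m N a b c p q) = odd (a + b + c + (a./2 + b./2 + c./2)).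
Proof. by rewrite /revexp; move: (m + N)%N => d od; rewrite !(oddD, oddM, oddS) od /= !odd_bin2 addbF. Qed.

Lemma even_revexp a b c : ~~ odd e -> odd (revexp m N a b c 0 0) = odd (a + b + c).
Proof. by rewrite /revexp; move: (m + N)%N => d /negbTE od; rewrite !(oddD, oddM, oddS) od /= !addbF. Qed.

Lemma supported_insert i z : supported k i.+1 z -> supported k i (insert e z).
Proof.
move=> sz a b c h; rewrite /insert.
by case: a h => [|a] h; case: b h => [|b] h; case: c h => [|c] h;
  rewrite ?sz ?mulr0 ?addr0 //; lia.
Qed.

Lemma supportedZ i r z : supported k i z -> supported k i (fun a b c => r a b c * z a b c).
Proof. by move=> sz a b c h; rewrite sz ?mulr0. Qed.

Lemma equivZ s (r : coefs) z :
    (forall a b c, r b a c = r a b c) -> (forall a b c, r a c b = r a b c) ->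
  equiv e s z -> equiv e s (fun a b c => r a b c * z a b c).
Proof. by move=> r1 r2 [z1 z2]; split=> a b c; [rewrite r1 z1|rewrite r2 z2]; rewrite mulrCA. Qed.

Lemma homology2_zero : ~ homology_nonzero m N k 2.
Proof.
case=> x [hx [//|dx]]; apply; rewrite /is_boundary /=.
have [z [nz xE]] := @normal_form m N k 2 x isT hx; have [sz gz ez] := nz.
rewrite xE chain_of0 // => a b c.
pose w a b c := sg (revexp m N a b c 0 1) * insert e z a b c.
have nw : normal m N k 1 w.
  split=> //; first exact/supportedZ/supported_insert.
  by apply: equivZ (equiv_insert ez) => a' b' c'; [rewrite (revexp_ba m N a' b')|rewrite (revexp_cb m N a' b')].
have w0 : forall a b c, w a b c = 0.
  apply: (@normal_inj m N k 1 w isT nw); move: dx; rewrite xE boundary_chain2 // => /eqP.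
  by rewrite scaler_eq0 mulf_eq0 signr_eq0 pnatr_eq0 => /eqP.
apply: (insert_inj (e := e)) => a' b' c'; have /eqP := w0 a' b' c'.
by rewrite mulf_eq0 signr_eq0 => /eqP.
Qed.

(** Being a cycle controls R z only where the generator of defect 0 survives the reversal. The mask
    r removes the other values, which do not affect the chain, and makes the coefficients normal. *)
Lemma insert_cycle z : normal m N k 1 z -> boundary (chain_of m N k 1 z) = 0 ->
  forall a b c, (a + b + c)%N <> k \/ unreversed m N 0 a b c -> insert e z a b c = 0.
Proof.
move=> [sz _ ez] dz a b c [h|un]; first by apply: (supported_insert sz); rewrite addn0.
pose r a b c : rat := if unreversed m N 0 a b c then 1 else 0.
have nw : normal m N k 0 (fun a b c => r a b c * insert e z a b c).
  split; first exact/supportedZ/supported_insert.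
    by move=> a' b' c' /negbTE u; rewrite /r u mul0r.
  by apply: equivZ (equiv_insert ez) => a' b' c'; rewrite /r; [rewrite (unreversed_ba m N 0 a')|rewrite (unreversed_cb m N 0 a' b')].
have := @normal_inj m N k 0 _ isT nw _ a b c; rewrite /r un mul1r; apply.
rewrite -(@chain_of_ext m N k 0 (insert e z)) // => [|a' b' c' ->]; last by rewrite mul1r.
by move: dz; rewrite boundary_chain1 // => /eqP; rewrite scaler_eq0 signr_eq0 => /eqP.
Qed.

(** It is enough to match z on the surviving generators, with a preimage y that may favour one path.
    The global sign s is chosen according to the residue of k. *)
Lemma boundary0_of_insert y z s : supported k 1 y -> s * s = 1 ->
  (forall a b c, unreversed m N 0 a b c -> insert e y a b c = s * z a b c) ->
  is_boundary k 0 (chain_of m N k 0 z).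
Proof.
move=> sy ss yz; exists (chain_of m N k 1 (fun a b c => s * sg (kap m N 0) * y a b c)).
  exact/hairy_chain_of/supportedZ.
rewrite chain_ofZ linearZ /= boundary_chain1 // scalerA -mulrA sign_sqr mulr1 -chain_ofZ.
by apply: chain_of_ext => // a b c /yz->; rewrite mulrA ss mul1r.
Qed.

Lemma boundary1_of_insert y z s : supported k 2 y ->
  (forall a b c, ~~ unreversed m N 2 a b c -> y a b c = 0) -> s * s = 1 ->
  (forall a b c, sg (revexp m N a b c 0 1) * insert e y a b c = s * z a b c) ->
  is_boundary k 1 (chain_of m N k 1 z).
Proof.
move=> sy uy ss yz.
(* 1/2 and the sign undo the scalar of [boundary_chain2]. *)
exists (chain_of m N k 2 (fun a b c => s * (2%:R^-1 * sg (kap m N 1)) * y a b c)).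
  exact/hairy_chain_of/supportedZ.
rewrite chain_ofZ linearZ /= boundary_chain2 // scalerA.
have -> : s * (2%:R^-1 * sg (kap m N 1)) * (2%:R * sg (kap m N 1)) = s.
  by rewrite -mulrA mulrACA mulVf // sign_sqr !mulr1.
rewrite -chain_ofZ; apply: chain_of_ext => // a b c _.
by rewrite yz mulrA ss mul1r.
Qed.

Lemma homology0_zero_even : ~~ odd e -> odd k -> ~ homology_nonzero m N k 0.
Proof.
move=> eo ko [x [hx _]]; apply.
have [z [[sz _ _] ->]] := @normal_form m N k 0 x isT hx.
apply: (@boundary0_of_insert (fun _ _ _ => 0) z 1) => // a b c.
rewrite /unreversed /= even_revexp // => un; rewrite sz; last first.
  by move=> abc; move: un ko; rewrite -abc addn0 => /negbTE->.
by rewrite /insert; case: a {un} => [|a]; case: b => [|b]; case: c => [|c]; rewrite !mulr0 ?addr0.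
Qed.

Lemma homology0_zero_odd0 : odd e -> (k %% 4 = 0)%N -> ~ homology_nonzero m N k 0.
Proof.
move=> eo k4 [x [hx _]]; apply.
have [z [[sz _ _] ->]] := @normal_form m N k 0 x isT hx.
(* The coefficient of an all even triple is placed on the generator that shortens its first non-zero
   entry, so a single term of R y survives; such an entry exists as k > 0. The shortened length is
   odd and what precedes it is 0, whence the sign -1. *)
pose y : coefs := fun a b c =>
  if [&& odd a, ~~ odd b & ~~ odd c] then z a.+1 b c else
  if [&& a == 0%N, odd b & ~~ odd c] then z a b.+1 c else
  if [&& a == 0%N, b == 0%N & odd c] then z a b c.+1 else 0.
have sy : supported k 1 y.
  by move=> a b c h; rewrite /y; do 3?[case: ifP => // _]; rewrite sz //; lia.
apply: (@boundary0_of_insert y z (-1)) => // a b c.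
rewrite /unreversed /= odd_revexp // => un.
have [/eqP abc|/eqP abc] := boolP (a + b + c == k)%N; last first.
  by rewrite (supported_insert sy) ?sz ?mulr0 // addn0.
have [oa ob oc] : [/\ ~~ odd a, ~~ odd b & ~~ odd c] by split; lia.
have : (0 < a + b + c)%N by rewrite abc.
rewrite /insert /y; case: a oa {abc un} => [|a]; case: b ob => [|b]; case: c oc => [|c] //=;
  rewrite ?negbK => oc ob oa _; rewrite ?oa ?ob ?oc /= ?mulr0 ?addr0 ?add0r sign_e //=
    ?oddD ?oa ?ob ?oc //.
Qed.

Lemma homology0_zero_odd1 : odd e -> (k %% 4 = 1)%N -> ~ homology_nonzero m N k 0.
Proof.
move=> eo k4 [x [hx _]]; apply.
have [z [[sz _ _] ->]] := @normal_form m N k 0 x isT hx.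
(* With all entries odd, the first one can always be shortened; the shortened length is even, whence
   the sign +1. *)
pose y : coefs := fun a b c => if [&& ~~ odd a, odd b & odd c] then z a.+1 b c else 0.
have sy : supported k 1 y.
  by move=> a b c h; rewrite /y; case: ifP => // _; rewrite sz //; lia.
apply: (@boundary0_of_insert y z 1) => // a b c.
rewrite /unreversed /= odd_revexp // => un.
have [/eqP abc|/eqP abc] := boolP (a + b + c == k)%N; last first.
  by rewrite (supported_insert sy) ?sz ?mulr0 // addn0.
have [oa ob oc] : [/\ odd a, odd b & odd c] by split; lia.
rewrite /insert /y; case: a oa {abc un} => [|a]; case: b ob => [|b]; case: c oc => [|c] //= oc ob oa.
by rewrite oa ob oc (negbTE ob) /= ?oa /= !mulr0 !addr0 sign_e // (negbTE oa) expr0.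
Qed.

Lemma homology1_zero_even : ~~ odd e -> ~~ odd k -> ~ homology_nonzero m N k 1.
Proof.
move=> eo ko [x [hx [//|dx]]]; apply; rewrite /is_boundary /=.
have [z [nz xE]] := @normal_form m N k 1 x isT hx; rewrite xE in dx *.
exists 0; first exact: span0.
rewrite linear0 chain_of0 //; apply: (insert_inj (e := e)) => a b c.
apply: (insert_cycle nz dx); have [/eqP abc|/eqP] := boolP (a + b + c == k)%N; [right|by left].
by rewrite /unreversed /= even_revexp // abc.
Qed.

Lemma homology1_zero_odd2 : odd e -> (k %% 4 = 2)%N -> ~ homology_nonzero m N k 1.
Proof.
move=> eo k4 [x [hx [//|dx]]]; apply.
have [z [nz xE]] := @normal_form m N k 1 x isT hx; rewrite xE in dx *.
have [sz _ _] := nz.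
have zE : forall a b c, z a b c = insert e (lift_even z) a b c.
  apply: insert_even => // [a b c o|a b c o]; first by apply: sz; lia.
  (* At sum k and with exactly two odd entries the reversal sign is +1, so the cycle condition
     applies. *)
  apply: (insert_cycle nz dx); have [/eqP abc|/eqP] := boolP (a + b + c == k)%N; [right|by left].
  by rewrite /unreversed /= odd_revexp //; lia.
have sl : supported k 2 (lift_even z).
  by move=> a b c h; rewrite /lift_even; case: ifP => // _; rewrite sz //; lia.
(* z lives on triples with exactly one odd entry and sum k - 1, which is 1 modulo 4; there the sign
   [revexp m N a b c 0 1] is odd, whence the global factor -1. *)
apply: (@boundary1_of_insert (lift_even z) z (-1)) => // [a b c|a b c]; last first.
- rewrite -zE; have [/eqP abc|/eqP/sz->] := boolP (a + b + c + 1 == k)%N; last by rewrite !mulr0.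
  have [o|o] := boolP (odd (revexp m N a b c 0 1)); first by rewrite -signr_odd o.
  have [oa ob oc] : [/\ odd a, odd b & odd c] by move: o; rewrite odd_revexp // => o; split; lia.
  by rewrite zE /insert /lift_even; case: a oa {abc o} => [|a]; case: b ob => [|b]; case: c oc => [|c] //= oc ob oa;
    rewrite ?oa ?ob ?oc /= ?orbT ?mulr0 ?addr0 ?mulr0.
rewrite /unreversed /= negbK odd_revexp // => o; rewrite /lift_even; case: ifP => // e3.
by rewrite sz //; lia.
Qed.

Lemma homology1_zero_odd3 : odd e -> (k %% 4 = 3)%N -> ~ homology_nonzero m N k 1.
Proof.
move=> eo k4 [x [hx [//|dx]]]; apply.
have [z [nz xE]] := @normal_form m N k 1 x isT hx; rewrite xE in dx *.
have [sz _ _] := nz.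
have zE : forall a b c, z a b c = insert e (lift_odd z) a b c.
  apply: insert_odd => // [a b c o|a b c o]; first by apply: sz; lia.
  apply: (insert_cycle nz dx); have [/eqP abc|/eqP] := boolP (a + b + c == k)%N; [right|by left].
  by rewrite /unreversed /= odd_revexp //; lia.
have sl : supported k 2 (lift_odd z).
  by move=> a b c h; rewrite /lift_odd; case: ifP => // _; rewrite sz ?oppr0 //; lia.
(* z lives on triples with exactly two odd entries and sum k - 1, which is 2 modulo 4; there the
   exponent is even, whence the factor 1. *)
apply: (@boundary1_of_insert (lift_odd z) z 1) => // [a b c|a b c]; last first.
- rewrite -zE; have [/eqP abc|/eqP/sz->] := boolP (a + b + c + 1 == k)%N; last by rewrite !mulr0.
  have [o|o] := boolP (odd (revexp m N a b c 0 1)); last by rewrite -signr_odd (negbTE o).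
  have [oa ob oc] : [/\ ~~ odd a, ~~ odd b & ~~ odd c] by move: o; rewrite odd_revexp // => o; split; lia.
  by rewrite zE /insert /lift_odd; case: a oa {abc o} => [|a]; case: b ob => [|b]; case: c oc => [|c] //= oc ob oa;
    rewrite ?(negbTE oa) ?(negbTE ob) ?(negbTE oc) /= ?andbF ?mulr0 ?addr0 ?mulr0.
rewrite /unreversed /= negbK odd_revexp // => o; rewrite /lift_odd; case: ifP => // e3.
by rewrite sz ?oppr0 //; lia.
Qed.

Lemma homology_zero : ~ homology_nonzero m N k 0 \/ ~ homology_nonzero m N k 1.
Proof.
have [eo|eo] := boolP (odd e); last first.
  have [ko|ko] := boolP (odd k); [left; exact: homology0_zero_even|right; exact: homology1_zero_even].
have : (k %% 4 < 4)%N by rewrite ltn_mod.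
case k4: (k %% 4)%N => [|[|[|[|]]]] // _.
- by left; apply: homology0_zero_odd0.
- by left; apply: homology0_zero_odd1.
- by right; apply: homology1_zero_odd2.
- by right; apply: homology1_zero_odd3.
Qed.

End Vanishing.

Local Close Scope ring_scope.

Theorem mainTheorem9 (m N k : nat) (hm : 0 < m) (hN : 0 < N) (hk : 1 <= k)
    (i j : 'I_3) :
  homology_nonzero m N k i -> homology_nonzero m N k j -> i = j.
Proof.
move=> hi hj; apply: val_inj => /=.
have h2 := homology2_zero (m := m) (N := N) hk.
case: i j hi hj => [[|[|[|//]]] ?] [[|[|[|//]]] ?] //= hi hj; try by case: (homology_zero m N hk).
Qed.
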